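(* For any $\epsilon > 0$ there exists $d_0 \in \mathbb{N}$ such that if $d \geq d_0$ then $\big[ d^{-1} + (\tfrac{7}{6} + \epsilon) d^{-2}, \infty\big) \subseteq \mathscr{T}^{\mathcal{T}_{d}}$.
   Context: $\mathcal{T}_d$ denotes the rooted regular tree each of whose vertices has exactly $d$ offspring (neighbours farther from the root). For a graph $G$, $\mathscr{T}^G$ denotes the set of $T>0$ such that the random stirring model on $G$ with parameter $T$ has infinite cycles (cycles with infinitely many elements) almost surely. The random stirring model with parameter $T$ is the random permutation $\sigma_T$ of $V(G)$, where $(\sigma_t)_{t\ge0}$ starts at the identity and, independently for each edge $e$, the transposition of the endpoints of $e$ is composed at each point of a rate-one Poisson process on $[0,\infty)$. *)

(* Defs.v *)
From HB Require Import structures.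
From mathcomp Require Import all_boot all_order all_algebra.
From mathcomp Require Import all_classical all_reals all_analysis.
Set Implicit Arguments. Unset Strict Implicit. Unset Printing Implicit Defensive.
Import Order.TTheory GRing.Theory Num.Theory.
Local Open Scope classical_set_scope.
Local Open Scope ring_scope.

(* ---------- The rooted d-ary tree T_d ----------
   Vertices: finite words over 'I_d; the root is [::]; the offspring of v
   are the words i :: v (i : 'I_d).  Every non-root vertex v is the lower
   endpoint of exactly one edge, {v, behead v}; we index edges by their
   lower endpoint (the index [::] is never an edge). *)
Definition tvertex (d : nat) := seq 'I_d.

Definition incident (d : nat) (v e : tvertex d) : Prop :=
  (e = v /\ v <> [::]) \/ (exists i : 'I_d, e = i :: v).

Definition other_end (d : nat) (v e : tvertex d) : tvertex d :=
  if e == v then behead v else e.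

(* ---------- Poisson clocks ----------
   A rate-one Poisson process on [0,oo) for edge e is given by its i.i.d.
   Exp(1) inter-arrival times tau (e, k), k = 0, 1, 2, ...;
   its n-th point (n = 0, 1, ...) is tau (e,0) + ... + tau (e,n). *)
Section clocks.
Context {R : realType} {dO : measure_display} {Omega : measurableType dO}.
Variable (P : probability Omega R).

Definition is_exp1 (X : Omega -> R) : Prop :=
  measurable_fun setT X /\
  forall x : R, 0 <= x -> P (X @^-1` `]x, +oo[) = (expR (- x))%:E.

Definition mutually_independent {I : eqType} (X : I -> Omega -> R) : Prop :=
  forall (F : seq I) (B : I -> set R),
    uniq F -> (forall i, measurable (B i)) ->
    P (\big[setI/setT]_(i <- F) (X i @^-1` B i)) =
    (\prod_(i <- F) P (X i @^-1` B i))%E.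

Definition poisson_clocks (d : nat) (tau : tvertex d * nat -> Omega -> R) : Prop :=
  (forall i, is_exp1 (tau i)) /\ mutually_independent tau.
End clocks.

Section stirring.
Context {R : realType} {Omega : Type} (d : nat).
Variable tau : tvertex d * nat -> Omega -> R.

Definition arrival (e : tvertex d) (n : nat) (w : Omega) : R :=
  \sum_(k < n.+1) tau (e, nat_of_ord k) w.

Definition rings (w : Omega) (e : tvertex d) (t : R) : Prop :=
  exists n, arrival e n w = t.

(* The trajectory of a single element under the stirring dynamics: an element
   sitting at v at time s moves across the first edge incident to v that
   rings after time s (at that time t).  *)
Definition jump (w : Omega) (p q : tvertex d * R) : Prop :=
  let (v, s) := p in let (u, t) := q in
  s < t /\
  exists e, [/\ incident v e, rings w e t, u = other_end v e,
    (forall e' t', incident v e' -> rings w e' t' -> s < t' -> t' < t -> False)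
    & (forall e', incident v e' -> rings w e' t -> e' = e)].

Inductive reach (w : Omega) : tvertex d * R -> tvertex d * R -> Prop :=
  | reach_refl p : reach w p p
  | reach_step p q r : jump w p q -> reach w q r -> reach w p r.

Definition stir_rel (T : R) (w : Omega) (x y : tvertex d) : Prop :=
  exists s, [/\ reach w (x, 0) (y, s), s <= T &
    forall u t, jump w (y, s) (u, t) -> T < t].

(* sigma_T (default value x on the null event where it is ill-defined) *)
Definition stir_perm (T : R) (w : Omega) (x : tvertex d) : tvertex d :=
  xget x (stir_rel T w x).

Definition cycle_of (s : tvertex d -> tvertex d) (x : tvertex d) : set (tvertex d) :=
  [set y | exists k : nat, iter k s x = y \/ iter k s y = x].

Definition has_infinite_cycle (s : tvertex d -> tvertex d) : Prop :=
  exists x, infinite_set (cycle_of s x).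
End stirring.

Definition in_TG {R : realType} (d : nat) (T : R) : Prop :=
  0 < T /\
  forall (dO : measure_display) (Omega : measurableType dO)
         (P : probability Omega R) (tau : tvertex d * nat -> Omega -> R),
    poisson_clocks P tau ->
    {ae P, forall w, has_infinite_cycle (stir_perm tau T w)}.

(* Main.v *)
Require Import Defs.
From HB Require Import structures.
From mathcomp Require Import all_boot all_order all_algebra.
From mathcomp Require Import boolp zify ring lra.
Set Implicit Arguments. Unset Strict Implicit. Unset Printing Implicit Defensive.

(** The clocks are discretised into Bernoulli slots of length [T / N ^ 2], placed on
    a circle: following an orbit of the stirring permutation is following a
    deterministic walk in tree x circle, which crosses an edge whenever it carries a bar
    (a ring) at the current slot.  Let [q_n] be the largest probability that the walk
    entering a subtree through a single bar comes back to that bar before descending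
    [n] levels; one needs [q_n <= 1 - c] uniformly in [n] and [N].

    - For [T <= 9 / d], a walk which comes back sweeps the whole circle at the top
      vertex, except for what multiply occupied edges make it skip.  So it must come
      back from every "good" child, whose edge carries a single bar such that all the
      bars of the multiply occupied edges lie on one side of it.  This gives a
      branching recursion [q_(n+1) <= E (q_n ^ Z)] with [Z] the number of good
      children.  With [l = d T] its mean is at least
      [(1 - l / d) (l - l^3 / (6 d) - O(d^-2))], which exceeds [1] as soon as
      [l > 1 + (7/6) / d + O(d^-2)]: the [1] in [7/6 = 1 + 1/6] comes from a second
      bar on the edge, the [1/6] from a pair of bars of another edge that surround it.
    - For [T >= 9 / d], with [f] the probability of coming back when arbitrary further
      bars are added to the entrance edge, the walk must come back from two distinct
      children within a short window of slots, up to an event of probability at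
      most [1 / 4]; thus [f <= 1 / 4 + f ^ 2], which propagates [f <= 1 / 2].

    The [d ^ l] vertices at depth [l] give independent trials, so that almost surely
    some orbit reaches every depth.  Its cycle is infinite: a single vertex reaches only
    finitely many levels before time [T], because below each vertex there is almost
    surely no long descending path with rings at increasing times. *)

(** Time is circular because an element found at a vertex at time [T] is taken up by the next
    iterate of the permutation, which starts at that vertex at time 0. A start at time 0 is treated
    as an entrance through a fictitious bar at the last slot, so that starting a walk and entering a
    subtree become the same event.

    Truncating the depth and cutting time into slots make every probability a finite sum. Nothing is
    lost in law: by the memoryless property of the exponential, the recorded slots are exactly
    independent Bernoulli variables. The price is that slots are not ring times, and greater depth
    requires a finer mesh for the two orders to agree; this is why [c] must be uniform in [n] and
    [N].

    The branching recursion uses only the mean of [Z], through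
    [(1 - x) ^ Z <= 1 - Z x + d ^ 2 x ^ 2]. Hence [c] is the excess of the mean over 1, up to a
    factor of order [d ^ -2]. The threshold [9 / d] between the two regimes leaves room in [[0, T]]
    for the two windows of length about [4 / d] in which two children are sought. *)

Inductive star {S : Type} (r : S -> S -> Prop) (x : S) : S -> Prop :=
  | star_refl : star r x x
  | star_step y z : r x y -> star r y z -> star r x z.

Lemma star_trans (S : Type) (r : S -> S -> Prop) x y z :
  star r x y -> star r y z -> star r x z.
Proof. by elim=> // a b c rab _ IH /IH; apply: star_step. Qed.

Lemma star_rcons (S : Type) (r : S -> S -> Prop) x y z :
  star r x y -> r y z -> star r x z.
Proof. by move=> xy yz; apply: star_trans xy _; apply: star_step yz (star_refl _ _). Qed.

Lemma star_last (S : Type) (r : S -> S -> Prop) x z :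
  star r x z -> x = z \/ exists2 y, star r x y & r y z.
Proof.
elim=> [a|a b c rab bc [<-|[y by_ yc]]]; first by left.
- by right; exists a => //; apply: star_refl.
- by right; exists y => //; apply: star_step rab by_.
Qed.

Lemma star_first (S : Type) (r : S -> S -> Prop) x z :
  star r x z -> x = z \/ exists2 y, r x y & star r y z.
Proof. by case=> [|y a xy ya]; [left|right; exists y]. Qed.

Lemma star_sub (S : Type) (r r' : S -> S -> Prop) x y :
  (forall a b, r a b -> r' a b) -> star r x y -> star r' x y.
Proof. by move=> rr'; elim=> [a|a b c /rr' rab _ IH]; [apply: star_refl|apply: star_step IH]. Qed.

(** * The walk on the circle of slots *)

Section circle.
Variable L : nat.
Implicit Types m s t : 'I_L.+1.

Definition nx m : 'I_L.+1 := inord (if m == L :> nat then 0 else m.+1).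

(* The number of steps of [nx] from [t] to [s]. *)
Definition off t s : nat := if t <= s then s - t else s + L.+1 - t.

Lemma val_nx m : nx m = (if m == L :> nat then 0 else m.+1) :> nat.
Proof. by rewrite inordK //; case: eqP (ltn_ord m) => //; lia. Qed.

Lemma off_lt t s : off t s < L.+1.
Proof. by rewrite /off; have := ltn_ord t; have := ltn_ord s; case: ifP; lia. Qed.

Lemma off_id t : off t t = 0.
Proof. by rewrite /off; case: ifP; lia. Qed.

Lemma off_inj t : injective (off t).
Proof.
move=> s s'; rewrite /off => H; apply: val_inj => /=; move: H.
by have := ltn_ord t; have := ltn_ord s; have := ltn_ord s'; do 2 case: ifP; lia.
Qed.

Lemma off_eq0 t s : (off t s == 0) = (s == t).
Proof. by rewrite -(inj_eq (@off_inj t)) off_id. Qed.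

Lemma off_nx t s : off t (nx s) = if off t s == L then 0 else (off t s).+1.
Proof.
rewrite /off val_nx.
by have := ltn_ord t; have := ltn_ord s; do ! case: ifP; lia.
Qed.

Lemma nx_inj : injective nx.
Proof.
move=> s s' /(congr1 val) /=; rewrite !val_nx => H; apply: val_inj => /=; move: H.
by have := ltn_ord s; have := ltn_ord s'; do 2 case: ifP; lia.
Qed.

Lemma off_surj t a : a < L.+1 -> exists s, off t s = a.
Proof.
move=> aL; have/injF_bij [g gK fK] : injective (fun s : 'I_L.+1 => Ordinal (off_lt t s)).
  by move=> s s' [] /off_inj.
by exists (g (Ordinal aL)); have := fK (Ordinal aL) => /(congr1 val).
Qed.

Lemma off_add t s k : off t s + off s k < L.+1 -> off t k = off t s + off s k.
Proof.
rewrite /off.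
by have := ltn_ord t; have := ltn_ord s; have := ltn_ord k; do 3 case: ifP; lia.
Qed.

Lemma off_last : nx ord_max = ord0 :> 'I_L.+1.
Proof. by apply: val_inj; rewrite /= val_nx /= eqxx. Qed.

Lemma card_off t (P : pred nat) :
  #|[set s : 'I_L.+1 | P (off t s)]| = #|[set a : 'I_L.+1 | P a]|.
Proof.
have inj : injective (fun s : 'I_L.+1 => Ordinal (off_lt t s)) by move=> s s' [] /off_inj.
rewrite -(card_imset _ inj); apply: eq_card => a; rewrite inE.
apply/imsetP/idP => [[s]|Pa]; first by rewrite inE => Ps ->.
have [s os] := off_surj t (ltn_ord a).
by exists s; [rewrite inE os|apply: val_inj].
Qed.

Definition win m K : {set 'I_L.+1} := [set s | 0 < off m s <= K].

Lemma card_win m K : K <= L -> #|win m K| = K.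
Proof.
move=> KL; rewrite (card_off m (fun a => 0 < a <= K)).
rewrite (_ : [set a : 'I_L.+1 | _] = [set inord a.+1 | a : 'I_K]).
  rewrite card_imset ?card_ord // => a b /(congr1 val) /=.
  have := ltn_ord a; have := ltn_ord b => ? ?.
  by rewrite !inordK; [move=> [] /val_inj|lia|lia].
apply/setP => a; rewrite inE; apply/idP/imsetP => [Ha|[b _ ->]].
  have aL : a.-1 < K by lia.
  by exists (Ordinal aL) => //; apply: val_inj; rewrite /= inordK; lia.
by have bL := ltn_ord b; rewrite inordK; lia.
Qed.

Lemma card_before m K : K <= L -> #|[set s | off s m <= K]| <= K.+1.
Proof.
move=> KL; rewrite (_ : [set s | _] = m |: [set s | L - K < off m s]).
  rewrite cardsU1; apply: leq_add (leq_b1 _) _.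
  rewrite (card_off m (fun a => L - K < a)).
  rewrite (_ : [set a : 'I_L.+1 | _] = [set inord (L - a) | a : 'I_K]).
    by rewrite (leq_trans (leq_imset_card _ _)) // card_ord.
  apply/setP => a; rewrite inE; apply/idP/imsetP => [Ha|[b _ ->]].
    have := ltn_ord a => ?; have aL : L - a < K by lia.
    by exists (Ordinal aL) => //; apply: val_inj; rewrite /= inordK; lia.
  by have bL := ltn_ord b; rewrite inordK; lia.
apply/setP => s; rewrite !inE -val_eqE /= /off.
by have := ltn_ord s; have := ltn_ord m; do 2 case: ifP; lia.
Qed.

End circle.

Section walk.
Variables (d L : nat).
Local Notation slot := 'I_L.+1.
Local Notation pat := {set slot}.

(* A configuration of depth [n] gives, for each child [i], the bars [(c i).1] on the
   edge to [i] and the configuration [(c i).2] below [i]. *)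
Fixpoint conf (n : nat) : finType :=
  if n is n'.+1 then {ffun 'I_d -> pat * conf n'} : finType else unit.

(* Breaks the ties between children with a bar at the same slot, a case of vanishing
   probability. *)
Definition first_at (E : 'I_d -> pat) (m : slot) (i : 'I_d) : Prop :=
  m \in E i /\ forall j : 'I_d, j < i -> m \notin E j.

Lemma first_at_inj E m i j : first_at E m i -> first_at E m j -> i = j.
Proof.
move=> [mi Hi] [mj Hj]; apply: val_inj => /=.
by case: (ltngtP i j) => // [/Hj|/Hi]; rewrite ?mi ?mj.
Qed.

Lemma first_at_ex (E : 'I_d -> pat) m i : m \in E i -> exists j, first_at E m j.
Proof.
move=> mi; have := @arg_minnP _ i (fun j : 'I_d => m \in E j) (fun j => j : nat) mi.
case=> j mj Hj; exists j; split=> // k kj; apply/negP => /Hj; lia.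
Qed.

(* One step of the walk at a vertex with bars [B] above it and [E i] on the edge to
   child [i], where [X i] relates the entrance and exit slots of the excursions below
   [i]. *)
Definition cstep (E : 'I_d -> pat) (X : 'I_d -> slot -> slot -> Prop) (B : pat)
    (m m' : slot) : Prop :=
  m \notin B /\
  ((forall i, m \notin E i) /\ m' = nx m \/
   exists i k, [/\ first_at E m i, X i (nx m) k & m' = nx k]).

(* The walk started at slot [m] at the root of [c] leaves for the first time through
   the edge above the root, whose bars are [B], and does so at slot [k] without having
   reached depth [n]; [escapes] is the event of reaching depth [n] before leaving. *)
Fixpoint exits n : conf n -> pat -> slot -> slot -> Prop :=
  match n return conf n -> pat -> slot -> slot -> Prop with
  | 0 => fun _ _ _ _ => False
  | n'.+1 => fun c B m k => k \in B /\
      star (cstep (fun i => (c i).1) (fun i => exits (c i).2 (c i).1) B) m k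
  end.

Fixpoint escapes n : conf n -> pat -> slot -> Prop :=
  match n return conf n -> pat -> slot -> Prop with
  | 0 => fun _ _ _ => True
  | n'.+1 => fun c B m => exists m' i,
      [/\ star (cstep (fun i => (c i).1) (fun i => exits (c i).2 (c i).1) B) m m',
          m' \notin B, first_at (fun i => (c i).1) m' i
        & escapes (c i).2 (c i).1 (nx m')]
  end.

Lemma cstep_det E X B m m1 m2 :
  (forall i m k k', X i m k -> X i m k' -> k = k') ->
  cstep E X B m m1 -> cstep E X B m m2 -> m1 = m2.
Proof.
move=> Xd [_ [[N1 ->]|[i [k [Fi Xi ->]]]]] [_ [[N2 ->]|[j [k' [Fj Xj ->]]]]] //.
- by case: Fj => H; rewrite (negPf (N1 j)) in H.
- by case: Fi => H; rewrite (negPf (N2 i)) in H.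
- by have ij := first_at_inj Fi Fj; subst j; rewrite (Xd _ _ _ _ Xi Xj).
Qed.

Lemma exits_det n (c : conf n) (B : pat) m k k' :
  exits c B m k -> exits c B m k' -> k = k'.
Proof.
elim: n c B m k k' => [//|n IH] c B m k k' /= [kB mk] [k'B mk'].
elim: mk kB mk' => {m k} [m mB mk'|m m1 k s1 _ IH1 kB mk'].
  by case: mk' k'B => [//|y z [/negP[]]].
case: mk' k'B IH1 => [mB|m2 z s2 st zB IH1]; first by case: s1; rewrite mB.
apply: IH1 => //; suff -> : m1 = m2 by [].
by apply: cstep_det s1 s2 => i a b b'; apply: IH.
Qed.

Lemma cstep_sub E X (B B' : pat) m m' : B' \subset B -> cstep E X B m m' -> cstep E X B' m m'.
Proof. by move=> /subsetP BB' [mB H]; split=> //; apply: contra mB => /BB'. Qed.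

(** The walk meets no bar of [B] before its exit, so deleting any bar other than the exit leaves its
    path intact. *)
Lemma exits_sub n (c : conf n) (B B' : pat) m k :
  B' \subset B -> k \in B' -> exits c B m k -> exits c B' m k.
Proof.
case: n c => [//|n] c BB' kB' /= [_ H]; split=> //.
by apply: star_sub H => a b; apply: cstep_sub.
Qed.

(** More bars on the entrance edge can only stop the walk earlier, possibly at another slot:
    returning is monotone in [B]. *)
Lemma exits_super n (c : conf n) (B B' : pat) m k :
  B \subset B' -> exits c B m k -> exists k', exits c B' m k'.
Proof.
case: n c => [//|n] c /subsetP BB' /= [kB].
move=> mk; elim: mk kB => {m k} [m mB|m m1 k s1 _ IH kB].
  by exists m; split; [apply: BB'|apply: star_refl].
have [mB'|mB'] := boolP (m \in B').
  by exists m; split => //; apply: star_refl.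
have [k' [k'B' H]] := IH kB; exists k'; split => //; apply: star_step H.
by case: s1 => _ s1; split.
Qed.

(* Incident edges have no bar at a common slot: the walk is then reversible, and it
   either leaves or escapes. *)
Fixpoint cfree n : conf n -> pat -> Prop :=
  match n return conf n -> pat -> Prop with
  | 0 => fun _ _ => True
  | n'.+1 => fun c B => forall i, [/\ [disjoint B & (c i).1],
       (forall j, j != i -> [disjoint (c j).1 & (c i).1])
       & cfree (c i).2 (c i).1]
  end.

Lemma disjointN (A B : pat) m : [disjoint A & B] -> m \in A -> m \in B -> False.
Proof. by move=> /pred0P /(_ m) /= H mA mB; rewrite mA mB in H. Qed.

Lemma exits_in n (c : conf n) (B : pat) m k : exits c B m k -> k \in B.
Proof. by case: n c => [//|n] c []. Qed.

(** A predecessor of [nx t] would be either [t], where the walk stops, or the start of an excursion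
    returning through a child's bar at [t], which [cfree] excludes. *)
Lemma cstep_entry n (c : conf n.+1) (B : pat) m t : cfree c B -> t \in B ->
  cstep (fun i => (c i).1) (fun i => exits (c i).2 (c i).1) B m (nx t) -> False.
Proof.
move=> cf tB [mB [[_ /nx_inj mt]|[i [k [_ Xi /nx_inj tk]]]]]; first by rewrite -mt tB in mB.
case: (cf i) => D _ _; apply: (disjointN D tB); rewrite tk.
exact: exits_in Xi.
Qed.

Lemma star_inj_total (S : Type) (r : S -> S -> Prop) a b k :
  (forall x y z, r x z -> r y z -> x = y) ->
  star r a k -> star r b k -> star r a b \/ star r b a.
Proof.
move=> rinj ak; elim: ak b => {a k} [a|a a1 k s1 st IH] b; first by right.
move=> bk; case: (IH b bk) => [H|H]; first by left; apply: star_step H.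
case: (star_last H) => [->|[y by_ ya1]]; first by left; apply: star_step s1 (star_refl _ _).
by right; rewrite (rinj _ _ _ s1 ya1).
Qed.

Lemma cstep_inj n (c : conf n.+1) (B : pat) m1 m2 m : cfree c B ->
  (forall i t t' k, t \in (c i).1 -> t' \in (c i).1 ->
    exits (c i).2 (c i).1 (nx t) k -> exits (c i).2 (c i).1 (nx t') k -> t = t') ->
  cstep (fun i => (c i).1) (fun i => exits (c i).2 (c i).1) B m1 m ->
  cstep (fun i => (c i).1) (fun i => exits (c i).2 (c i).1) B m2 m -> m1 = m2.
Proof.
move=> cf IH [_ H1] [_ H2].
case: H1 H2 => [[N1 ->]|[i [k [[Fi _] Xi ->]]]] [[N2 /nx_inj E]|[j [k' [[Fj _] Xj /nx_inj E]]]].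
- by [].
- by have /exits_in := Xj; rewrite -E (negPf (N1 j)).
- by have /exits_in := Xi; rewrite E (negPf (N2 i)).
- subst k'; have [ij|ij] := eqVneq j i.
    by subst j; apply: IH Xi Xj.
  by case: (cf i) => _ /(_ j ij) D _; case: (disjointN D (exits_in Xj) (exits_in Xi)).
Qed.

(** Backwards from the exit the walk is deterministic, so one of the two paths contains the other;
    [cstep_entry] forbids a path to run into an entrance slot. *)
Lemma exits_inj n (c : conf n) (B : pat) t t' k : cfree c B -> t \in B -> t' \in B ->
  exits c B (nx t) k -> exits c B (nx t') k -> t = t'.
Proof.
elim: n c B t t' k => [//|n IH] c B t t' k cf tB t'B /= [kB st] [_ st'].
have sinj : forall x y z,
  cstep (fun i => (c i).1) (fun i => exits (c i).2 (c i).1) B x z ->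
  cstep (fun i => (c i).1) (fun i => exits (c i).2 (c i).1) B y z -> x = y.
  move=> x y z; apply: cstep_inj (cf) _ => i a b m ai bi.
  by case: (cf i) => _ _ ci; apply: IH.
have key a b : b \in B ->
    star (cstep (fun i => (c i).1) (fun i => exits (c i).2 (c i).1) B) (nx a) (nx b) -> a = b.
  move=> bB ab; case: (star_last ab) => [/nx_inj//|[y _ H]].
  by case: (cstep_entry cf bB H).
case: (star_inj_total sinj st st'); first exact: key.
by move=> H; apply/esym; apply: key H.
Qed.

(** In a finite set an endless path must close up, and injectivity lets it close only at [x], which
    has no predecessor. Formally, a successor map would embed the set reachable from [x] into itself
    minus [x]. *)
Lemma star_end (S : finType) (r : S -> S -> Prop) (x : S) :
  (forall a b c, r a c -> r b c -> a = b) -> (forall y, ~ r y x) ->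
  exists2 y, star r x y & forall z, ~ r y z.
Proof.
move=> rinj rx; apply: contrapT => H.
have nxt y : exists z, star r x y -> r y z.
  case: (pselect (star r x y)) => xy; last by exists x => /xy.
  apply: contrapT => Hn; apply: H; exists y => // z ryz.
  by apply: Hn; exists z.
have [f fP] := choice nxt.
pose A := [set y | `[< star r x y >]].
have fA : [set f y | y in A] \subset A :\ x.
  apply/subsetP => u /imsetP[y Ay ->].
  have xy : star r x y by move: Ay; rewrite inE => /asboolP.
  rewrite !inE; apply/andP; split; last by apply/asboolP; apply: star_rcons (fP _ xy).
  by apply/negP => /eqP E; apply: (rx y); have := fP _ xy; rewrite E.
have xA : x \in A by rewrite inE; apply/asboolP; apply: star_refl.
have := subset_leq_card fA; rewrite card_in_imset; last first.
  move=> y z; rewrite !inE => /asboolP /fP ry /asboolP /fP rz E.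
  by rewrite E in ry; apply: rinj ry rz.
by rewrite [X in X <= _](cardsD1 x) xA ltnn.
Qed.

(** By [star_end] the path at the top vertex ends. Outside [B], the only obstacle to a further step
    is a child from which the walk does not return, and there the induction applies. *)
Lemma exits_or_escapes n (c : conf n) (B : pat) t : cfree c B -> t \in B ->
  (exists k, exits c B (nx t) k) \/ escapes c B (nx t).
Proof.
elim: n c B t => [|n IH] c B t cf tB; first by right.
have [||y ty yend] := @star_end _
    (cstep (fun i => (c i).1) (fun i => exits (c i).2 (c i).1) B) (nx t).
- move=> a b m; apply: cstep_inj (cf) _ => i u v k ui vi.
  by case: (cf i) => _ _ ci; apply: exits_inj ci ui vi.
- by move=> y; apply: cstep_entry cf tB.
have [yB|yB] := boolP (y \in B); first by left; exists y.
have [[i yi]|yi] := pselect (exists i, y \in (c i).1); last first.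
  case: (yend (nx y)); split=> //; left; split=> // i.
  by apply/negP => H; apply: yi; exists i.
have [j yj] := first_at_ex (E := fun i => (c i).1) yi.
case: (cf j) (yj) => _ _ /IH cj [/cj [[k jk]|esc] _]; last by right; exists y, j.
by case: (yend (nx k)); split=> //; right; exists j, k.
Qed.

Definition good_single (F : 'I_d -> pat) (t0 : slot) (i : 'I_d) (t : slot) : Prop :=
  [/\ F i = [set t], t != t0, (forall j, j != i -> t \notin F j)
    & (forall j s, 1 < #|F j| -> s \in F j -> ~ (0 < off t0 s < off t0 t)) \/
      (forall j s, 1 < #|F j| -> s \in F j -> ~ (off t0 t < off t0 s))].

Lemma card_le1_eq (A : pat) (s t : slot) :
  ~ (1 < #|A|) -> s \in A -> t \in A -> s = t.
Proof.
move=> /negP; rewrite -leqNgt => A1 sA tA; apply/eqP/negPn/negP => st; move: A1.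
have /subset_leq_card : [set s; t] \subset A.
  by apply/subsetP => u; rewrite !inE => /orP[/eqP->|/eqP->].
by rewrite cards2 st; case: #|A| => [|[|]].
Qed.

(* A walk that enters at [t0] and leaves at [t0] sweeps both the arc before the
   first and the arc after the last bar of the multiply occupied edges. *)
Lemma single_exits n (c : conf n.+1) (t0 : slot) i t :
  exits c [set t0] (nx t0) t0 -> good_single (fun j => (c j).1) t0 i t ->
  exits (c i).2 (c i).1 (nx t) t.
Proof.
set F := fun j => (c j).1; set st := cstep F (fun j => exits (c j).2 (c j).1) [set t0].
move=> [_ path] [Fi tt0 tF arcs].
have ot : 0 < off t0 t by rewrite lt0n off_eq0.
have tFi : t \in (c i).1 by rewrite -/(F i) Fi inE.
case: arcs => arcs.
  (* Forward from the entrance: with no multiply occupied edge in the way, each excursion must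
     return through the bar it entered by. *)
  have fwd a : forall m, off t0 m = a.+1 -> a < off t0 t -> star st m t0.
    elim: a => [|a IH] m om am.
      suff -> : m = nx t0 by [].
      apply: (@off_inj _ t0); rewrite om off_nx off_id.
      by have := off_lt t0 t; case: eqP => //; lia.
    have [s os] : exists s, off t0 s = a.+1.
      by apply: off_surj; have := off_lt t0 m; lia.
    have ms : m = nx s.
      apply: (@off_inj _ t0); rewrite om off_nx os.
      by have := off_lt t0 m; case: eqP => //; lia.
    have /IH : off t0 s = a.+1 by [].
    move=> /(_ (ltnW am)) H; rewrite ms.
    case: (star_first H) => [E|[m1 [_ [[_ ->]//|[j [k [[jm _] Xj ->]]]]] {}H]].
      by move: os; rewrite E off_id.
    suff <- : k = s by [].
    apply: card_le1_eq (exits_in Xj) (jm) => /arcs /(_ jm); apply.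
    by rewrite os.
  have {fwd} H := fwd (off t0 t).-1 t (esym (prednK ot)).
  have {H}: star st t t0 by apply: H; lia.
  move=> H; case: (star_first H) => [E|[m1 [_ [[/(_ i) + _]|[j [k [[jt _] Xj _]]]]] _]].
  - by rewrite E eqxx in tt0.
  - by rewrite tFi.
  - have ji : j = i by apply: contraTeq (jt) => /tF.
    subst j; have kt : k = t by have := exits_in Xj; rewrite -/(F i) Fi inE => /eqP.
    by rewrite kt in Xj.
(* The mirror argument on predecessors, backward from the exit at [t0]; [b] counts the slots from
   [s] to the end of the circle. *)
have bwd b : forall s, off t0 s + b = L -> off t0 t <= off t0 s -> star st (nx t0) (nx s).
  elim: b => [|b IH] s os ts.
    suff -> : nx s = t0 by [].
    by apply: (@off_inj _ t0); rewrite off_nx off_id; case: eqP => //; lia.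
  have ons : off t0 (nx s) = (off t0 s).+1 by rewrite off_nx; case: eqP => //; lia.
  have := IH (nx s); rewrite ons => /(_ ltac:(lia) ltac:(lia)) H.
  case: (star_last H) => [/nx_inj E|[y H1 [_ [[_ /nx_inj ->]//|[j [k [[jy _] Xj /nx_inj E]]]]]]].
    by move: ons; rewrite -E off_id.
  suff -> : nx s = y by [].
  have kF := exits_in Xj.
  rewrite E; apply: card_le1_eq (kF) jy => /arcs /(_ kF); apply.
  by rewrite -E ons; lia.
have := bwd (L - off t0 t) t; have := off_lt t0 t; rewrite ltnS => otL.
move=> /(_ (subnKC otL) (leqnn _)) H.
case: (star_last H) => [/nx_inj E|[y _ [_ [[/(_ i) + /nx_inj E]|[j [k [[jy _] Xj /nx_inj E]]]]]]].
- by rewrite E eqxx in tt0.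
- by rewrite -E tFi.
- have kF := exits_in Xj; rewrite -E in kF Xj.
  have ji : j = i by apply: contraTeq (kF) => /tF.
  subst j; have yt : y = t by move: jy; rewrite -/(F i) Fi inE => /eqP.
  by rewrite yt in Xj.
Qed.

Definition first_bar (I : pred 'I_d) (E : 'I_d -> pat) (m t : slot) (y : 'I_d) : Prop :=
  [/\ I y, 0 < off m t, t \in E y &
    forall i, I i -> (forall s, s \in E i -> ~ (0 < off m s < off m t)) /\
                     (i < y -> t \notin E i)].

Lemma first_bar_ex (I : pred 'I_d) (E : 'I_d -> pat) m i s :
  I i -> s \in E i -> 0 < off m s ->
  exists t y, first_bar I E m t y /\ off m t <= off m s.
Proof.
move=> Ii si ms; pose P (t : slot) := [exists j, [&& I j, t \in E j & 0 < off m t]].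
have Ps : P s by apply/existsP; exists i; rewrite Ii si ms.
have [t /existsP[j /and3P[Ij tj mt]] tmin] := arg_minnP (off m) Ps.
have Pj : (fun j => I j && (t \in E j)) j by rewrite /= Ij tj.
have [y /andP[Iy ty] ymin] := @arg_minnP _ j (fun j : 'I_d => I j && (t \in E j)) (fun j : 'I_d => j : nat) Pj.
exists t, y; split; last exact: tmin.
split=> // k Ik; split=> [u uk /andP[mu]|ky].
  by rewrite ltnNge tmin //; apply/existsP; exists k; rewrite Ik uk mu.
by apply/negP => tk; have := ymin k; rewrite Ik tk leqNgt ky => /(_ isT).
Qed.

Lemma first_bar_uniq I E m t y t' y' :
  first_bar I E m t y -> first_bar I E m t' y' -> t = t' /\ y = y'.
Proof.
move=> [Iy mt ty H] [Iy' mt' ty' H'].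
have tt' : t = t'.
  apply: (@off_inj _ m); case: (ltngtP (off m t) (off m t')) => // lt.
    by case: (H' _ Iy) => /(_ _ ty); rewrite mt lt.
  by case: (H _ Iy') => /(_ _ ty'); rewrite mt' lt.
subst t'; split=> //; apply: val_inj => /=; case: (ltngtP y y') => // lt.
  by case: (H' _ Iy) => _ /(_ lt); rewrite ty.
by case: (H _ Iy') => _ /(_ lt); rewrite ty'.
Qed.

(** Nothing interrupts the walk before slot [t], so it arrives there and crosses to [y]. Its path
    then splits into the excursion below [y] and a walk resumed at [nx k]. *)
Lemma exits_first_bar n (c : conf n.+1) (B : pat) I m t y k0 :
  exits c B (nx m) k0 -> first_bar I (fun i => (c i).1) m t y ->
  (forall i s, ~~ I i -> s \in (c i).1 -> ~ (0 < off m s <= off m t)) ->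
  (forall s, s \in B -> ~ (0 < off m s <= off m t)) ->
  exists2 k, exits (c y).2 (c y).1 (nx t) k & exits c B (nx k) k0.
Proof.
move=> [k0B path] [Iy mt ty H] HI HB.
set st := cstep _ _ B in path.
have tB : t \notin B by apply/negP => /HB; rewrite mt leqnn.
have tfirst : first_at (fun i => (c i).1) t y.
  split=> // j jy; have [/H[_ /(_ jy)]//|/HI Hj] := boolP (I j).
  by apply/negP => /Hj; rewrite mt leqnn.
have key a : forall s, off m s = a.+1 -> a < off m t -> star st s k0.
  elim: a => [|a IH] s os am.
    suff -> : s = nx m by [].
    apply: (@off_inj _ m); rewrite os off_nx off_id.
    by have := off_lt m t; case: eqP => //; lia.
  have [u ou] : exists u, off m u = a.+1 by apply: off_surj; have := off_lt m s; lia.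
  have su : s = nx u.
    apply: (@off_inj _ m); rewrite os off_nx ou.
    by have := off_lt m s; case: eqP => //; lia.
  rewrite su; case: (star_first (IH u ou (ltnW am))) => [E|[v [uB]]].
    by case: (HB k0 k0B); rewrite -E ou; lia.
  move=> [[_ ->]//|[j [k [[uj _] _ _]]]] _.
  have [/H[/(_ u uj)]|/HI /(_ uj)] := boolP (I j); rewrite ou; lia.
have {key} H1 : star st t k0 by apply: (key (off m t).-1); lia.
case: (star_first H1) => [E|[v [_ [[/(_ y) + _]|[j [k [tj Xj ->]]]]] vk0]].
- by rewrite E k0B in tB.
- by rewrite ty.
- by have jy := first_at_inj tj tfirst; subst j; exists k.
Qed.

(** The condition [K < off k t0] ensures that the window after the first return is over before the
    entrance bar comes round again. *)
Lemma exits_two_children n (c : conf n.+1) (B : pat) (t0 t1 t2 k k0 : slot) x y K :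
  exits c (t0 |: B) (nx t0) k0 ->
  first_bar predT (fun i => (c i).1) t0 t1 x -> off t0 t1 <= K ->
  exits (c x).2 (c x).1 (nx t1) k -> K < off k t0 ->
  (forall s, s \in B -> ~ (0 < off t0 s <= K) /\ ~ (0 < off k s <= K)) ->
  (forall s, s \in (c x).1 -> ~ (0 < off k s <= K)) ->
  first_bar (predC1 x) (fun i => (c i).1) k t2 y -> off k t2 <= K ->
  exists k', exits (c y).2 (c y).1 (nx t2) k'.
Proof.
move=> ex fb1 t1K xk kt0 HB Hx fb2 t2K.
have [|s|k1 xk1 ex1] := exits_first_bar ex fb1; first by [].
  by rewrite !inE => /orP[/eqP->|/HB[]]; rewrite ?off_id //; lia.
have kk1 := exits_det xk xk1; subst k1.
have [i s|s|k2 yk2 _] := exits_first_bar ex1 fb2; last by exists k2.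
  by rewrite /= negbK => /eqP-> /Hx; lia.
by rewrite !inE => /orP[/eqP->|/HB[_]]; lia.
Qed.

End walk.

Import Order.TTheory GRing.Theory Num.Theory.
Local Open Scope ring_scope.

(** * Finite probability spaces *)

Section finite_weights.
Variables (R : realFieldType) (T : finType) (w : T -> R).
Implicit Types A B C : T -> Prop.

Definition Pr A : R := \sum_(t | `[< A t >]) w t.

Lemma PrE A : Pr A = \sum_t w t * (`[< A t >])%:R.
Proof.
by rewrite /Pr big_mkcond; apply: eq_bigr => t _; case: `[< _ >]; rewrite ?mulr1 ?mulr0.
Qed.

Lemma eq_Pr A B : (forall t, A t <-> B t) -> Pr A = Pr B.
Proof. by move=> AB; apply: eq_bigl => t; apply/asboolP/asboolP => /AB. Qed.

Lemma Pr_false A : (forall t, ~ A t) -> Pr A = 0.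
Proof. by move=> nA; apply: big_pred0 => t; apply/asboolP/nA. Qed.

Lemma Pr_true A : (forall t, A t) -> Pr A = \sum_t w t.
Proof. by move=> hA; apply: eq_bigl => t; apply/asboolP. Qed.

Hypothesis w_ge0 : forall t, 0 <= w t.

Lemma Pr_ge0 A : 0 <= Pr A.
Proof. exact: sumr_ge0. Qed.

Lemma Pr_sub A B : (forall t, A t -> B t) -> Pr A <= Pr B.
Proof.
move=> AB; rewrite !PrE; apply: ler_sum => t _; apply: ler_wpM2l => //.
by rewrite ler_nat; case: asboolP => // /AB H; case: asboolP.
Qed.

Lemma Pr_bigU (J : finType) (Q : pred J) A (B : J -> T -> Prop) :
  (forall t, A t -> exists2 j, Q j & B j t) -> Pr A <= \sum_(j | Q j) Pr (B j).
Proof.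
move=> AB; under eq_bigr do rewrite PrE.
rewrite exchange_big PrE; apply: ler_sum => t _; rewrite -mulr_sumr.
apply: ler_wpM2l => //; case: asboolP => [/AB[j Qj /asboolP Bj]|_]; last exact: sumr_ge0.
by rewrite (bigD1 j) //= Bj lerDl sumr_ge0.
Qed.

Lemma Pr_U A B C : (forall t, A t -> B t \/ C t) -> Pr A <= Pr B + Pr C.
Proof.
move=> AB; apply: le_trans (@Pr_bigU bool predT A (fun b => if b then B else C) _) _.
  by move=> t /AB[]; [exists true|exists false].
by rewrite big_bool.
Qed.

Lemma Pr_disj (J : finType) (Q : pred J) (A : J -> T -> Prop) C :
  (forall j t, Q j -> A j t -> C t) ->
  (forall j j' t, Q j -> Q j' -> A j t -> A j' t -> j = j') ->
  \sum_(j | Q j) Pr (A j) <= Pr C.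
Proof.
move=> AC Adisj; under eq_bigr do rewrite PrE.
rewrite exchange_big PrE; apply: ler_sum => t _; rewrite -mulr_sumr.
apply: ler_wpM2l => //.
have [[j Qj Aj]|nA] := pselect (exists2 j, Q j & A j t); last first.
  rewrite big1 // => j Qj; case: asboolP => // Aj; case: nA; by exists j.
rewrite (bigD1 j) //= big1 => [|k /andP[Qk kj]]; last first.
  by case: asboolP => // Ak; move: kj; rewrite (Adisj _ _ _ Qk Qj Ak Aj) eqxx.
by rewrite addr0 ler_nat; case: asboolP => // _; case: asboolP => // H; case: H; apply: AC Aj.
Qed.

Lemma Pr_split A B : Pr A = Pr (fun t => A t /\ B t) + Pr (fun t => A t /\ ~ B t).
Proof.
rewrite !PrE -big_split /=; apply: eq_bigr => t _; rewrite -mulrDr -natrD.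
by congr (_ * _%:R); rewrite asbool_and asbool_and asbool_neg; do 2 case: asboolP.
Qed.

Hypothesis w1 : \sum_t w t = 1.

Lemma Pr_le1 A : Pr A <= 1.
Proof. by rewrite -w1 -(@Pr_true (fun=> True)) //; apply: Pr_sub. Qed.

Lemma PrC A : Pr (fun t => ~ A t) = 1 - Pr A.
Proof.
rewrite -w1 -(@Pr_true (fun=> True)) // (Pr_split (fun=> True) A).
rewrite (@eq_Pr (fun t => True /\ A t) A) => [|t]; last by split=> // -[].
by rewrite (@eq_Pr (fun t => True /\ ~ A t) (fun t => ~ A t)) => [|t]; [lra|split=> // -[]].
Qed.

End finite_weights.

Section product_weights.
Variables (R : realFieldType) (I T : finType) (w : T -> R).

Definition wprod (F : {ffun I -> T}) : R := \prod_i w (F i).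

Lemma Pr_prod (A : I -> T -> Prop) :
  Pr wprod (fun F => forall i, A i (F i)) = \prod_i Pr w (A i).
Proof.
rewrite /Pr bigA_distr_big_dep /=; apply: eq_bigl => F.
apply/asboolP/familyP => [H i|H i]; first by rewrite unfold_in; apply/asboolP.
by have := H i; rewrite unfold_in => /asboolP.
Qed.

Hypothesis w_ge0 : forall t, 0 <= w t.

Lemma wprod_ge0 F : 0 <= wprod F.
Proof. exact: prodr_ge0. Qed.

(** Independence in the form used below: a factor [q] is extracted at one coordinate while the
    conditions on the others are merely relaxed. *)
Lemma Pr_prod_replace (q : R) (y : I) (A A' : I -> T -> Prop) :
  (forall i t, i != y -> A i t -> A' i t) -> 0 <= q ->
  Pr w (A y) <= q * Pr w (A' y) ->
  Pr wprod (fun F => forall i, A i (F i)) <= q * Pr wprod (fun F => forall i, A' i (F i)).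
Proof.
move=> AA' q0 Hy; rewrite !Pr_prod (bigD1 y) //= [X in _ <= q * X](bigD1 y) //= mulrA.
apply: ler_pM => //; [exact: Pr_ge0|by apply: prodr_ge0 => i _; apply: Pr_ge0|].
apply: ler_prod => i iy; rewrite Pr_ge0 //=; apply: Pr_sub => // t; exact: AA'.
Qed.

Hypothesis w1 : \sum_t w t = 1.

Lemma wprod1 : \sum_F wprod F = 1.
Proof. by rewrite /wprod -(bigA_distr_bigA (fun=> w)) big1. Qed.

Lemma Pr_prod1 (i : I) (A : T -> Prop) : Pr wprod (fun F : {ffun I -> T} => A (F i)) = Pr w A.
Proof.
rewrite (@eq_Pr _ _ _ _ (fun F : {ffun I -> T} => forall j, (fun j t => j = i -> A t) j (F j))) => [|F]; last first.
  by split=> [AF j ->//|/(_ i)/(_ erefl)].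
rewrite (Pr_prod (fun j t => j = i -> A t)) (bigD1 i) //= big1 ?mulr1 => [|j ji].
  by apply: eq_Pr => t; split=> [/(_ erefl)|].
by rewrite Pr_true ?w1 // => t /eqP; rewrite (negPf ji).
Qed.

Lemma Pr_prod2 (i j : I) (A B : T -> Prop) : i != j ->
  Pr wprod (fun F => A (F i) /\ B (F j)) = Pr w A * Pr w B.
Proof.
move=> ij; pose Q k t := (k = i -> A t) /\ (k = j -> B t).
rewrite (@eq_Pr _ _ _ _ (fun F : {ffun I -> T} => forall k, Q k (F k))) => [|F]; last first.
  split=> [[AF BF] k|H]; first by split=> ->.
  by split; [case: (H i) => /(_ erefl)|case: (H j) => _ /(_ erefl)].
rewrite (Pr_prod Q) (bigD1 i) //= (bigD1 j) 1?eq_sym //= big1 ?mulr1 => [|k /andP[ki kj]].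
  congr (_ * _); apply: eq_Pr => t; split.
  - by case=> /(_ erefl).
  - by move=> At; split=> // E; rewrite E eqxx in ij.
  - by case=> _ /(_ erefl).
  - by move=> Bt; split=> // E; rewrite -E eqxx in ij.
by rewrite Pr_true ?w1 // => t; split=> /eqP; rewrite ?(negPf ki) ?(negPf kj).
Qed.

Lemma Pr_prod3 (i j k : I) (A B C : T -> Prop) : i != j -> i != k -> j != k ->
  Pr wprod (fun F => [/\ A (F i), B (F j) & C (F k)]) = Pr w A * Pr w B * Pr w C.
Proof.
move=> ij ik jk; pose Q l t := [/\ l = i -> A t, l = j -> B t & l = k -> C t].
rewrite (@eq_Pr _ _ _ _ (fun F : {ffun I -> T} => forall l, Q l (F l))) => [|F]; last first.
  split=> [[AF BF CF] l|H]; first by split=> ->.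
  by split; [case: (H i) => /(_ erefl)|case: (H j) => _ /(_ erefl)|case: (H k) => _ _ /(_ erefl)].
rewrite (Pr_prod Q) (bigD1 i) //= (bigD1 j) 1?eq_sym //= (bigD1 k) /=; last first.
  by rewrite ![k == _]eq_sym ik jk.
rewrite big1 ?mulr1 ?mulrA => [|l /andP[/andP[li lj] lk]]; last first.
  by rewrite Pr_true ?w1 // => t; split=> /eqP; rewrite ?(negPf li) ?(negPf lj) ?(negPf lk).
congr (_ * _ * _); apply: eq_Pr => t; split.
- by case=> /(_ erefl).
- by move=> At; split=> // /eqP; rewrite ?(negPf ij) ?(negPf ik).
- by case=> _ /(_ erefl).
- by move=> At; split=> // /eqP; rewrite ?[j == i]eq_sym ?(negPf ij) ?(negPf jk).
- by case=> _ _ /(_ erefl).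
- by move=> At; split=> // /eqP; rewrite ?[k == _]eq_sym ?(negPf ik) ?(negPf jk).
Qed.

End product_weights.

Lemma disjoint_setU1 (S : finType) (m : S) (A Z : {set S}) :
  [disjoint m |: A & Z] = (m \notin Z) && [disjoint A & Z].
Proof. by rewrite !disjoints_subset subUset sub1set inE. Qed.

(** * Random sets of slots with independent Bernoulli membership *)

Section bernoulli.
Variables (R : realFieldType) (p : R) (S : finType).
Hypothesis p01 : 0 < p < 1.
Implicit Types (A : {set S}) (Q : {set S} -> Prop) (m : S) (Z : {set S}).

Definition wp A : R := \prod_m (if m \in A then p else 1 - p).

Let p_ge0 : 0 <= p. Proof. by case/andP: p01 => *; lra. Qed.
Let q_ge0 : 0 <= 1 - p. Proof. by case/andP: p01 => *; lra. Qed.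

Lemma wp_ge0 A : 0 <= wp A.
Proof. by apply: prodr_ge0 => m _; case: ifP. Qed.

Lemma wp1 : \sum_A wp A = 1.
Proof.
rewrite -[RHS](_ : \prod_(m : S) (p + (1 - p)) = 1); last first.
  by rewrite big1 // => _ _; lra.
by rewrite bigA_distr; apply: eq_bigl => A; rewrite inE.
Qed.

Let rest m A := \prod_(k | k != m) (if k \in A then p else 1 - p).

Let wp_rest m A : wp A = (if m \in A then p else 1 - p) * rest m A.
Proof. by rewrite /wp (bigD1 m). Qed.

Lemma sum_set_split m (f : {set S} -> R) :
  \sum_A f A = \sum_(A : {set S} | m \notin A) (f A + f (m |: A)).
Proof.
rewrite (bigID (fun A : {set S} => m \notin A)) /= big_split /=; congr (_ + _).
rewrite (reindex_onto (fun A : {set S} => m |: A) (fun A => A :\ m)) /= => [|A]; last first.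
  by rewrite negbK => mA; rewrite setD1K.
apply: eq_bigl => A; rewrite negbK setU11 /=.
apply/eqP/idP => [<-|mA]; first by rewrite !inE eqxx.
by rewrite setU1K.
Qed.

Lemma Pr_resample m Q :
  Pr wp Q = p * Pr wp (fun A : {set S} => Q (m |: A)) + (1 - p) * Pr wp (fun A : {set S} => Q (A :\ m)).
Proof.
rewrite !PrE !(sum_set_split m) !mulr_sumr -big_split /=; apply: eq_bigr => A mA.
have r1 : rest m (m |: A) = rest m A.
  by apply: eq_bigr => k km; rewrite !inE (negPf km).
rewrite !(wp_rest m) setU11 (negPf mA) r1.
have -> : m |: (m |: A) = m |: A by rewrite setUA setUid.
have -> : (m |: A) :\ m = A by rewrite setU1K.
have -> : A :\ m = A by apply/setDidPl; rewrite disjoint_sym disjoints1.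
by ring.
Qed.

Lemma Pr_mem m Q : Pr wp (fun A : {set S} => Q A /\ m \in A) = p * Pr wp (fun A : {set S} => Q (m |: A)).
Proof.
rewrite (Pr_resample m) [X in _ + _ * X]Pr_false ?mulr0 ?addr0; last by move=> A; rewrite !inE eqxx => -[].
by congr (_ * _); apply: eq_Pr => A; rewrite setU11; split=> // -[].
Qed.

Lemma Pr_notmem m Q : Pr wp (fun A : {set S} => Q A /\ m \notin A) = (1 - p) * Pr wp (fun A : {set S} => Q (A :\ m)).
Proof.
rewrite (Pr_resample m) [X in _ * X + _]Pr_false ?mulr0 ?add0r; last by move=> A; rewrite setU11 => -[].
by congr (_ * _); apply: eq_Pr => A; rewrite !inE eqxx; split=> // -[].
Qed.

(** Slots outside [Z] are independent of those inside, so [A :\: Z] has the law of [A] conditioned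
    to avoid [Z]. *)
Lemma Pr_avoid Z Q :
  Pr wp (fun A : {set S} => Q A /\ [disjoint A & Z]) = (1 - p) ^+ #|Z| * Pr wp (fun A : {set S} => Q (A :\: Z)).
Proof.
have [k] := ubnP #|Z|; elim: k Z Q => // k IH Z Q Zk.
have [->|[m mZ]] := set_0Vmem Z.
  rewrite cards0 expr0 mul1r; apply: eq_Pr => A; rewrite setD0 -setI_eq0 setI0 eqxx.
  by split=> // -[].
have Zm : Z = m |: (Z :\ m) by rewrite setD1K.
have cZ : #|Z| = #|Z :\ m|.+1 by rewrite (cardsD1 m) mZ.
rewrite (@eq_Pr _ _ _ _ (fun A : {set S} => (Q A /\ m \notin A) /\ [disjoint A & Z :\ m])) => [|A]; last first.
  have -> : [disjoint A & Z] = (m \notin A) && [disjoint A & Z :\ m].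
    by rewrite ![[disjoint A & _]]disjoint_sym -disjoint_setU1 setD1K.
  by split=> [[QA /andP[mA D]]|[[QA mA] D]]; split=> //; rewrite mA.
rewrite (IH _ (fun A : {set S} => Q A /\ m \notin A)); last by rewrite -ltnS -cZ.
rewrite cZ exprSr -mulrA; congr (_ * _).
rewrite (@eq_Pr _ _ _ _ (fun A : {set S} => Q (A :\: (Z :\ m)) /\ m \notin A)) => [|A]; last first.
  by rewrite !inE eqxx /=.
rewrite (Pr_notmem m (fun A => Q (A :\: (Z :\ m)))); congr (_ * _); apply: eq_Pr => A.
suff -> : A :\ m :\: (Z :\ m) = A :\: Z by [].
by rewrite setDDl setD1K.
Qed.

Lemma Pr_mem1 m : Pr wp (fun A : {set S} => m \in A) = p.
Proof.
rewrite (@eq_Pr _ _ _ _ (fun A : {set S} => True /\ m \in A)) => [|A]; last by split=> // -[].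
by rewrite (Pr_mem m (fun=> True)) Pr_true ?wp1 ?mulr1.
Qed.

Lemma Pr_mem2 m m' : m != m' -> Pr wp (fun A : {set S} => m \in A /\ m' \in A) = p ^+ 2.
Proof.
move=> mm'; rewrite (Pr_mem m' (fun A : {set S} => m \in A)) expr2; congr (_ * _).
by rewrite -[RHS](Pr_mem1 m); apply: eq_Pr => A; rewrite !inE (negPf mm').
Qed.

Lemma Pr_disjoint Z : Pr wp (fun A : {set S} => [disjoint A & Z]) = (1 - p) ^+ #|Z|.
Proof.
rewrite (@eq_Pr _ _ _ _ (fun A : {set S} => True /\ [disjoint A & Z])) => [|A]; last by split=> // -[].
by rewrite (Pr_avoid Z (fun=> True)) Pr_true ?wp1 ?mulr1.
Qed.

Lemma Pr_hit Z : Pr wp (fun A : {set S} => exists2 s, s \in A & s \in Z) <= #|Z|%:R * p.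
Proof.
apply: le_trans (@Pr_bigU _ _ _ wp_ge0 _ (mem Z) _ (fun s (A : {set S}) => s \in A) _) _.
  by move=> A [s sA sZ]; exists s.
by under eq_bigr do rewrite Pr_mem1; rewrite sumr_const mulr_natl.
Qed.

Lemma Pr_hit2 Z Z' : [disjoint Z & Z'] ->
  Pr wp (fun A : {set S} => (exists2 s, s \in A & s \in Z) /\ (exists2 s, s \in A & s \in Z'))
    <= #|Z|%:R * #|Z'|%:R * p ^+ 2.
Proof.
move=> D.
apply: le_trans (@Pr_bigU _ _ _ wp_ge0 _ (fun u => (u.1 \in Z) && (u.2 \in Z')) _
   (fun u (A : {set S}) => u.1 \in A /\ u.2 \in A) _) _.
  by move=> A [[s sA sZ] [s' s'A s'Z]]; exists (s, s') => //=; rewrite sZ.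
under eq_bigr => u /andP[uZ uZ'].
  rewrite Pr_mem2; last by apply: contraTneq uZ' => <-; rewrite (disjointFr D).
  over.
rewrite sumr_const (_ : #|_| = (#|Z| * #|Z'|)%N).
  by rewrite -[X in X <= _]mulr_natl natrM.
by rewrite -cardsX; apply: eq_card => u; rewrite !inE unfold_in.
Qed.

Lemma Pr_multi : Pr wp (fun A : {set S} => (1 < #|A|)%N) <= (#|S|%:R * p) ^+ 2.
Proof.
apply: le_trans (@Pr_bigU _ _ _ wp_ge0 _ (fun u => u.1 != u.2) _
   (fun u (A : {set S}) => u.1 \in A /\ u.2 \in A) _) _.
  by move=> A /card_gt1P[x [y [xA yA xy]]]; exists (x, y).
under eq_bigr => u uu do rewrite Pr_mem2 //.
rewrite sumr_const -[X in X <= _]mulr_natl exprMn -natrX; apply: ler_wpM2r; first exact: sqr_ge0.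
by rewrite ler_nat (leq_trans (max_card _)) // card_prod mulnn.
Qed.

(** Markov's inequality for the number of bars. *)
Lemma Pr_card N : N.+1%:R * Pr wp (fun A : {set S} => (N < #|A|)%N) <= #|S|%:R * p.
Proof.
apply: le_trans (_ : \sum_A wp A * #|A|%:R <= _).
  rewrite PrE mulr_sumr; apply: ler_sum => A _; rewrite mulrCA; apply: ler_wpM2l; first exact: wp_ge0.
  by rewrite -natrM ler_nat; case: asboolP => /= [|_]; rewrite ?muln1 ?muln0.
have -> : \sum_A wp A * #|A|%:R = \sum_(m : S) Pr wp (fun A : {set S} => m \in A).
  under [RHS]eq_bigr do rewrite PrE.
  rewrite exchange_big; apply: eq_bigr => A _; rewrite -mulr_sumr; congr (_ * _).
  rewrite -sum1_card natr_sum big_mkcond; apply: eq_bigr => m _.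
  by rewrite asboolb; case: (m \in A).
by under eq_bigr do rewrite Pr_mem1; rewrite sumr_const mulr_natl.
Qed.

Lemma wp_set1 m : wp [set m] = p * (1 - p) ^+ #|S|.-1.
Proof.
rewrite (wp_rest m) inE eqxx; congr (_ * _); rewrite /rest.
under eq_bigr => k km do rewrite inE (negPf km).
by rewrite prodr_const cardC1.
Qed.

Lemma wp_set0 : wp set0 = (1 - p) ^+ #|S|.
Proof. by rewrite /wp; under eq_bigr do rewrite inE; rewrite prodr_const. Qed.

(** Resampling the slot [b]: its presence costs the odds [p / (1 - p)]. This replaces independence
    when [Q] itself depends on [b]. *)
Lemma Pr_add_slot b Q : (forall A, Q (b |: A) -> Q (A :\ b)) ->
  (1 - p) * Pr wp (fun A : {set S} => Q A /\ b \in A) <= p * Pr wp Q.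
Proof.
move=> Qb; rewrite Pr_mem mulrCA; apply: ler_wpM2l => //.
apply: le_trans (_ : (1 - p) * Pr wp (fun A : {set S} => Q (A :\ b)) <= _).
  by apply: ler_wpM2l => //; apply: Pr_sub => //; apply: wp_ge0.
by rewrite -Pr_notmem; apply: Pr_sub => [|A []//]; apply: wp_ge0.
Qed.

End bernoulli.

(** * Near-critical times: one good child at a time *)

Section conf_weights.
Variables (R : realFieldType) (p : R) (d L : nat).
Hypothesis p01 : 0 < p < 1.
Local Notation slot := 'I_L.+1.
Local Notation pat := {set slot}.
Local Notation conf := (conf d L).
Local Notation wpp := (@wp R p slot).

Fixpoint wc n : conf n -> R :=
  match n return conf n -> R with
  | 0 => fun _ => 1
  | n'.+1 => fun c => \prod_i (wp p (c i).1 * wc (c i).2)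
  end.

Definition we n (ec : pat * conf n) : R := wp p ec.1 * wc ec.2.

Lemma wc_ge0 n (c : conf n) : 0 <= wc c.
Proof.
elim: n c => [//|n IH] c /=; apply: prodr_ge0 => i _.
by rewrite mulr_ge0 ?wp_ge0.
Qed.

Lemma we_ge0 n (ec : pat * conf n) : 0 <= we ec.
Proof. by rewrite mulr_ge0 ?wc_ge0 ?wp_ge0. Qed.

Lemma Pr_we n (A : pat * conf n -> Prop) :
  Pr (@we n) A = \sum_(S : pat) wp p S * Pr (@wc n) (fun c => A (S, c)).
Proof.
rewrite PrE; under [RHS]eq_bigr do rewrite PrE mulr_sumr.
by rewrite pair_big /=; apply: eq_bigr => -[S c] _; rewrite /we mulrA.
Qed.

Lemma Pr_we_swap n (A : pat * conf n -> Prop) :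
  Pr (@we n) A = \sum_(c : conf n) wc c * Pr wpp (fun S => A (S, c)).
Proof.
rewrite Pr_we; under eq_bigr do rewrite PrE mulr_sumr.
rewrite exchange_big; apply: eq_bigr => c _; rewrite PrE mulr_sumr.
by apply: eq_bigr => S _; rewrite mulrCA.
Qed.

Lemma we1 n : \sum_(c : conf n) wc c = 1 -> \sum_(ec : pat * conf n) we ec = 1.
Proof.
move=> H; rewrite -(@Pr_true _ _ _ (fun=> True)) // Pr_we.
under eq_bigr do rewrite Pr_true // H mulr1.
by rewrite wp1.
Qed.

Lemma wc1 n : \sum_(c : conf n) wc c = 1.
Proof.
elim: n => [|n IH]; first by rewrite big_const cardE /= enumT unlock /= addr0.
by rewrite -[RHS](wprod1 'I_d (we1 IH)).
Qed.

(** Once the edges at the root are revealed, the subtrees of the children are independent. *)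
Lemma Pr_conf_split n (A : {ffun 'I_d -> pat} -> 'I_d -> conf n -> Prop) :
  Pr (@wc n.+1) (fun c => forall i, A [ffun j => (c j).1] i (c i).2) =
  \sum_F wprod wpp F * \prod_i Pr (@wc n) (A F i).
Proof.
rewrite PrE (reindex (fun u : {ffun 'I_d -> pat} * {ffun 'I_d -> conf n} =>
  [ffun i => (u.1 i, u.2 i)] : conf n.+1)) /=; last first.
  exists (fun c : conf n.+1 => ([ffun i => (c i).1], [ffun i => (c i).2])).
    by case=> F C _ /=; congr (_, _); apply/ffunP => i; rewrite !ffunE.
  by move=> c _; apply/ffunP => i; rewrite !ffunE /=; case: (c i).
rewrite -(pair_big xpredT xpredT (fun (F : {ffun 'I_d -> pat}) (C : {ffun 'I_d -> conf n}) =>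
   (\prod_i (wp p ([ffun i => (F i, C i)] i : pat * conf n).1 *
             wc ([ffun i => (F i, C i)] i : pat * conf n).2)) *
   (`[< forall i, A [ffun j => ([ffun i => (F i, C i)] j : pat * conf n).1] i
        ([ffun i => (F i, C i)] i : pat * conf n).2 >])%:R)) /=.
apply: eq_bigr => F _; rewrite -Pr_prod PrE mulr_sumr; apply: eq_bigr => C _.
rewrite mulrA; congr (_ * _).
  by rewrite /wprod -big_split /=; apply: eq_bigr => i _; rewrite ffunE.
have -> : [ffun j => ([ffun i => (F i, C i)] j : pat * conf n).1] = F.
  by apply/ffunP => i; rewrite !ffunE.
by congr (_ %:R); congr (nat_of_bool _); apply/asboolP/asboolP => H i; have := H i; rewrite ffunE.
Qed.

Let M : R := L.+1%:R * p.
Let w_ge0 := wprod_ge0 (I := 'I_d) (wp_ge0 (S := slot) p01).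

(** Given that [F i] is the single bar [t], a union bound over three obstructions: another bar at
    [t] (negligible for a fine mesh), one edge with bars on both sides of [t] (the leading term),
    and two multiply occupied edges (of higher order in [1 / d]). *)
Lemma Pr_good_single t0 (i : 'I_d) (t : slot) : t != t0 ->
  p * (1 - p) ^+ L * (1 - d%:R * p - d%:R * (off t0 t).-1%:R * (L - off t0 t)%:R * p ^+ 2
                      - d%:R ^+ 2 * M ^+ 4)
  <= Pr (wprod wpp) (fun F : {ffun 'I_d -> pat} => good_single F t0 i t).
Proof.
move=> tt0; set w := wprod wpp.
pose bef : pat := [set s | 0 < off t0 s < off t0 t]%N.
pose aft : pat := [set s | off t0 t < off t0 s]%N.
have ot : (0 < off t0 t)%N by rewrite lt0n off_eq0.
have otL := off_lt t0 t.
have cbef : #|bef| = (off t0 t).-1.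
  rewrite (card_off t0 (fun a => 0 < a < off t0 t)%N).
  rewrite (_ : [set a : slot | _] = [set inord a.+1 | a : 'I_(off t0 t).-1]).
    rewrite card_imset ?card_ord // => a b /(congr1 val) /=.
    have := ltn_ord a; have := ltn_ord b => ? ?.
    by rewrite !inordK; [move=> [] /val_inj|lia|lia].
  apply/setP => a; rewrite inE; apply/idP/imsetP => [Ha|[b _ ->]].
    have aL : (a.-1 < (off t0 t).-1)%N by lia.
    by exists (Ordinal aL) => //; apply: val_inj; rewrite /= inordK; lia.
  by have bL := ltn_ord b; rewrite inordK; lia.
have caft : #|aft| = (L - off t0 t)%N.
  rewrite (card_off t0 (fun a => off t0 t < a)%N).
  rewrite (_ : [set a : slot | _] = [set inord (L - a) | a : 'I_(L - off t0 t)]).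
    rewrite card_imset ?card_ord // => a b /(congr1 val) /=.
    have := ltn_ord a; have := ltn_ord b => ? ?.
    rewrite !inordK; [move=> H; apply: val_inj => /=; lia|lia|lia].
  apply/setP => a; rewrite inE; apply/idP/imsetP => [Ha|[b _ ->]].
    have := ltn_ord a => ?; have aL : (L - a < (L - off t0 t))%N by lia.
    by exists (Ordinal aL) => //; apply: val_inj; rewrite /= inordK; lia.
  by have bL := ltn_ord b; rewrite inordK; lia.
have wt : Pr wpp (fun A : pat => A = [set t]) = p * (1 - p) ^+ L.
  rewrite /Pr (big_pred1 [set t]) => [|A]; last by apply/asboolP/eqP.
  by rewrite wp_set1 card_ord.
have wtF : Pr w (fun F : {ffun 'I_d -> pat} => F i = [set t]) = p * (1 - p) ^+ L.
  by rewrite (Pr_prod1 (wp1 p _) i (fun A : pat => A = [set t])) wt.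
have w0 : 0 <= p * (1 - p) ^+ L by rewrite -wtF Pr_ge0.
pose multi (A : pat) := (1 < #|A|)%N.
pose hits (Z A : pat) := exists2 s, s \in A & s \in Z.
pose E1 j (F : {ffun 'I_d -> pat}) := F i = [set t] /\ t \in F j.
pose E2 j (F : {ffun 'I_d -> pat}) := F i = [set t] /\ (hits bef (F j) /\ hits aft (F j)).
pose E3 (u : 'I_d * 'I_d) (F : {ffun 'I_d -> pat}) :=
  [/\ F i = [set t], multi (F u.1) & multi (F u.2)].
pose Q3 (u : 'I_d * 'I_d) := [&& i != u.1, i != u.2 & u.1 != u.2].
have cover (F : {ffun 'I_d -> pat}) : F i = [set t] -> (((good_single F t0 i t \/ exists2 j, i != j & E1 j F) \/
    exists2 j, i != j & E2 j F) \/ exists2 u, Q3 u & E3 u F).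
  move=> Fi; apply: contrapT => /not_orP[/not_orP[/not_orP[nG n1] n2] n3].
  apply: nG; split=> // [j ji|].
    by apply/negP => tj; apply: n1; exists j => //; rewrite eq_sym.
  have Fi1 : ~ multi (F i) by rewrite /multi Fi cards1.
  apply: contrapT => /not_orP[nb na].
  have [j [mj hb]] : exists j, multi (F j) /\ hits bef (F j).
    apply: contrapT => H; apply: nb => j s mj sj ob; apply: H; exists j; split=> //.
    by exists s; rewrite // inE.
  have [k [mk ha]] : exists j, multi (F j) /\ hits aft (F j).
    apply: contrapT => H; apply: na => k s mk sk oa; apply: H; exists k; split=> //.
    by exists s; rewrite // inE.
  have ij : i != j by apply/eqP => E; apply: Fi1; rewrite E.
  have ik : i != k by apply/eqP => E; apply: Fi1; rewrite E.
  have [jk|jk] := eqVneq j k; first by apply: n2; exists j => //; split=> //; split=> //; rewrite jk.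
  by apply: n3; exists (j, k) => //; rewrite /Q3 ij ik.
have S1 : Pr w (fun F : {ffun 'I_d -> pat} => exists2 j, i != j & E1 j F) <= d%:R * (p * (1 - p) ^+ L * p).
  apply: le_trans (@Pr_bigU _ _ w w_ge0 _ (fun j => i != j) _ E1 _) _ => //.
  under eq_bigr => j ij.
    rewrite (Pr_prod2 (wp1 p _) (fun A : pat => A = [set t]) (fun A => t \in A) ij) wt Pr_mem1 //.
    over.
  rewrite sumr_const -[X in X <= _]mulr_natl; apply: ler_wpM2r.
    by rewrite mulr_ge0 //; case/andP: p01 => *; lra.
  by rewrite ler_nat (leq_trans (max_card _)) // card_ord.
have S2 : Pr w (fun F : {ffun 'I_d -> pat} => exists2 j, i != j & E2 j F) <=
    d%:R * (p * (1 - p) ^+ L * ((off t0 t).-1%:R * (L - off t0 t)%:R * p ^+ 2)).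
  apply: le_trans (@Pr_bigU _ _ w w_ge0 _ (fun j => i != j) _ E2 _) _ => //.
  have B0 : 0 <= p * (1 - p) ^+ L * ((off t0 t).-1%:R * (L - off t0 t)%:R * p ^+ 2).
    by apply: mulr_ge0 => //; apply: mulr_ge0; [exact: mulr_ge0|exact: sqr_ge0].
  apply: le_trans (_ : \sum_(j | i != j) (p * (1 - p) ^+ L *
     ((off t0 t).-1%:R * (L - off t0 t)%:R * p ^+ 2)) <= _).
    apply: ler_sum => j ij.
    rewrite (Pr_prod2 (wp1 p _) (fun A : pat => A = [set t])
      (fun A => hits bef A /\ hits aft A) ij) wt.
    apply: ler_wpM2l => //; rewrite -cbef -caft; apply: Pr_hit2 => //.
    by apply/pred0P => s /=; rewrite !inE; lia.
  rewrite sumr_const -[X in X <= _]mulr_natl; apply: ler_wpM2r => //.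
  by rewrite ler_nat (leq_trans (max_card _)) // card_ord.
have M0 : 0 <= M by rewrite mulr_ge0 //; case/andP: p01 => *; lra.
have S3 : Pr w (fun F : {ffun 'I_d -> pat} => exists2 u, Q3 u & E3 u F) <=
    d%:R ^+ 2 * (p * (1 - p) ^+ L * (M ^+ 4)).
  apply: le_trans (@Pr_bigU _ _ w w_ge0 _ Q3 _ E3 _) _ => //.
  have B0 : 0 <= p * (1 - p) ^+ L * M ^+ 4 by rewrite mulr_ge0 ?exprn_ge0.
  apply: le_trans (_ : \sum_(u | Q3 u) (p * (1 - p) ^+ L * M ^+ 4) <= _).
    apply: ler_sum => -[j k] /and3P[/= ij ik jk].
    rewrite (Pr_prod3 (wp1 p _) (fun A : pat => A = [set t]) multi multi ij ik jk) wt.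
    rewrite -mulrA; apply: ler_wpM2l => //; rewrite -[4%N]/(2 + 2)%N exprD.
    have := Pr_multi slot p01; rewrite card_ord => mu.
    by apply: ler_pM => //; apply: Pr_ge0; apply: wp_ge0.
  rewrite sumr_const -[X in X <= _]mulr_natl; apply: ler_wpM2r => //.
  by rewrite -natrX ler_nat (leq_trans (max_card _)) // card_prod card_ord mulnn.
have := @Pr_sub _ _ w w_ge0 _ _ cover.
rewrite wtF => T0.
have T1 := @Pr_U _ _ w w_ge0 _ _ _ (fun (F : {ffun 'I_d -> pat}) (H : (((good_single F t0 i t \/ exists2 j, i != j & E1 j F) \/
    exists2 j, i != j & E2 j F) \/ exists2 u, Q3 u & E3 u F)) => H).
have T2 := @Pr_U _ _ w w_ge0 _ _ _ (fun (F : {ffun 'I_d -> pat}) (H : ((good_single F t0 i t \/ exists2 j, i != j & E1 j F) \/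
    exists2 j, i != j & E2 j F)) => H).
have T3 := @Pr_U _ _ w w_ge0 _ _ _ (fun (F : {ffun 'I_d -> pat}) (H : (good_single F t0 i t \/ exists2 j, i != j & E1 j F)) => H).
set X := p * (1 - p) ^+ L in T0 S1 S2 S3 *; lra.
Qed.

(** Both sides count triples in [1..k], the left one by their middle element [a]. The [1/6] of the
    theorem is the [1/3!] of this binomial. *)
Lemma sum_pred_mul k : (\sum_(a < k.+1) a.-1 * (k - a))%N = 'C(k, 3).
Proof.
elim: k => [|k IH]; first by rewrite big_ord_recl big_ord0.
have spred l : (\sum_(a < l.+1) a.-1)%N = 'C(l, 2).
  by elim: l => [|l IHl]; [rewrite big_ord_recl big_ord0|rewrite big_ord_recr /= IHl binS bin1].
rewrite big_ord_recr /= subnn muln0 addn0 binS -IH -spred -big_split /=.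
by apply: eq_bigr => a _; rewrite (subSn (ltn_ord a : (a <= k)%N)) mulnSr.
Qed.

Lemma bin3_le k : (6 * 'C(k, 3) <= k.+1 ^ 3)%N.
Proof.
have -> : (6 = 3`!)%N by []; rewrite mulnC bin_ffact !ffactnSr ffactn0 !expnS expn0; nia.
Qed.

(** The bound of [Pr_good_single] summed over [t]; multiplied by [d], it bounds the mean number of
    good children from below. *)
Definition window_mean : R :=
  p * (1 - p) ^+ L * (L%:R * (1 - d%:R * p - d%:R ^+ 2 * M ^+ 4)
                      - d%:R * p ^+ 2 * (L.+1%:R ^+ 3 / 6)).

Lemma Pr_some_good_single t0 (i : 'I_d) :
  window_mean <=
  Pr (wprod wpp) (fun F : {ffun 'I_d -> pat} => exists t, good_single F t0 i t).
Proof.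
apply: le_trans (_ : \sum_(t | t != t0) Pr (wprod wpp)
    (fun F : {ffun 'I_d -> pat} => good_single F t0 i t) <= _); last first.
  apply: Pr_disj => // [t F _ G|t t' F _ _ [Ft _ _ _] [Ft' _ _ _]]; first by exists t.
  by apply/set1P; rewrite -Ft' Ft set11.
apply: le_trans (ler_sum _ (fun t => @Pr_good_single t0 i t)).
rewrite -mulr_sumr; apply: ler_wpM2l.
  by case/andP: p01 => *; apply: mulr_ge0; [lra|apply: exprn_ge0; lra].
pose g (t : slot) : R := ((off t0 t).-1 * (L - off t0 t))%N%:R.
rewrite (eq_bigr (fun t => (1 - d%:R * p - d%:R ^+ 2 * M ^+ 4) - d%:R * p ^+ 2 * g t)); last first.
  by move=> t _; rewrite /g natrM; ring.
rewrite sumrB sumr_const cardC1 card_ord /= -[X in _ <= X - _]mulr_natl -mulr_sumr.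
apply: lerB => //; apply: ler_wpM2l; first by rewrite mulr_ge0 ?sqr_ge0.
apply: le_trans (_ : \sum_t g t <= _).
  by rewrite [X in _ <= X](bigD1 t0) //= lerDr.
have bij : bijective (fun s : slot => Ordinal (off_lt t0 s)).
  by apply: injF_bij => s s' [] /off_inj.
have -> : \sum_t g t = \sum_(a : slot) (a.-1 * (L - a))%N%:R.
  by rewrite [RHS](reindex (fun s : slot => Ordinal (off_lt t0 s))) //; apply: onW_bij.
rewrite -natr_sum sum_pred_mul ler_pdivlMr // mulrC -natrX -natrM ler_nat.
exact: bin3_le.
Qed.

Lemma one_minus_exp (x : R) k : 0 <= x <= 1 -> (1 - x) ^+ k <= 1 - k%:R * x + k%:R ^+ 2 * x ^+ 2.
Proof.
case/andP=> x0 x1; elim: k => [|k IH]; first by rewrite expr0; lra.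
rewrite exprS; apply: le_trans (ler_wpM2l _ IH) _; first by lra.
have k0 : 0 <= k%:R :> R by [].
rewrite -(natr1 k) -subr_ge0.
rewrite [X in 0 <= X](_ : _ = (k%:R + 1) * x ^+ 2 + k%:R ^+ 2 * x ^+ 3); last by ring.
by rewrite addr_ge0 // mulr_ge0 ?exprn_ge0 ?sqr_ge0 //; lra.
Qed.

Lemma window_step n (x : R) : 0 <= x <= 1 ->
  (forall t, Pr (@wc n) (fun c => exits c [set t] (nx t) t) <= 1 - x) ->
  forall t0, Pr (@wc n.+1) (fun c => exits c [set t0] (nx t0) t0)
    <= 1 - x * d%:R * window_mean + d%:R ^+ 2 * x ^+ 2.
Proof.
move=> x01 IH t0.
(* Only good children constrain the subtrees; given [F], each of them contributes a factor at most
   [1 - x], the others at most 1. *)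
pose A (F : {ffun 'I_d -> pat}) i (c : conf n) :=
  forall t, good_single F t0 i t -> exits c [set t] (nx t) t.
apply: le_trans (_ : Pr (@wc n.+1) (fun c => forall i, A [ffun j => (c j).1] i (c i).2) <= _).
  apply: Pr_sub => [|c ex i t]; first exact: wc_ge0.
  have -> : ([ffun j => (c j).1] : {ffun 'I_d -> pat}) = (fun j => (c j).1) :> ('I_d -> pat).
    by apply/funext => j; rewrite ffunE.
  by move=> G; have [<- _ _ _] := G; apply: single_exits G.
rewrite Pr_conf_split.
pose gd (F : {ffun 'I_d -> pat}) i := `[< exists t, good_single F t0 i t >].
pose Z F := (\sum_i gd F i)%N.
have Zd F : (Z F <= d)%N.
  rewrite -[d in (_ <= d)%N](card_ord d) -sum1_card; apply: leq_sum => i _.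
  by case: (gd F i).
have step F : wprod wpp F * \prod_i Pr (@wc n) (A F i) <=
    wprod wpp F * (1 - (Z F)%:R * x + d%:R ^+ 2 * x ^+ 2).
  apply: ler_wpM2l; first exact: w_ge0.
  apply: le_trans (_ : (1 - x) ^+ Z F <= _).
    rewrite /Z -prodrXr; apply: ler_prod => i _.
    rewrite Pr_ge0 ?wc_ge0 //=; last exact: wc_ge0.
    rewrite /gd; case: asboolP => [[t G]|_]; last by apply: Pr_le1; [exact: wc_ge0|exact: wc1].
    rewrite expr1; apply: le_trans (IH t); apply: Pr_sub => [|c]; first exact: wc_ge0.
    by apply.
  apply: le_trans (one_minus_exp _ x01) _; rewrite lerD2l; apply: ler_wpM2r; first exact: sqr_ge0.
  by rewrite -!natrX ler_nat leq_sqr.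
apply: le_trans (ler_sum _ (fun F _ => step F)) _.
have -> : \sum_F wprod wpp F * (1 - (Z F)%:R * x + d%:R ^+ 2 * x ^+ 2) =
   1 - (\sum_F wprod wpp F * (Z F)%:R) * x + d%:R ^+ 2 * x ^+ 2.
  under eq_bigr do rewrite mulrDr mulrBr mulr1 mulrA.
  rewrite big_split sumrB /= -!mulr_suml wprod1 ?mul1r //; last exact: wp1.
  by congr (_ - _ + _); rewrite mulr_suml; apply: eq_bigr => F _; rewrite mulrA.
rewrite lerD2r lerD2l lerN2.
have -> : x * d%:R * window_mean = d%:R * window_mean * x by ring.
apply: ler_wpM2r; first by case/andP: x01.
have -> : \sum_F wprod wpp F * (Z F)%:R = \sum_(i < d) Pr (wprod wpp)
    (fun F : {ffun 'I_d -> pat} => exists t, good_single F t0 i t).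
  under [RHS]eq_bigr do rewrite PrE.
  rewrite exchange_big; apply: eq_bigr => F _; rewrite -mulr_sumr; congr (_ * _).
  by rewrite natr_sum.
apply: le_trans (ler_sum _ (fun i _ => Pr_some_good_single t0 i)).
by rewrite sumr_const card_ord mulr_natl.
Qed.

(** With [m = d * window_mean], one level sends [1 - x] to at most [1 - m x + d ^ 2 x ^ 2]; the
    hypothesis is exactly that this stays below [1 - x]. *)
Lemma window_bound (x : R) : 0 <= x <= 1 -> 1 + d%:R ^+ 2 * x <= d%:R * window_mean ->
  forall n t0, Pr (@wc n) (fun c => exits c [set t0] (nx t0) t0) <= 1 - x.
Proof.
move=> x01 H; elim=> [|n IH] t0.
  by rewrite Pr_false => [|c []//]; case/andP: x01 => *; lra.
apply: le_trans (window_step x01 IH t0) _.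
have x0 : 0 <= x by case/andP: x01.
have := ler_wpM2l x0 H; lra.
Qed.

End conf_weights.

(** * Large times: two children *)

Section two_children.
Variables (R : realFieldType) (p : R) (d L : nat).
Hypothesis p01 : 0 < p < 1.
Local Notation slot := 'I_L.+1.
Local Notation pat := {set slot}.
Local Notation conf := (conf d L).
Local Notation wpp := (@wp R p slot).
Local Notation wen := (@we R p d L).
Local Notation wcn := (@wc R p d L).

Let p0 : 0 < p. Proof. by case/andP: p01. Qed.
Let q0 : 0 < 1 - p. Proof. by case/andP: p01 => *; lra. Qed.
Let wp0 := @wp_ge0 R p slot p01.
Let we0 n := @we_ge0 R p d L p01 n.
Let we1' n : \sum_(ec : pat * conf n) we p ec = 1.
Proof. by apply: we1 => //; apply: wc1. Qed.

Let r := p / (1 - p).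
Let r0 : 0 <= r. Proof. by rewrite divr_ge0 ?ltW. Qed.

Definition entry_exits n (v : pat * conf n) (t : slot) := exists k, exits v.2 v.1 (nx t) k.

Lemma Pr_avoid_mem n (Z : pat) t : t \notin Z ->
  Pr (@wen n) (fun v => [disjoint v.1 & Z] /\ t \in v.1) = p * (1 - p) ^+ #|Z|.
Proof.
move=> tZ; rewrite Pr_we_swap.
under eq_bigr => c _.
  rewrite (Pr_mem p t (fun A : pat => [disjoint A & Z])).
  rewrite (@eq_Pr _ _ _ _ (fun A : pat => [disjoint A & Z])) ?Pr_disjoint //; last first.
    by move=> A; rewrite disjoint_setU1 // tZ.
  over.
by rewrite -mulr_suml wc1 // mul1r.
Qed.

Lemma Pr_avoid_we n (Z : pat) :
  Pr (@wen n) (fun v => [disjoint v.1 & Z]) = (1 - p) ^+ #|Z|.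
Proof.
rewrite Pr_we_swap; under eq_bigr => c _ do rewrite /= Pr_disjoint.
by rewrite -mulr_suml wc1 // mul1r.
Qed.

(* Conditioning on absent bars can only help the walk to escape. *)
Lemma Pr_entry_exits n (f : R) (Z : pat) t : t \notin Z ->
  Pr (@wen n) (fun v => exists k, exits v.2 (t |: v.1) (nx t) k) <= f ->
  Pr (@wen n) (fun v => ([disjoint v.1 & Z] /\ t \in v.1) /\ entry_exits v t) <=
    f * Pr (@wen n) (fun v => [disjoint v.1 & Z] /\ t \in v.1).
Proof.
move=> tZ Hf; rewrite Pr_avoid_mem //.
apply: le_trans (_ : p * (1 - p) ^+ #|Z| *
  Pr (@wen n) (fun v => exists k, exits v.2 (t |: v.1) (nx t) k) <= _); last first.
  rewrite [X in _ <= X]mulrC; apply: ler_wpM2l Hf.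
  by rewrite mulr_ge0 ?exprn_ge0 ?ltW.
rewrite !Pr_we_swap mulr_sumr; apply: ler_sum => c _.
rewrite mulrCA; apply: ler_wpM2l; first exact: wc_ge0.
rewrite (@eq_Pr _ _ _ _ (fun A : pat =>
  ([disjoint A & Z] /\ entry_exits (A, c) t) /\ t \in A)); last first.
  by move=> A; split=> [[[? ?] ?]|[[? ?] ?]].
rewrite (Pr_mem p t (fun A : pat => [disjoint A & Z] /\ entry_exits (A, c) t)).
rewrite (@eq_Pr _ _ _ _ (fun A : pat =>
  entry_exits (t |: A, c) t /\ [disjoint A & Z])); last first.
  by move=> A; rewrite disjoint_setU1 // tZ; split=> [[]|[]].
rewrite (Pr_avoid p Z (fun A : pat => entry_exits (t |: A, c) t)) mulrA.
apply: ler_wpM2l; first by rewrite mulr_ge0 ?exprn_ge0 ?ltW.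
apply: Pr_sub => // A [k H]; apply: exits_super H.
by apply: setUS; apply: subsetDl.
Qed.

Lemma Pr_add_slot_we n s (Q : pat * conf n -> Prop) :
  (forall A c, Q (s |: A, c) -> Q (A :\ s, c)) ->
  Pr (@wen n) (fun v => Q v /\ s \in v.1) <= r * Pr (@wen n) Q.
Proof.
move=> HQ; rewrite !Pr_we_swap mulr_sumr; apply: ler_sum => c _.
rewrite mulrCA; apply: ler_wpM2l; first exact: wc_ge0.
have := @Pr_add_slot _ p _ p01 s (fun A => Q (A, c)) (fun A => HQ A c).
by rewrite /r mulrAC ler_pdivlMr // mulrC.
Qed.

Variables (K : nat) (t0 : slot).
Hypothesis KL : (2 * K <= L)%N.

(* [first_barE]: the slots at which the edge to child [i] carries no bar if the first
   bar after [m] is at [t] on the edge to [y], with [b := (i < y)%N]. *)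
Definition zset (m t : slot) (b : bool) : pat :=
  [set s | (0 < off m s)%N && (if b then off m s <= off m t else off m s < off m t)%N].

Lemma first_barE (I : pred 'I_d) (E : 'I_d -> pat) m t y : (0 < off m t)%N -> I y ->
  first_bar I E m t y <->
  forall i, (I i -> [disjoint E i & zset m t (i < y)%N]) /\ (i = y -> t \in E i).
Proof.
move=> mt Iy; split=> [[_ _ ty H] i|H].
  split=> [/H[H1 H2]|-> //]; rewrite disjoints_subset; apply/subsetP => s sE.
  rewrite !inE; apply/negP => /andP[ms]; case: ifP => iy; last first.
    by move=> st; apply: (H1 s sE); rewrite ms.
  rewrite leq_eqVlt => /orP[/eqP/off_inj st|st]; last by apply: (H1 s sE); rewrite ms.
  by have := H2 iy; rewrite -st sE.
split=> //; first by case: (H y) => _ /(_ erefl).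
move=> i Ii; case: (H i) => /(_ Ii) D _; split=> [s sE /andP[ms st]|iy].
  by apply: disjointN D sE _; rewrite inE ms; case: ifP => // _; apply: ltnW.
by apply/negP => tE; apply: disjointN D tE _; rewrite inE mt iy leqnn.
Qed.

Definition first1 (x : 'I_d) t1 n (i : 'I_d) (v : pat * conf n) : Prop :=
  [disjoint v.1 & zset t0 t1 (i < x)%N] /\ (i = x -> t1 \in v.1).

Lemma first1x x t1 n (v : pat * conf n) :
  first1 x t1 x v <-> [disjoint v.1 & zset t0 t1 false] /\ t1 \in v.1.
Proof. by rewrite /first1 ltnn; split=> [[? /(_ erefl)]|[]]. Qed.

Lemma notin_zset m t : t \notin zset m t false.
Proof. by rewrite inE ltnn andbF. Qed.

Section first_child.
Variables (x : 'I_d) (t1 : slot) (n : nat).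
Hypothesis t1K : (0 < off t0 t1 <= K)%N.
Local Notation Fx := (fun v : pat * conf n => [disjoint v.1 & zset t0 t1 false] /\ t1 \in v.1).

Lemma exit_after k (A : pat) : [disjoint A & zset t0 t1 false] -> k \in A ->
  (K < off k t0)%N -> (off t0 t1 <= off t0 k)%N.
Proof.
move=> D kA kK; rewrite leqNgt; apply/negP => lt; apply: disjointN D kA _.
rewrite inE lt andbT lt0n off_eq0; apply/eqP => E.
by rewrite E off_id in kK.
Qed.

(** The window after [k] does not wrap past [t0], hence avoids the slots explored while searching
    for the first bar. The second search is therefore independent of the first. *)
Lemma win_after k s : (K < off k t0)%N -> (off t0 t1 <= off t0 k)%N -> s \in win k K ->
  (off t0 t1 < off t0 s)%N.
Proof.
rewrite inE => kK kt /andP[ks sK].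
suff H : (off t0 k + off k s < L.+1)%N by rewrite (off_add H); lia.
move: kK sK; rewrite /off; have := ltn_ord k; have := ltn_ord s; have := ltn_ord t0.
by do ! case: ifP; lia.
Qed.

(** A return slot is a bar of the entrance edge, so this bounds the chance of a return less than one
    window before [t0]. The bar [t1] is not such a slot, since [2 * K <= L]. *)
Lemma Pr_hit_before :
  Pr (@wen n) (fun v => Fx v /\ exists2 s, s \in v.1 & (off s t0 <= K)%N)
    <= K.+1%:R * r * Pr (@wen n) Fx.
Proof.
apply: le_trans (@Pr_bigU _ _ _ (@we0 n) _ (fun s => off s t0 <= K)%N _
   (fun s v => Fx v /\ s \in v.1) _) _.
  by move=> v [Fv [s sv sK]]; exists s.
apply: le_trans (_ : \sum_(s | (off s t0 <= K)%N) r * Pr (@wen n) Fx <= _).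
  apply: ler_sum => s sK; apply: Pr_add_slot_we => A c /= [D tA].
  have st : s != t1.
    apply: contraTneq sK => ->; rewrite -ltnNge.
    move: t1K; rewrite /off; have := ltn_ord t1; have := ltn_ord t0.
    by do 2 case: ifP; lia.
  move: D; rewrite disjoint_setU1 => /andP[_ D]; split.
    by apply: disjointWl D; apply: subsetDl.
  by move: tA; rewrite !inE eq_sym (negPf st).
rewrite sumr_const -[X in X <= _]mulr_natl mulrA; apply: ler_wpM2r; first exact: Pr_ge0.
apply: ler_wpM2r => //; rewrite ler_nat; apply: leq_trans (@card_before _ t0 K _); [by rewrite cardsE|lia].
Qed.

Definition exits_late (v : pat * conf n) (k : slot) :=
  exits v.2 v.1 (nx t1) k /\ (K < off k t0)%N.

Lemma Pr_hit_after :
  Pr (@wen n) (fun v => Fx v /\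
     exists k, exits_late v k /\ exists2 s, s \in v.1 & s \in win k K)
    <= K%:R * r * Pr (@wen n) Fx.
Proof.
apply: le_trans (@Pr_bigU _ _ _ (@we0 n) _ predT _
   (fun k v => (Fx v /\ exits_late v k) /\ exists2 s, s \in v.1 & s \in win k K) _) _.
  by move=> v [Fv [k [ek hk]]]; exists k.
apply: le_trans (_ : \sum_k K%:R * r * Pr (@wen n) (fun v => Fx v /\ exits_late v k) <= _);
  last first.
  rewrite -mulr_sumr; apply: ler_wpM2l; first by rewrite mulr_ge0.
  apply: Pr_disj => // [k v _ []//|k k' v _ _ [_ [ek _]] [_ [ek' _]]].
  exact: exits_det ek ek'.
apply: ler_sum => k _.
apply: le_trans (@Pr_bigU _ _ _ (@we0 n) _ (mem (win k K)) _
   (fun s v => (Fx v /\ exits_late v k) /\ s \in v.1) _) _.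
  by move=> v [Fv [s sv sk]]; exists s.
apply: le_trans (_ : \sum_(s in win k K) r * Pr (@wen n) (fun v => Fx v /\ exits_late v k) <= _).
  apply: ler_sum => s sk; apply: Pr_add_slot_we => A c /= [[D tA] [ek kK]].
  have kA := exits_in ek.
  have lt := win_after kK (exit_after D kA kK) sk.
  have st : t1 == s = false by apply: contraTF lt => /eqP->; rewrite ltnn.
  have ks : k == s = false.
    by apply/negbTE/eqP => E; move: sk; rewrite -E /win !inE off_id.
  move: D; rewrite disjoint_setU1 => /andP[_ D]; split; first split.
  - by apply: disjointWl D; apply: subsetDl.
  - by move: tA; rewrite !inE st.
  - split=> //; apply: exits_sub ek; last by move: kA; rewrite !inE ks.
    by apply: subset_trans (subsetDl _ _) (subsetUr _ _).
rewrite sumr_const -[X in X <= _]mulr_natl mulrA card_win //; lia.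
Qed.

End first_child.

Section recursion.
Variables (n : nat) (f : R).
Hypothesis f0 : 0 <= f.
Hypothesis Hf : forall t,
  Pr (@wen n) (fun v => exists k, exits v.2 (t |: v.1) (nx t) k) <= f.

Local Notation W := (@wprod R 'I_d _ (@wen n)).
Local Notation cfg := {ffun 'I_d -> pat * conf n}.

Let W0 := wprod_ge0 (I := 'I_d) (@we0 n).

Section fixed_first.
Variables (x : 'I_d) (t1 : slot).
Hypothesis t1K : (0 < off t0 t1 <= K)%N.

Definition FB (c : cfg) : Prop := forall i, first1 x t1 i (c i).

Lemma Pr_FB_at (q : R) (Q : pat * conf n -> Prop) : 0 <= q ->
  Pr (@wen n) (fun v => ([disjoint v.1 & zset t0 t1 false] /\ t1 \in v.1) /\ Q v) <=
    q * Pr (@wen n) (fun v => [disjoint v.1 & zset t0 t1 false] /\ t1 \in v.1) ->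
  Pr W (fun c : cfg => FB c /\ Q (c x)) <= q * Pr W FB.
Proof.
move=> hq H.
rewrite (@eq_Pr _ _ _ _ (fun c : cfg => forall i,
   (fun i v => first1 x t1 i v /\ (i = x -> Q v)) i (c i))); last first.
  move=> c; split=> [[Fc Qc] i|Hc]; first by split; [apply: Fc|move=> ->].
  by split=> [i|]; [case: (Hc i)|case: (Hc x) => _; apply].
apply: (@Pr_prod_replace _ _ _ _ (@we0 n) q x
   (fun i v => first1 x t1 i v /\ (i = x -> Q v)) (fun i v => first1 x t1 i v)) => // [i v _ []//|].
rewrite (@eq_Pr _ _ _ (first1 x t1 x) _ (@first1x x t1 n)).
apply: le_trans H; apply: Pr_sub => // v [/first1x Fv Qv]; split=> //.
exact: Qv.
Qed.

Let late k (c : cfg) := exits_late t1 (c x) k.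

Lemma late_uniq k k' c : late k c -> late k' c -> k = k'.
Proof. by move=> [e _] [e' _]; apply: exits_det e e'. Qed.

Lemma FB_late k c : FB c -> late k c -> (K < off k t0)%N /\ (off t0 t1 <= off t0 k)%N.
Proof.
move=> Fc [ek kK]; split=> //; have /first1x[D _] := Fc x.
exact: exit_after D (exits_in ek) kK.
Qed.

(** For fixed [k] this is a product event over the children: each child other than [x] must avoid
    [K] slots about which nothing is known yet. *)
Lemma Pr_no_second :
  Pr W (fun c : cfg => FB c /\ exists k, late k c /\
    forall i, i != x -> [disjoint (c i).1 & win k K]) <=
  (1 - p) ^+ (K * d.-1) * Pr W FB.
Proof.
apply: le_trans (@Pr_bigU _ _ _ W0 _ predT _ (fun k (c : cfg) =>
   (FB c /\ late k c) /\ forall i, i != x -> [disjoint (c i).1 & win k K]) _) _.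
  by move=> c [Fc [k [lk Hk]]]; exists k.
apply: le_trans (_ : \sum_k (1 - p) ^+ (K * d.-1) * Pr W (fun c => FB c /\ late k c) <= _);
  last first.
  rewrite -mulr_sumr; apply: ler_wpM2l; first by rewrite exprn_ge0 // ltW.
  apply: Pr_disj => // [k c _ []//|k k' c _ _ [_ lk] [_ lk']].
  exact: late_uniq lk lk'.
apply: ler_sum => k _.
have [/andP[kK kt]|nk] := boolP ((K < off k t0)%N && (off t0 t1 <= off t0 k)%N); last first.
  rewrite Pr_false; first by rewrite mulr_ge0 ?exprn_ge0 ?Pr_ge0 // ltW.
  by move=> c [[Fc /(FB_late Fc) [a b]]]; rewrite a b in nk.
pose A1 i (v : pat * conf n) := first1 x t1 i v /\ (i = x -> exits_late t1 v k).
pose A2 i (v : pat * conf n) := A1 i v /\ (i != x -> [disjoint v.1 & win k K]).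
have -> : Pr W (fun c => FB c /\ late k c) = Pr W (fun c : cfg => forall i, A1 i (c i)).
  apply: eq_Pr => c; split=> [[Fc lc] i|Hc]; first by split; [apply: Fc|move=> ->].
  by split=> [i|]; [case: (Hc i)|case: (Hc x) => _; apply].
apply: le_trans (_ : Pr W (fun c : cfg => forall i, A2 i (c i)) <= _).
  apply: Pr_sub => // c [[Fc lc] Hc] i; split; last exact: Hc.
  by split; [apply: Fc|move=> ->].
rewrite !Pr_prod (bigD1 x) //= [X in _ <= _ * X](bigD1 x) //= mulrCA.
apply: ler_pM; [exact: Pr_ge0|by apply: prodr_ge0 => i _; apply: Pr_ge0| |].
  by apply: Pr_sub => // v [].
rewrite exprM (_ : ((1 - p) ^+ K) ^+ d.-1 = \prod_(i | i != x) (1 - p) ^+ K); last first.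
  by rewrite prodr_const cardC1 card_ord.
rewrite -big_split /=.
apply: ler_prod => i ix; rewrite Pr_ge0 //=.
rewrite (@eq_Pr _ _ _ (A1 i) (fun v => [disjoint v.1 & zset t0 t1 (i < x)%N])); last first.
  move=> v; split=> [[[]]//|D]; split; first split=> //.
  - by move=> E; rewrite E eqxx in ix.
  - by move=> E; rewrite E eqxx in ix.
apply: le_trans (_ : Pr (@wen n) (fun v => [disjoint v.1 & zset t0 t1 (i < x)%N :|: win k K]) <= _).
  apply: Pr_sub => // v [[[D1 _] _] /(_ ix) D2].
  by move: D1 D2; rewrite ![[disjoint v.1 & _]]disjoint_sym !disjoints_subset subUset => -> ->.
rewrite !Pr_avoid_we cardsU disjoint_setI0; last first.
  rewrite disjoint_sym disjoints_subset; apply/subsetP => s /(win_after t1K kK kt) lt.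
  by rewrite !inE; case: ifP => _; lia.
by rewrite cards0 subn0 card_win ?exprD 1?mulrC //; lia.
Qed.

Definition second k t2 (y : 'I_d) (i : 'I_d) (v : pat * conf n) : Prop :=
  (i != x -> [disjoint v.1 & zset k t2 (i < y)%N]) /\ (i = y -> t2 \in v.1).

Lemma second_uniq k t2 y t2' y' (c : cfg) : y != x -> y' != x ->
  (0 < off k t2)%N -> (0 < off k t2')%N ->
  (forall i, second k t2 y i (c i)) -> (forall i, second k t2' y' i (c i)) -> (t2, y) = (t2', y').
Proof.
move=> yx y'x k2 k2' H H'.
have [] := @first_bar_uniq d L (predC1 x) (fun i => (c i).1) k t2 y t2' y'.
- by apply/first_barE.
- by apply/first_barE.
by move=> -> ->.
Qed.

(** Splitting over the exclusive values of [k], then of [(t2, y)], turns everything into product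
    events. The coordinate [y] yields one factor [f]; summing back, the coordinate [x] yields the
    other. *)
Lemma Pr_two_exits :
  Pr W (fun c : cfg => FB c /\ exists k, late k c /\ exists y t2,
    [/\ y != x, (0 < off k t2 <= K)%N, forall i, second k t2 y i (c i) & entry_exits (c y) t2])
  <= f ^+ 2 * Pr W FB.
Proof.
pose Q2 k (u : slot * 'I_d) := (u.2 != x) && (0 < off k u.1 <= K)%N.
apply: le_trans (@Pr_bigU _ _ _ W0 _ predT _ (fun k (c : cfg) =>
   (FB c /\ late k c) /\ exists2 u, Q2 k u &
      (forall i, second k u.1 u.2 i (c i)) /\ entry_exits (c u.2) u.1) _) _.
  move=> c [Fc [k [lk [y [t2 [yx kt2 Hs He]]]]]]; exists k => //; split=> //.
  by exists (t2, y) => //; rewrite /Q2 /= yx.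
apply: le_trans (_ : f * \sum_k Pr W (fun c => FB c /\ late k c) <= _); last first.
  rewrite expr2 -mulrA; apply: ler_wpM2l => //.
  apply: le_trans (_ : Pr W (fun c => FB c /\ entry_exits (c x) t1) <= _).
    apply: Pr_disj => // [k c _ [Fc [ek _]]|k k' c _ _ [_ lk] [_ lk']].
      by split=> //; exists k.
    exact: late_uniq lk lk'.
  apply: (@Pr_FB_at f (fun v => entry_exits v t1)) => //.
  by apply: Pr_entry_exits => //; apply: notin_zset.
rewrite mulr_sumr; apply: ler_sum => k _.
have [/andP[kK kt]|nk] := boolP ((K < off k t0)%N && (off t0 t1 <= off t0 k)%N); last first.
  rewrite Pr_false; first by rewrite mulr_ge0 ?Pr_ge0.
  by move=> c [[Fc /(FB_late Fc) [a b]]]; rewrite a b in nk.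
apply: le_trans (@Pr_bigU _ _ _ W0 _ (Q2 k) _ (fun u (c : cfg) =>
   (FB c /\ late k c) /\ ((forall i, second k u.1 u.2 i (c i)) /\ entry_exits (c u.2) u.1)) _) _.
  by move=> c [Fc [u Qu Hu]]; exists u.
apply: le_trans (_ : \sum_(u | Q2 k u) f * Pr W (fun c : cfg =>
    (FB c /\ late k c) /\ (forall i, second k u.1 u.2 i (c i))) <= _); last first.
  rewrite -mulr_sumr; apply: ler_wpM2l => //; apply: Pr_disj => // [u c _ []//|].
  move=> [t2 y] [t2' y'] c /andP[/= yx /andP[k2 _]] /andP[/= y'x /andP[k2' _]] [_ H] [_ H'].
  exact: second_uniq H H'.
apply: ler_sum => -[t2 y] /andP[/= yx k2].
pose A1 i (v : pat * conf n) :=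
  [/\ first1 x t1 i v, (i = x -> exits_late t1 v k) & second k t2 y i v].
pose A2 i (v : pat * conf n) := A1 i v /\ (i = y -> entry_exits v t2).
apply: le_trans (_ : Pr W (fun c : cfg => forall i, A2 i (c i)) <= _).
  apply: Pr_sub => // c [[Fc lc] [Hs He]] i; split; last by move=> ->.
  by split=> //; move=> ->.
apply: le_trans (_ : f * Pr W (fun c : cfg => forall i, A1 i (c i)) <= _); last first.
  apply: ler_wpM2l => //; apply: Pr_sub => // c Hc; split; last by move=> i; case: (Hc i).
  by split=> [i|]; [case: (Hc i)|case: (Hc x) => _ + _; apply].
apply: (@Pr_prod_replace _ _ _ _ (@we0 n) f y A2 A1) => // [i v _ []//|].
set Z := zset t0 t1 (y < x)%N :|: zset k t2 false.
have t2Z : t2 \notin Z.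
  rewrite inE negb_or notin_zset andbT inE.
  have := win_after t1K kK kt (s := t2); rewrite inE => /(_ k2).
  by case: ifP => _; lia.
have A1E v : A1 y v <-> [disjoint v.1 & Z] /\ t2 \in v.1.
  have -> : [disjoint v.1 & Z] =
      [disjoint v.1 & zset t0 t1 (y < x)%N] && [disjoint v.1 & zset k t2 false].
    by rewrite ![[disjoint v.1 & _]]disjoint_sym !disjoints_subset subUset.
  rewrite /A1 /first1 /second ltnn yx; split.
    by case=> [[D1 _] _ [/(_ isT) D2 /(_ erefl) t2v]]; rewrite D1 D2.
  case=> /andP[D1 D2] t2v; split=> //.
    by split=> // E; rewrite E eqxx in yx.
  by move=> E; rewrite E eqxx in yx.
rewrite (@eq_Pr _ _ _ (A1 y) _ A1E).
apply: le_trans (Pr_entry_exits t2Z (Hf t2)).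
by apply: Pr_sub => // v [/A1E Av Ev]; split=> //; apply: Ev.
Qed.

End fixed_first.

Let bad (u : slot * 'I_d) (c : cfg) : Prop :=
  ((FB u.2 u.1 c /\ (exists2 s, s \in (c u.2).1 & (off s t0 <= K)%N)) \/
   (FB u.2 u.1 c /\ exists k, exits_late u.1 (c u.2) k /\
       exists2 s, s \in (c u.2).1 & s \in win k K)) \/
  ((FB u.2 u.1 c /\ exists k, exits_late u.1 (c u.2) k /\
       forall i, i != u.2 -> [disjoint (c i).1 & win k K]) \/
   (FB u.2 u.1 c /\ exists k, exits_late u.1 (c u.2) k /\ exists y t2,
      [/\ y != u.2, (0 < off k t2 <= K)%N,
          forall i, second u.2 k t2 y i (c i) & entry_exits (c y) t2])).

(** The bars [B] are independent of [c], so [H] must be determined by [c] alone: it consists of the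
    windows after [t0] and after the first return. If [B] misses them, the walk has to enter two
    children, and its return would put [c] in [bad]. *)
Lemma exits_cover (c : conf n.+1) :
  ((forall i, [disjoint (c i).1 & win t0 K]) \/
   exists2 u : slot * 'I_d, (0 < off t0 u.1 <= K)%N & bad u c) \/
  exists2 H : pat, (#|H| <= 2 * K)%N &
    forall B k0, exits c (t0 |: B) (nx t0) k0 -> exists2 s, s \in B & s \in H.
Proof.
have [?|] := pselect ((forall i, [disjoint (c i).1 & win t0 K]) \/
   exists2 u : slot * 'I_d, (0 < off t0 u.1 <= K)%N & bad u c); first by left.
move=> /not_orP[nN nbad]; right.
have [i [s [si sw]]] : exists i s, s \in (c i).1 /\ s \in win t0 K.
  apply: contrapT => H; apply: nN => i; rewrite disjoints_subset; apply/subsetP => s si.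
  by rewrite inE; apply/negP => sw; apply: H; exists i, s.
move: (sw); rewrite inE => /andP[s0 sK].
have [t1 [x [fb1 t1s]]] := @first_bar_ex d L predT (fun i => (c i).1) t0 i s isT si s0.
have t10 : (0 < off t0 t1)%N by case: fb1.
have t1K : (0 < off t0 t1 <= K)%N by rewrite t10 (leq_trans t1s).
have Fc : FB x t1 (c : cfg).
  have Hc := (@first_barE predT (fun i => (c i).1) t0 t1 x t10 isT).1 fb1.
  by move=> j; split; [apply: (Hc j).1|apply: (Hc j).2].
have {nbad} : ~ bad (t1, x) (c : cfg) by move=> b; apply: nbad; exists (t1, x).
move=> /not_orP[/not_orP[n1 n2] /not_orP[n3 n4]] /=.
have cw (k : slot) : (#|win k K| <= K)%N.
  by rewrite card_win //; lia.
have [[k ek]|nek] := pselect (entry_exits (c x) t1); last first.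
  exists (win t0 K) => [|B k0 ex]; first by apply: leq_trans (cw _) _; lia.
  apply: contrapT => nB; apply: nek.
  have [i'|s' |k ek _] := exits_first_bar ex fb1; [by []| |by exists k].
  rewrite !inE => /orP[/eqP->|s'B /andP[a b]]; first by rewrite off_id.
  by apply: nB; exists s' => //; rewrite inE a (leq_trans b) //; case/andP: t1K.
have kK : (K < off k t0)%N.
  rewrite ltnNge; apply/negP => H; apply: n1; split=> //.
  by exists k => //; apply: exits_in ek.
exists (win t0 K :|: win k K) => [|B k0 ex].
  by apply: leq_trans (leq_card_setU _ _) _; have := cw t0; have := cw k; lia.
apply: contrapT => nB; apply: n4; split=> //; exists k; split=> //.
have [i' [s' [i'x si' sw']]] : exists i s, [/\ i != x, s \in (c i).1 & s \in win k K].
  apply: contrapT => H; apply: n3; split=> //; exists k; split=> // j jx.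
  rewrite disjoints_subset; apply/subsetP => s' s'j.
  by rewrite inE; apply/negP => sw'; apply: H; exists j, s'.
move: (sw'); rewrite inE => /andP[s'0 s'K].
have [t2 [y [fb2 t2s]]] := @first_bar_ex d L (predC1 x) (fun i => (c i).1) k i' s' i'x si' s'0.
have t20 : (0 < off k t2)%N by case: fb2.
have t2K := leq_trans t2s s'K.
have yx : y != x by case: fb2.
exists y, t2; split=> //; first by rewrite t20.
  have Hc := (@first_barE (predC1 x) (fun i => (c i).1) k t2 y t20 yx).1 fb2.
  by move=> j; split; [apply: (Hc j).1|apply: (Hc j).2].
apply: exits_two_children (ex) (fb1) _ (ek) (kK) _ _ (fb2) (t2K).
- by case/andP: t1K.
- move=> u uB; split=> uw; apply: nB; exists u => //; rewrite !inE.
    by rewrite uw.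
  by rewrite uw orbT.
- move=> u uc uw; apply: n2; split=> //; exists k; split; first by split.
  by exists u; rewrite // inE.
Qed.

Lemma two_children_step :
  Pr (@wen n.+1) (fun v => exists k, exits v.2 (t0 |: v.1) (nx t0) k) <=
    (2 * K)%:R * p + (1 - p) ^+ (K * d) + (2 * K).+1%:R * r + (1 - p) ^+ (K * d.-1) + f ^+ 2.
Proof.
pose N0 (c : cfg) := forall i, [disjoint (c i).1 & win t0 K].
pose D (c : cfg) := N0 c \/ exists2 u : slot * 'I_d, (0 < off t0 u.1 <= K)%N & bad u c.
apply: le_trans (_ : Pr W D + (2 * K)%:R * p <= _).
  have -> : (2 * K)%:R * p = \sum_(c : conf n.+1) wc p c * ((2 * K)%:R * p).
    by rewrite -mulr_suml wc1 mul1r.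
  rewrite Pr_we_swap PrE -big_split; apply: ler_sum => c _ /=; rewrite -mulrDr.
  apply: ler_wpM2l; first exact: (wc_ge0 p01 (n := n.+1) c).
  have Kp : 0 <= (2 * K)%:R * p by rewrite mulr_ge0 // ltW.
  case: asboolP => [_|nD].
    by apply: le_trans (Pr_le1 wp0 (wp1 _ _) _) _; rewrite lerDl.
  have [//|[H HK Hc]] := exits_cover c.
  rewrite add0r; apply: le_trans (_ : Pr wpp (fun A => exists2 s, s \in A & s \in H) <= _).
    by apply: Pr_sub => // A [k /Hc].
  apply: le_trans (Pr_hit p01 H) _; apply: ler_wpM2r; first exact: ltW.
  by rewrite ler_nat.
rewrite addrC -!addrA lerD2l.
apply: le_trans (Pr_U W0 (B := N0) (C := fun c => exists2 u : slot * 'I_d,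
  (0 < off t0 u.1 <= K)%N & bad u c) (fun c H => H)) _.
apply: lerD.
  rewrite /N0 (Pr_prod _ (fun (i : 'I_d) (v : pat * conf n) => [disjoint v.1 & win t0 K])).
  under eq_bigr do rewrite Pr_avoid_we.
  by rewrite prodr_const card_ord -exprM card_win //; lia.
apply: le_trans (Pr_bigU W0 (Q := fun u : slot * 'I_d => (0 < off t0 u.1 <= K)%N)
   (B := bad) (fun c H => H)) _.
set q := (2 * K).+1%:R * r + _.
have q0' : 0 <= q.
  by apply: addr_ge0; [exact: mulr_ge0|apply: addr_ge0; apply: exprn_ge0 => //; exact: ltW].
apply: le_trans (_ : \sum_(u : slot * 'I_d | (0 < off t0 u.1 <= K)%N) q * Pr W (FB u.2 u.1) <= _);
  last first.
  rewrite -mulr_sumr -[X in _ <= X]mulr1; apply: ler_wpM2l => //.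
  apply: le_trans (@Pr_disj _ _ _ W0 _ _ _ (fun=> True) _ _) _ => //; last first.
    by apply: Pr_le1 => //; apply: wprod1.
  move=> [t1 x] [t1' x'] c /= /andP[k1 _] /andP[k1' _] H H'.
  have [] := @first_bar_uniq d L predT (fun i => (c i).1) t0 t1 x t1' x'.
  - by apply/first_barE => //= i; split=> [_|]; [apply: (H i).1|apply: (H i).2].
  - by apply/first_barE => //= i; split=> [_|]; [apply: (H' i).1|apply: (H' i).2].
  by move=> -> ->.
apply: ler_sum => -[t1 x] /= t1K.
apply: le_trans (Pr_U W0 (fun c H => H)) _.
have e1 := Pr_U W0 (fun c (H : (FB x t1 c /\ (exists2 s, s \in (c x).1 & (off s t0 <= K)%N)) \/
   (FB x t1 c /\ exists k, exits_late t1 (c x) k /\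
       exists2 s, s \in (c x).1 & s \in win k K)) => H).
have e2 := Pr_U W0 (fun c (H : (FB x t1 c /\ exists k, exits_late t1 (c x) k /\
       forall i, i != x -> [disjoint (c i).1 & win k K]) \/
   (FB x t1 c /\ exists k, exits_late t1 (c x) k /\ exists y t2,
      [/\ y != x, (0 < off k t2 <= K)%N,
          forall i, second x k t2 y i (c i) & entry_exits (c y) t2])) => H).
have b1 := Pr_FB_at x (mulr_ge0 (ler0n _ K.+1) r0) (Pr_hit_before n t1K).
have b2 := Pr_FB_at x (mulr_ge0 (ler0n _ K) r0) (Pr_hit_after n t1K).
have b3 := Pr_no_second x t1K.
have b4 := Pr_two_exits x t1K.
apply: le_trans (lerD (le_trans e1 (lerD b1 b2)) (le_trans e2 (lerD b3 b4))) _.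
rewrite /q mul2n -addnn -addSn natrD; set P := Pr W _; lra.
Qed.

End recursion.
End two_children.

From mathcomp Require Import all_classical all_reals all_analysis.
Import numFieldNormedType.Exports.

Section two_children_bound.
Variables (R : realFieldType) (p : R) (d L K : nat).
Hypothesis p01 : 0 < p < 1.

Lemma two_children_bound : (2 * K <= L)%N ->
  (2 * K)%:R * p + (1 - p) ^+ (K * d) + (2 * K).+1%:R * (p / (1 - p)) + (1 - p) ^+ (K * d.-1)
    <= 1 / 4 ->
  forall n t, Pr (@wc R p d L n) (fun c => exits c [set t] (nx t) t) <= 1 - 1 / 2.
Proof.
move=> KL Ha n t.
have H m s : Pr (@we R p d L m) (fun v => exists k, exits v.2 (s |: v.1) (nx s) k) <= 1 / 2.
  elim: m s => [|m IH] s; first by rewrite Pr_false => [|v [] //]; lra.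
  have := @two_children_step _ _ _ _ p01 K s KL m (1 / 2) _ IH; move/(_ ltac:(lra)).
  by move/le_trans; apply; rewrite expr2; lra.
(* Random bars added to the single entrance bar can only make a return more likely. *)
apply: le_trans (_ : Pr (@we R p d L n) (fun v => exists k, exits v.2 (t |: v.1) (nx t) k) <= _).
  rewrite Pr_we -[X in X <= _]mul1r -(wp1 p 'I_L.+1) mulr_suml; apply: ler_sum => S _.
  apply: ler_wpM2l; first exact: wp_ge0.
  apply: Pr_sub => [|c ex /=]; first exact: wc_ge0.
  by apply: exits_super ex; rewrite finset.sub1set finset.setU11.
by apply: le_trans (H n t) _; lra.
Qed.
End two_children_bound.

(** * Numerical estimates and the choice of constants in both regimes *)

Section bounds.
Variable R : realType.
Implicit Types (eta T e l u : R).

Lemma expRN_bounds eta : 0 < eta -> 0 < 1 - expR (- eta) < 1.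
Proof.
by move=> e0; rewrite subr_gt0 expR_lt1 oppr_lt0 e0 /= ltrBlDr ltrDl expR_gt0.
Qed.

Lemma one_minus_expR_le eta : 1 - expR (- eta) <= eta.
Proof. by have := expR_ge1Dx (- eta); lra. Qed.

Lemma one_minus_expR_ge eta : 0 < eta -> eta * (1 - eta) <= 1 - expR (- eta).
Proof.
move=> e0; have := expR_ge1Dx eta; rewrite expRN => H.
have : (expR eta)^-1 <= (1 + eta)^-1 by rewrite lef_pV2 ?posrE //; lra.
have : (1 + eta) * (1 + eta)^-1 = 1 by rewrite divff //; lra.
by set z := (1 + eta)^-1; nra.
Qed.

(** Squaring [1 + x / 2] gives [2.95 ^ 2], whereas [1 + x] would be too weak. The bound is applied
    to an exponent close to 4. *)
Lemma expRN_small x : 39 / 10 <= x -> expR (- x) <= 116 / 1000 :> R.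
Proof.
move=> hx; have := expR_ge1Dx (x / 2).
have -> : expR (- x) = (expR (x / 2) * expR (x / 2))^-1.
  by rewrite expRN -expRD; congr (expR _)^-1; lra.
move=> H.
set z := expR (x / 2) in H *; have z0 : 295 / 100 <= z by lra.
rewrite -[_ / 1000]invrK lef_pV2 ?posrE; [|nra|].
  have -> : (116 / 1000 : R)^-1 = 1000 / 116 by rewrite invf_div.
  by nra.
by rewrite invr_gt0; lra.
Qed.

(* With [l = d T] and [e = 1 / d], the left-hand side is the limit, as the mesh
   goes to [0], of a lower bound for the mean number of good children. *)
Lemma critical_inequality eps e l : 0 < eps -> 0 < e -> e <= 1 / 100 ->
  e * (30 * 9 ^+ 4) <= eps -> 1 + (7 / 6 + eps) * e <= l -> l <= 9 ->
  1 < (1 - l * e) * (l - l ^+ 3 * e / 6 - l ^+ 5 * e ^+ 2).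
Proof.
move=> eps0 e0 e1 + hl l9; have eW := ltW e0; have ee := mulr_ge0 eW eW.
have epsW := ltW eps0; have epse := mulr_gt0 eps0 e0.
have l0 : 0 <= l by have : 0 <= (7 / 6 + eps) * e by [apply: mulr_ge0; lra]; lra.
have : l ^+ 4 <= 9 ^+ 4 by apply: lerXn2r => //; rewrite nnegrE.
have : 100 <= 9 ^+ 4 :> R by rewrite -natrX ler_nat.
set c := 9 ^+ 4 => c100 l4 he.
(* The product of two negative corrections is positive and is dropped. *)
have step1 : l * (1 - l * e - l ^+ 2 * e / 6 - l ^+ 4 * e ^+ 2) <=
    (1 - l * e) * (l - l ^+ 3 * e / 6 - l ^+ 5 * e ^+ 2).
  rewrite -subr_ge0 [X in 0 <= X](_ : _ = l * e * (l ^+ 3 * e * 6^-1 + l ^+ 5 * e ^+ 2)); last by ring.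
  apply: mulr_ge0; first exact: mulr_ge0.
  by apply: addr_ge0; rewrite ?mulr_ge0 ?exprn_ge0.
apply: lt_le_trans step1.
have m0 : 0 <= l - 1 by have : 0 <= (7 / 6 + eps) * e by [apply: mulr_ge0; lra]; lra.
(* The chord of this convex function over [[1, 9]] starts at [7/6] with slope [8/3], rounded up to
   3. *)
have step2 : l + l ^+ 2 / 6 <= 7 / 6 + 3 * (l - 1).
  have : 0 <= (l - 1) * (9 - l) by apply: mulr_ge0 => //; lra.
  by clear -m0; rewrite expr2; lra.
have step3 : 1 - (7 / 6 + 3 * (l - 1)) * e - c * (e * e)
    <= 1 - l * e - l ^+ 2 * e / 6 - l ^+ 4 * e ^+ 2.
  rewrite [e ^+ 2]expr2; have := ler_wpM2r eW step2; have := ler_wpM2r ee l4.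
  by clear; lra.
apply: lt_le_trans (ler_wpM2l l0 step3).
set mu := l - 1 in m0 *; have lE : l = mu + 1 by rewrite subrK.
have mu8 : mu <= 8 by rewrite /mu; clear -l9; lra.
have h0 : (7 / 6 + eps) * e <= mu by rewrite /mu; clear -hl; lra.
have h9 : 0 <= mu * e by apply: mulr_ge0.
have h2 : mu * (mu * e) <= 8 * (mu * e) by apply: ler_wpM2r.
have cee : 0 <= c * (e * e) by apply: mulr_ge0 => //; clear -c100; lra.
have h3 : mu * (c * (e * e)) <= 8 * (c * (e * e)) by apply: ler_wpM2r.
have h4 := ler_wpM2r eW he.
have h5 : 100 * (e * e) <= c * (e * e) by apply: ler_wpM2r.
(* The terms of order [mu * e] have total coefficient at most [25/6 + 3 * 8 < 30]. *)
have h6 : 0 <= (mu - (7 / 6 + eps) * e) * (1 - 30 * e).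
  by apply: mulr_ge0; [rewrite subr_ge0|clear -e1; lra].
have h7 : eps * e * e <= eps * e * (1 / 100) by apply: ler_wpM2l => //; apply: ltW.
rewrite lE; clear -h2 h3 h4 h5 h6 h7 h9 epse cee; lra.
Qed.

(** Used with a polynomial in [1 / N] whose value at 0 is the limit for fine meshes; dividing by
    ['X] gives continuity at 0. *)
Lemma horner_near0 (P : {poly R}) (a : R) : a < P.[0] ->
  exists N0, forall N, (N0 <= N)%N -> a < P.[N%:R^-1].
Proof.
move=> aP; have [Q QP] : exists Q, P - P.[0]%:P = Q * ('X - 0%:P).
  by apply/factor_theorem; rewrite rootE !hornerE subrr.
have [b bQ] := poly_disk_bound Q 1.
exists (Num.truncn (b / (P.[0] - a))).+1 => N hN.
have N0 : (0 < N)%N by apply: leq_trans hN.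
have NR : 0 < N%:R :> R by rewrite ltr0n.
have bN : b / (P.[0] - a) < N%:R.
  by apply: lt_le_trans (truncnS_gt _) _; rewrite ler_nat.
rewrite ltr_pdivrMr ?subr_gt0 // in bN.
have uN : `|N%:R^-1| <= 1 :> R.
  by rewrite ger0_norm ?invr_ge0 // invf_le1 // ler1n.
have /(congr1 (horner^~ N%:R^-1)) := QP; rewrite !hornerE subr0 => E.
have := bQ _ uN; rewrite ler_norml => /andP[bl _].
have : - b * N%:R^-1 <= Q.[N%:R^-1] * N%:R^-1 by apply: ler_wpM2r; rewrite ?invr_ge0.
have : b * N%:R^-1 < P.[0] - a by rewrite ltr_pdivrMr // mulrC.
by rewrite -E mulNr; lra.
Qed.

Variable d : nat.
Local Notation D := (d%:R : R).

(* The first [N ^ 2] slots cover [0, T].  As the discretisation of a clock restarts at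
   each ring, a ring with at most [N] predecessors is assigned a slot that is late by at
   most [N]; hence the [N] additional slots. *)
Definition mesh (T : R) N : R := T / N%:R ^+ 2.
Definition slots N := (N ^ 2 + N)%N.
Definition prob (T : R) N : R := 1 - expR (- mesh T N).

Lemma probC T N k : (1 - prob T N) ^+ k = expR (- (k%:R * mesh T N)).
Proof. by rewrite /prob opprB addrC subrK -expRM_natl mulrN. Qed.

Lemma escape_large (T : R) : (2000 <= d)%N -> 9 / D <= T ->
  exists N0, forall N, (N0 <= N)%N -> forall n t,
    Pr (@wc R (prob T N) d (slots N) n) (fun c => exits c [set t] (nx t) t) <= 1 - 1 / 2.
Proof.
move=> d2000 hT; have D2000 : 2000 <= D by rewrite ler_nat.
have D0 : 0 < D by clear -D2000; lra.
have T0 : 0 < T by apply: lt_le_trans hT; apply: divr_gt0.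
exists (Num.truncn (4000 * T)).+2 => N hN.
have N2 : (2 <= N)%N by apply: leq_trans hN.
have NR : 2 <= N%:R :> R by rewrite ler_nat.
have NT : 4000 * T < N%:R.
  by apply: lt_le_trans (truncnS_gt _) _; rewrite ler_nat; apply: ltnW.
have NN0 : 0 < N%:R ^+ 2 :> R by rewrite exprn_gt0 // ltr0n; apply: leq_trans N2.
set e := mesh T N.
have e0 : 0 < e by apply: divr_gt0.
have eE : e * N%:R ^+ 2 = T by rewrite /e /mesh divfK // gt_eqF.
have e1 : e <= 1 / 4000.
  rewrite /e /mesh ler_pdivrMr // expr2.
  by have : N%:R <= N%:R * N%:R :> R by [rewrite ler_peMl //; clear -NR; lra]; clear -NT; lra.
have De0 : 0 < D * e by apply: mulr_gt0.
(* A window of length about [4 / d], in which the [d] children together expect more than 4 bars; two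
   such windows fit because [T >= 9 / d]. *)
set K := (Num.truncn (4 / (D * e))).+1.
have K1 : 4 / (D * e) < K%:R by apply: truncnS_gt.
have K2 : K%:R <= 4 / (D * e) + 1.
  by rewrite /K -[X in X <= _]natr1 lerD2r Num.Theory.truncn_le divr_ge0 // ltW.
have KDe : 4 < K%:R * e * D by move: K1; rewrite ltr_pdivrMr // -mulrA [e * D]mulrC.
have Ke : K%:R * e <= 4 / D + e.
  have := ler_wpM2r (ltW e0) K2; rewrite mulrDl mul1r invfM -!mulrA mulVf ?gt_eqF //.
  by rewrite mulr1.
have D4 : 4 / D <= 1 / 500 by rewrite ler_pdivrMr //; clear -D2000; lra.
have KL : (2 * K <= slots N)%N.
  rewrite -(ler_nat R) natrM /slots natrD natrX.
  have : 4 / (D * e) <= 4 / 9 * N%:R ^+ 2.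
    rewrite ler_pdivrMr // mulrACA -mulrA; move: hT; rewrite ler_pdivrMr // -eE.
    by set z := N%:R ^+ 2; clear; lra.
  have : 0 <= (N%:R - 2) * N%:R :> R by apply: mulr_ge0 => //; rewrite subr_ge0.
  move: K2 NR; rewrite expr2.
  by set z := 4 / _; clear; lra.
have p01 : 0 < prob T N < 1 by apply: expRN_bounds.
have pe : prob T N <= e by apply: one_minus_expR_le.
apply: two_children_bound KL _ => //.
have p2 : prob T N / (1 - prob T N) <= 2 * e.
  rewrite ler_pdivrMr; last by case/andP: p01 => _; rewrite subr_gt0.
  have h : 0 <= 1 / 2 - prob T N by move: pe e1; clear; lra.
  by have := mulr_ge0 (ltW e0) h; move: pe; set q := prob T N; clear; lra.
have a1 : (2 * K)%:R * prob T N <= 2 * (K%:R * e).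
  by rewrite natrM -mulrA; apply: ler_wpM2l => //; apply: ler_wpM2l.
have a2 : (2 * K).+1%:R * (prob T N / (1 - prob T N)) <= 4 * (K%:R * e) + 2 * e.
  apply: le_trans (ler_wpM2l (ler0n _ _) p2) _.
  by rewrite -natr1 natrM; clear; lra.
have a3 : (1 - prob T N) ^+ (K * d.-1) <= 116 / 1000.
  rewrite probC; apply: expRN_small; rewrite natrM -/e -subn1 natrB; last by apply: leq_trans d2000.
  have -> : K%:R * (D - 1) * e = K%:R * e * D - K%:R * e by ring.
  by move: KDe Ke D4 e1; set z := K%:R * e; set w := 4 / D; clear; lra.
have a4 : (1 - prob T N) ^+ (K * d) <= 116 / 1000.
  rewrite probC; apply: expRN_small; rewrite natrM -/e.
  have -> : K%:R * D * e = K%:R * e * D by ring.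
  by move: KDe; clear; lra.
(* The two empty-window terms use [0.232] of the budget [1/4]; the remaining terms are at most
   [24 / d + 8 e]. *)
by move: a1 a2 a3 a4 Ke D4 e1; set z := K%:R * e; set w := 4 / D; clear; lra.
Qed.
End bounds.

Section window.
Variables (R : realType) (d : nat).
Local Notation D := (d%:R : R).

(** Replacing [p] by the mesh makes the bound polynomial in [u = 1 / N]; [T * s] is the total length
    of the [N ^ 2 + N + 1] slots. *)
Lemma window_mean_ge (T : R) N : (0 < N)%N -> 0 < T ->
  let u : R := N%:R^-1 in let s := 1 + u + u ^+ 2 in
  let b := T * (1 - T * u ^+ 2) - D * T ^+ 2 * u ^+ 2 * s - D ^+ 2 * (T * s) ^+ 5
           - D * (T * s) ^+ 3 / 6 in
  0 <= b -> 0 <= 1 - T * s ->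
  (1 - T * s) * b <= window_mean (prob T N) d (slots N).
Proof.
move=> N0 T0 u s b b0 Ts.
have NR : 0 < N%:R :> R by rewrite ltr0n.
have u0 : 0 < u by rewrite invr_gt0.
have Nu : N%:R = u^-1 :> R by rewrite invrK.
set e := mesh T N; have eE : e = T * u ^+ 2 by rewrite /e /mesh /u exprVn.
have e0 : 0 < e by rewrite eE mulr_gt0 // exprn_gt0.
have LE : (slots N)%:R * e = T * (1 + u) :> R.
  by rewrite eE /slots natrD natrX Nu; field; rewrite gt_eqF.
have L1E : (slots N).+1%:R * e = T * s :> R.
  by rewrite -natr1 mulrDl LE mul1r eE /s; ring.
have D0 : 0 <= D by [].
have p01 : 0 < prob T N < 1 by apply: expRN_bounds.
have p0 : 0 <= prob T N by case/andP: p01 => /ltW.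
have pe : prob T N <= e by apply: one_minus_expR_le.
have pe' : e * (1 - e) <= prob T N by apply: one_minus_expR_ge.
set p := prob T N in p01 p0 pe pe' *; set L := slots N in LE L1E *.
have s0 : 0 <= s by rewrite /s !addr_ge0 ?sqr_ge0 // ltW.
have Ts0 : 0 <= T * s by rewrite mulr_ge0 // ltW.
have Mle : L.+1%:R * p <= T * s by rewrite -L1E; apply: ler_wpM2l.
have M0 : 0 <= L.+1%:R * p by apply: mulr_ge0.
have LpM : L%:R * p <= L.+1%:R * p by apply: ler_wpM2r => //; rewrite ler_nat.
have Lp0 : 0 <= L%:R * p by apply: mulr_ge0.
have e1 : 0 <= 1 - e.
  have : e <= T * s.
    rewrite eE; apply: ler_wpM2l; first exact: ltW.
    by rewrite /s lerDr; clear -u0; lra.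
  by move: Ts; clear; lra.
have Lp : T * (1 - e) <= L%:R * p.
  apply: le_trans (ler_wpM2l (ler0n _ L) pe'); rewrite mulrA LE.
  have : 0 <= T * u * (1 - e) by apply: mulr_ge0 => //; apply: mulr_ge0; apply: ltW.
  by clear; lra.
set X := L%:R * p - L%:R * p * (D * p) - L%:R * p * (D ^+ 2 * (L.+1%:R * p) ^+ 4)
         - D * (L.+1%:R * p) ^+ 3 / 6.
have bX : b <= X.
  have x1 : L%:R * p * (D * p) <= D * T ^+ 2 * u ^+ 2 * s.
    have -> : D * T ^+ 2 * u ^+ 2 * s = T * s * (D * e) by rewrite eE; ring.
    apply: ler_pM => //; [exact: mulr_ge0|exact: le_trans Mle|exact: ler_wpM2l].
  have x2 : L%:R * p * (D ^+ 2 * (L.+1%:R * p) ^+ 4) <= D ^+ 2 * (T * s) ^+ 5.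
    have -> : D ^+ 2 * (T * s) ^+ 5 = T * s * (D ^+ 2 * (T * s) ^+ 4) by ring.
    apply: ler_pM => //; [|exact: le_trans Mle|].
      by apply: mulr_ge0; apply: exprn_ge0.
    apply: ler_wpM2l; first exact: exprn_ge0.
    by apply: lerXn2r; rewrite ?nnegrE.
  have x3 : D * (L.+1%:R * p) ^+ 3 / 6 <= D * (T * s) ^+ 3 / 6.
    apply: ler_wpM2r; first by rewrite invr_ge0.
    by apply: ler_wpM2l => //; apply: lerXn2r; rewrite ?nnegrE.
  by rewrite /b /X -eE; move: Lp x1 x2 x3; clear; lra.
have -> : window_mean p d L = (1 - p) ^+ L * X by rewrite /window_mean /X; field.
apply: ler_pM => //.
rewrite probC LE; apply: le_trans (expR_ge1Dx _).
by rewrite lerD2l lerN2; apply: ler_wpM2l; [exact: ltW|rewrite /s lerDl sqr_ge0].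
Qed.

Lemma escape_window (T : R) : (100 <= d)%N -> 0 < T -> T <= 9 / D ->
  1 < (1 - T) * (D * (T - D ^+ 2 * T ^+ 5 - D * T ^+ 3 / 6)) ->
  exists2 c0 : R, 0 < c0 & exists N0, forall N, (N0 <= N)%N -> forall n t,
    Pr (@wc R (prob T N) d (slots N) n) (fun c => exits c [set t] (nx t) t) <= 1 - c0.
Proof.
move=> d100 T0 T9 H.
have D100 : 100 <= D by rewrite ler_nat.
have D0 : 0 < D by clear -D100; lra.
pose S : {poly R} := 1 + 'X + 'X ^+ 2.
pose P : {poly R} := (1 - T%:P * S) * (D%:P * (T%:P * (1 - T%:P * 'X ^+ 2)
   - (D * T ^+ 2)%:P * 'X ^+ 2 * S - (D ^+ 2)%:P * (T%:P * S) ^+ 5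
   - (D / 6)%:P * (T%:P * S) ^+ 3)).
have PE u : P.[u] = (1 - T * (1 + u + u ^+ 2)) * (D * (T * (1 - T * u ^+ 2)
    - D * T ^+ 2 * u ^+ 2 * (1 + u + u ^+ 2) - D ^+ 2 * (T * (1 + u + u ^+ 2)) ^+ 5
    - D * (T * (1 + u + u ^+ 2)) ^+ 3 / 6)).
  by rewrite /P /S !(hornerD, hornerN, hornerM, horner_exp, hornerX, hornerC); ring.
set a := (1 - T) * _ in H.
have P0 : P.[0] = a by rewrite PE /a; ring.
have [N0 HN0] : exists N0, forall N, (N0 <= N)%N -> (1 + a) / 2 < P.[N%:R^-1].
  by apply: horner_near0; rewrite P0; move: H; clear; lra.
(* Half of the excess [a - 1] is given up to the mesh; the other half pays for the term [d ^ 2 * c0]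
   of [window_bound]. *)
pose c0 := Num.min 1 ((a - 1) / 2) / D ^+ 2.
have m0 : 0 < Num.min 1 ((a - 1) / 2) by rewrite lt_min ltr01 /=; move: H; clear; lra.
have c0_gt0 : 0 < c0 by apply: divr_gt0 => //; apply: exprn_gt0.
have c0_le1 : c0 <= 1.
  rewrite ler_pdivrMr ?exprn_gt0 // mul1r; apply: le_trans (_ : 1 <= _).
    by rewrite ge_min lexx.
  by apply: exprn_ege1; clear -D100; lra.
exists c0 => //; exists (maxn N0 1) => N; rewrite geq_max => /andP[/HN0 PN N1] n t.
apply: window_bound; first by apply: expRN_bounds; apply: divr_gt0 => //; rewrite exprn_gt0 // ltr0n.
  by rewrite ltW.
have -> : D ^+ 2 * c0 = Num.min 1 ((a - 1) / 2).
  by rewrite /c0 mulrC divfK // gt_eqF // exprn_gt0.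
apply: le_trans (_ : 1 + (a - 1) / 2 <= _); first by rewrite lerD2l ge_min lexx orbT.
apply: le_trans (_ : P.[N%:R^-1] <= _); first by move: PN; clear; lra.
set u := N%:R^-1 in PN *.
have u0 : 0 < u by rewrite invr_gt0 ltr0n.
have u1 : u <= 1 by rewrite invf_le1 ?ltr0n // ler1n.
have Ts : 0 < 1 - T * (1 + u + u ^+ 2).
  have : T <= 9 / 100 by apply: le_trans T9 _; rewrite ler_pM2l // lef_pV2 ?posrE.
  have : u ^+ 2 <= 1 by rewrite exprn_ile1 // ltW.
  have s3 : 1 + u + u ^+ 2 <= 3 by have : u ^+ 2 <= 1 by [rewrite exprn_ile1 // ltW]; clear -u1; lra.
  by have := ler_wpM2l (ltW T0) s3; clear; lra.
have Ppos : 0 < P.[u] by apply: lt_trans PN; move: H; clear; lra.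
move: Ppos; rewrite PE pmulr_rgt0 // pmulr_rgt0 // => b0.
have := window_mean_ge N1 T0 (ltW b0) (ltW Ts).
by move/(ler_wpM2l (ltW D0)); apply: le_trans; rewrite mulrCA.
Qed.

End window.

Lemma escape_bound (R : realType) (eps : R) : 0 < eps ->
  exists d0 : nat, (2 <= d0)%N /\ forall d, (d0 <= d)%N ->
    forall T : R, d%:R^-1 + (7 / 6 + eps) * (d%:R ^+ 2)^-1 <= T ->
    0 < T /\ exists2 c0 : R, 0 < c0 & exists N0, forall N, (N0 <= N)%N -> forall n t,
      Pr (@wc R (prob T N) d (slots N) n) (fun c => exits c [set t] (nx t) t) <= 1 - c0.
Proof.
move=> eps0; exists (maxn 2000 (Num.truncn (30 * 9 ^+ 4 / eps)).+1); split.
  by rewrite leq_max.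
move=> d; rewrite geq_max => /andP[d2000 deps] T hT.
have D2000 : 2000 <= d%:R :> R by rewrite ler_nat.
have D0 : 0 < d%:R :> R by clear -D2000; lra.
have T0 : 0 < T.
  apply: lt_le_trans hT; apply: addr_gt0; first by rewrite invr_gt0.
  by apply: mulr_gt0; [clear -eps0; lra|rewrite invr_gt0 exprn_gt0].
split=> //.
have [T9|T9] := lerP (9 / d%:R) T.
  have [N0 HN0] := escape_large d2000 T9.
  by exists (1 / 2) => //; exists N0.
apply: escape_window => //; [by apply: leq_trans d2000|exact: ltW|].
set D := d%:R in D2000 D0 hT T9 *; set e := D^-1.
have e0 : 0 < e by rewrite invr_gt0.
have De : D * e = 1 by rewrite mulfV // gt_eqF.
have TE : T = (D * T) * e by rewrite mulrAC De mul1r.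
set l := D * T in TE.
have -> : (1 - T) * (D * (T - D ^+ 2 * T ^+ 5 - D * T ^+ 3 / 6)) =
    (1 - l * e) * (l - l ^+ 3 * e / 6 - l ^+ 5 * e ^+ 2).
  rewrite /l /e; field; by rewrite gt_eqF.
apply: (@critical_inequality _ eps) => //.
- by rewrite /e -div1r ler_pdivrMr //; clear -D2000; lra.
- have : 30 * 9 ^+ 4 / eps <= D.
    by apply: ltW; apply: lt_le_trans (truncnS_gt _) _; rewrite /D ler_nat.
  by rewrite ler_pdivrMr // => h; rewrite /e mulrC ler_pdivrMr // [eps * _]mulrC.
- have := ler_wpM2l (ltW D0) hT; rewrite -/l; apply: le_trans.
  suff -> : 1 + (7 / 6 + eps) * e = D * (D^-1 + (7 / 6 + eps) / D ^+ 2) by [].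
  by rewrite /e; field; rewrite gt_eqF.
- by move/ltW: T9; rewrite ler_pdivlMr // mulrC.
Qed.

(** * Discretisation of the clocks *)

Section events.
Variables (d L : nat).
Local Notation slot := 'I_L.+1.
Local Notation pat := {set slot}.
Local Notation conf := (conf d L).

(* [nice] configurations are those for which the order of the slots is the order of the
   rings of the clocks, despite the delay of at most [N] slots. *)
Definition edge_ok N (A : pat) : Prop :=
  (#|A| <= N)%N /\ forall m, m \in A -> (m < N ^ 2)%N.

Definition sepd N (A B : pat) : Prop :=
  forall m m', m \in A -> m' \in B -> (m + N <= m')%N \/ (m' + N <= m)%N.

Fixpoint nice N n : pat * conf n -> Prop :=
  match n return pat * conf n -> Prop with
  | 0 => fun ec => edge_ok N ec.1
  | n'.+1 => fun ec =>
      [/\ edge_ok N ec.1, forall i, sepd N ec.1 (ec.2 i).1,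
          forall i j, i != j -> sepd N (ec.2 i).1 (ec.2 j).1
        & forall i, nice N (ec.2 i)]
  end.

Fixpoint incr n : conf n -> nat -> Prop :=
  match n return conf n -> nat -> Prop with
  | 0 => fun _ _ => True
  | n'.+1 => fun c a => exists i m,
      [/\ m \in (c i).1, (a <= m)%N & incr (c i).2 m.+1]
  end.

(* Some vertex at depth [l] has no bar above it and the walk started there
   at time [0] reaches [n] levels further down. *)
Fixpoint succeeds l n : pat * conf (l + n) -> Prop :=
  match l return pat * conf (l + n) -> Prop with
  | 0 => fun ec => ec.1 = finset.set0 /\ ~ exits ec.2 [set ord_max]%SET (nx ord_max) ord_max
  | l'.+1 => fun ec => exists i, succeeds ((ec.2 : {ffun 'I_d -> pat * conf (l' + n)}) i)
  end.

End events.

(** * Probabilities of the events on configurations *)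

Section probabilities.
Variables (R : realFieldType) (p : R) (d L : nat).
Hypothesis p01 : 0 < p < 1.
Local Notation slot := 'I_L.+1.
Local Notation pat := {set slot}.
Local Notation conf := (conf d L).
Local Notation wpp := (@wp R p slot).
Local Notation wen := (@we R p d L).
Local Notation wcn := (@wc R p d L).
Let p0 : 0 <= p. Proof. by case/andP: p01 => /ltW. Qed.
Let wp0 := @wp_ge0 R p slot p01.
Let we0 n := @we_ge0 R p d L p01 n.
Let we1' n : \sum_(ec : pat * conf n) we p ec = 1.
Proof. by apply: we1 => //; apply: wc1. Qed.
Let M : R := L.+1%:R.

Lemma Pr_we_fst n (Q : pat -> Prop) : Pr (@wen n) (fun v => Q v.1) = Pr wpp Q.
Proof.
rewrite Pr_we_swap; under eq_bigr do rewrite /=.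
by rewrite -mulr_suml wc1 mul1r.
Qed.

Lemma Pr_we_snd n (Q : conf n -> Prop) : Pr (@wen n) (fun v => Q v.2) = Pr (@wcn n) Q.
Proof.
rewrite Pr_we; under eq_bigr do rewrite /=.
by rewrite -mulr_suml wp1 mul1r.
Qed.

Lemma Pr_we_and n (Q : pat -> Prop) (Q' : conf n -> Prop) :
  Pr (@wen n) (fun v => Q v.1 /\ Q' v.2) = Pr wpp Q * Pr (@wcn n) Q'.
Proof.
rewrite Pr_we [Pr wpp Q]PrE mulr_suml; apply: eq_bigr => S _; rewrite -mulrA; congr (_ * _).
case: asboolP => QS; last by rewrite mul0r Pr_false // => c [].
by rewrite mul1r; apply: eq_Pr => c; split=> [[]|].
Qed.

Lemma Pr_edge_ok N : (0 < N)%N ->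
  Pr wpp (fun A => ~ edge_ok N A) <= M * p / N%:R + (L.+1 - N ^ 2)%:R * p.
Proof.
move=> N0; apply: le_trans (@Pr_U _ _ _ wp0 _ (fun A => (N < #|A|)%N)
   (fun A => exists2 s, s \in A & s \in [set s : slot | N ^ 2 <= s]%N) _) _.
  move=> A /not_andP[/negP|/existsNP[m /not_implyP[mA /negP]]]; first by rewrite -ltnNge; left.
  by rewrite -leqNgt => mN; right; exists m; rewrite // inE.
apply: lerD.
  rewrite ler_pdivlMr ?ltr0n // mulrC.
  have := Pr_card slot p01 N; rewrite card_ord; apply: le_trans.
  by apply: ler_wpM2r; [exact: Pr_ge0|rewrite ler_nat].
apply: le_trans (Pr_hit p01 _) _; apply: ler_wpM2r => //; rewrite ler_nat.
rewrite (_ : [set s | _]%SET = [set inord (N ^ 2 + a) | a : 'I_(L.+1 - N ^ 2)]%SET).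
  by rewrite (leq_trans (leq_imset_card _ _)) // card_ord.
apply/setP => s; rewrite inE; apply/idP/imsetP => [Hs|[b _ ->]].
  have sL : (s - N ^ 2 < L.+1 - N ^ 2)%N by have := ltn_ord s; lia.
  by exists (Ordinal sL) => //; apply: val_inj; rewrite /= inordK; have := ltn_ord s; lia.
by have bL := ltn_ord b; rewrite inordK; lia.
Qed.

Definition close N (u : slot * slot) := (u.1 < u.2 + N)%N && (u.2 < u.1 + N)%N.

Lemma not_sepd N (A B : pat) : ~ sepd N A B ->
  exists2 u, close N u & u.1 \in A /\ u.2 \in B.
Proof.
move=> /existsNP[m /existsNP[m' /not_implyP[mA /not_implyP[mB /not_orP[/negP h /negP h']]]]].
by exists (m, m') => //; rewrite /close /=; lia.
Qed.

Lemma card_close N : (#|close N| <= L.+1 * (2 * N))%N.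
Proof.
pose f (u : slot * slot) : slot * 'I_(2 * N).+1 := (u.1, inord (u.2 + N - u.1)).
have finj : {in close N &, injective f}.
  move=> [a b] [a' b']; rewrite !unfold_in /close /= => /andP[h1 h2] /andP[h3 h4].
  move=> [aa] /(congr1 val) /=; rewrite !inordK; try lia.
  by move=> E; congr (_, _) => //; apply: val_inj => /=; move: h1 h2 h3 h4 E; rewrite aa; lia.
rewrite -(card_in_imset finj).
have : [set f u | u in close N]%SET \subset finset.setX [set: slot]%SET [set~ ord0]%SET.
  apply/fintype.subsetP => y /imsetP[[a b] + ->]; rewrite unfold_in /close /= => /andP[h1 h2].
  change (is_true (f (a, b) \in finset.setX [set: slot]%SET [set~ ord0]%SET)).
  rewrite /f finset.in_setX finset.in_setT finset.in_setC1 -val_eqE /= inordK.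
  - by have {h1}h1 : (a < b + N)%N := h1; lia.
  - by have {h2}h2 : (b < a + N)%N := h2; lia.
move/subset_leq_card; rewrite finset.cardsX cardsT card_ord => /leq_trans; apply.
by rewrite cardsC1 card_ord.
Qed.

Let close_sum N : \sum_(u | close N u) p ^+ 2 <= M * (2 * N)%:R * p ^+ 2.
Proof.
rewrite sumr_const -[X in X <= _]mulr_natl; apply: ler_wpM2r; first exact: sqr_ge0.
by rewrite /M -natrM ler_nat; apply: card_close.
Qed.

(** There are about [2 N ^ 3] pairs of slots closer than [N], each jointly occupied with probability
    of order [N ^ -4], so conflicts have probability [O(1 / N)]. *)
Lemma nice_step N n :
  Pr (@wen n.+1) (fun v => ~ nice N v) <=
    Pr wpp (fun A => ~ edge_ok N A) + (d%:R + d%:R ^+ 2) * (M * (2 * N)%:R * p ^+ 2)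
    + d%:R * Pr (@wen n) (fun v => ~ nice N v).
Proof.
set sb := M * (2 * N)%:R * p ^+ 2.
have sb0 : 0 <= sb by rewrite !mulr_ge0 ?sqr_ge0.
pose E2 i (v : pat * conf n.+1) := ~ sepd N v.1 (v.2 i).1.
pose E3 (u : 'I_d * 'I_d) (v : pat * conf n.+1) := ~ sepd N (v.2 u.1).1 (v.2 u.2).1.
pose E4 i (v : pat * conf n.+1) := ~ nice N (v.2 i).
apply: le_trans (@Pr_U _ _ _ (@we0 n.+1) _ (fun v => (~ edge_ok N v.1 \/
   exists2 i, predT i & E2 i v) \/ exists2 u, u.1 != u.2 & E3 u v)
   (fun v => exists2 i, predT i & E4 i v) _) _.
  move=> v nv; apply: contrapT => /not_orP[/not_orP[/not_orP[n1 n2] n3] n4].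
  apply: nv; split=> [|i|i j ij|i]; apply: contrapT => H.
  - exact: n1.
  - by apply: n2; exists i.
  - by apply: n3; exists (i, j).
  - by apply: n4; exists i.
apply: lerD; last first.
  apply: le_trans (Pr_bigU (@we0 n.+1) (fun v H => H)) _.
  rewrite (eq_bigr (fun=> Pr (@wen n) (fun v => ~ nice N v))) => [|i _].
    by rewrite sumr_const card_ord mulr_natl.
  rewrite (Pr_we_snd (fun c : conf n.+1 => ~ nice N (c i))).
  exact: (Pr_prod1 (we1' n) i (fun v => ~ nice N v)).
apply: le_trans (Pr_U (@we0 n.+1) (fun v H => H)) _.
rewrite mulrDl addrA; apply: lerD; last first.
  apply: le_trans (Pr_bigU (@we0 n.+1) (fun v H => H)) _.
  apply: le_trans (_ : \sum_(u : 'I_d * 'I_d | u.1 != u.2) sb <= _).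
    apply: ler_sum => -[i j] /= ij.
    apply: le_trans (@Pr_bigU _ _ _ (@we0 n.+1) _ (close N) _
      (fun u v => u.1 \in (v.2 i).1 /\ u.2 \in (v.2 j).1) _) _.
      by move=> v /not_sepd.
    apply: le_trans (close_sum N); apply: ler_sum => u _.
    rewrite (Pr_we_snd (fun c : conf n.+1 => u.1 \in (c i).1 /\ u.2 \in (c j).1)).
    rewrite (Pr_prod2 (we1' n) (fun v : pat * conf n => u.1 \in v.1)
      (fun v : pat * conf n => u.2 \in v.1) ij).
    by rewrite !(Pr_we_fst _ (fun A => _ \in A)) !Pr_mem1 expr2.
  rewrite sumr_const -[X in X <= _]mulr_natl; apply: ler_wpM2r => //.
  by rewrite -natrX ler_nat (leq_trans (max_card _)) // card_prod card_ord mulnn.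
apply: le_trans (Pr_U (@we0 n.+1) (fun v H => H)) _; apply: lerD.
  by rewrite (Pr_we_fst _ (fun A => ~ edge_ok N A)).
apply: le_trans (Pr_bigU (@we0 n.+1) (fun v H => H)) _.
apply: le_trans (_ : \sum_(i < d) sb <= _); last by rewrite sumr_const card_ord mulr_natl.
apply: ler_sum => i _.
apply: le_trans (@Pr_bigU _ _ _ (@we0 n.+1) _ (close N) _
  (fun u v => u.1 \in v.1 /\ u.2 \in (v.2 i).1) _) _.
  by move=> v /not_sepd.
apply: le_trans (close_sum N); apply: ler_sum => u _.
rewrite (Pr_we_and (fun A : pat => u.1 \in A) (fun c : conf n.+1 => u.2 \in (c i).1)).
rewrite (Pr_prod1 (we1' n) i (fun v : pat * conf n => u.2 \in v.1)).
by rewrite (Pr_we_fst _ (fun A => _ \in A)) !Pr_mem1 expr2.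
Qed.

Lemma sum_binomials k n : (\sum_(j < k) 'C(j, n))%N = 'C(k, n.+1).
Proof.
elim: k => [|k IH]; first by rewrite big_ord0.
by rewrite big_ord_recr /= IH binS.
Qed.

(** First moment: [d ^ n] descending paths times the increasing choices of [n] slots from [a] on. *)
Lemma Pr_incr n a :
  Pr (@wcn n) (fun c => incr c a) <= (d%:R * p) ^+ n * 'C(L.+1 - a, n)%:R.
Proof.
elim: n a => [|n IH] a.
  by rewrite expr0 mul1r bin0; apply: Pr_le1; [exact: wc_ge0|exact: wc1].
apply: le_trans (@Pr_bigU _ _ _ (wc_ge0 p01 (n := n.+1)) _
  (fun u : 'I_d * slot => a <= u.2)%N _
  (fun u c => u.2 \in (c u.1).1 /\ incr (c u.1).2 u.2.+1) _) _.
  by move=> c [i [m [mi am H]]]; exists (i, m).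
apply: le_trans (_ : \sum_(u : 'I_d * slot | (a <= u.2)%N)
    p * ((d%:R * p) ^+ n * 'C(L.+1 - u.2.+1, n)%:R) <= _).
  apply: ler_sum => -[i m] /= am.
  rewrite (Pr_prod1 (we1' n) i (fun v => m \in v.1 /\ incr v.2 m.+1)).
  rewrite (Pr_we_and (fun A : pat => m \in A) (fun c : conf n => incr c m.+1)) Pr_mem1.
  by apply: ler_wpM2l => //; apply: IH.
rewrite -(pair_big predT (fun m : slot => (a <= m)%N)
  (fun (i : 'I_d) (m : slot) => p * ((d%:R * p) ^+ n * 'C(L.+1 - m.+1, n)%:R))) /=.
rewrite sumr_const card_ord -mulr_sumr -mulr_sumr -natr_sum.
have -> : (\sum_(m < L.+1 | a <= m) 'C(L.+1 - m.+1, n))%N = 'C(L.+1 - a, n.+1).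
  rewrite -sum_binomials (reindex_inj rev_ord_inj) /=.
  rewrite (big_ord_widen L.+1 (fun j => 'C(j, n))); last by lia.
  apply: eq_big => [m|m _]; first by have := ltn_ord m; lia.
  by congr 'C(_, _); have := ltn_ord m; lia.
by rewrite -[X in X <= _]mulr_natl exprS !mulrA lexx.
Qed.

Lemma Pr_incr0 n :
  Pr (@wcn n) (fun c => incr c 0) <= (d%:R * p * M) ^+ n / n`!%:R.
Proof.
apply: le_trans (Pr_incr n 0) _; rewrite subn0 [(_ * M) ^+ n]exprMn -[X in _ <= X]mulrA.
apply: ler_wpM2l.
  by apply: exprn_ge0; apply: mulr_ge0.
rewrite ler_pdivlMr ?ltr0n ?fact_gt0 // -natrM bin_ffact /M -natrX ler_nat.
elim: n L.+1 => [|n IH] k; first by rewrite ffactn0.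
case: k => [|k]; first by rewrite ffact0n.
rewrite ffactSS expnS leq_mul2l (leq_trans (IH k)) ?orbT //.
by case: n {IH} => // n; rewrite leq_exp2r.
Qed.

(** The subtrees at depth [l] are independent. A trial succeeds if the edge above is empty, of
    probability [(1 - p) ^ L.+1], and the walk entering by the fictitious bar at [ord_max] does not
    come back to it. *)
Lemma Pr_succeeds (c0 : R) l n : 0 <= c0 ->
  Pr (@wcn n) (fun c => exits c [set ord_max]%SET (nx ord_max) ord_max) <= 1 - c0 ->
  Pr (@wen (l + n)) (fun v => ~ succeeds v) <= (1 - (1 - p) ^+ L.+1 * c0) ^+ (d ^ l).
Proof.
move=> c00 H; elim: l => [|l IH].
  rewrite expn0 expr1.
  rewrite (PrC (@we1' n) (fun v => @succeeds d L 0 n v)) lerD2l lerN2.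
  rewrite (Pr_we_and (fun A : pat => A = finset.set0)
    (fun c : conf n => ~ exits c [set ord_max]%SET (nx ord_max) ord_max)).
  rewrite (PrC (@wc1 R p d L n)).
  have -> : (1 - p) ^+ L.+1 = wp p (finset.set0 : pat) by rewrite wp_set0 card_ord.
  apply: ler_pM => //.
    by rewrite /Pr (big_pred1 finset.set0) => [|A]; last by apply/asboolP/eqP.
  by move: H; set q := Pr _ _; lra.
rewrite (Pr_we_snd (fun c : conf (l + n).+1 => ~ exists i, succeeds
    ((c : {ffun 'I_d -> pat * conf (l + n)}) i))).
rewrite (@eq_Pr _ _ _ _ (fun c : {ffun 'I_d -> pat * conf (l + n)} =>
    forall i, (fun (_ : 'I_d) v => ~ succeeds v) i (c i))); last first.
  move=> c; split=> [nH i Hi|nH [i Hi]]; first by apply: nH; exists i.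
  exact: nH Hi.
rewrite (Pr_prod (@wen (l + n)) (fun (_ : 'I_d) v => ~ succeeds v)) prodr_const card_ord.
rewrite expnSr exprM; apply: lerXn2r => //; rewrite nnegrE; first exact: Pr_ge0.
by apply: le_trans IH; apply: Pr_ge0.
Qed.

End probabilities.

(** * Limits for fine meshes *)

Section limits.
Variables (R : realType) (d : nat) (T : R).
Hypothesis T0 : 0 < T.
Local Notation pN N := (prob T N).
Local Notation weN N n := (@we R (prob T N) d (slots N) n).

Lemma mesh_gt0 N : (0 < N)%N -> 0 < mesh T N.
Proof. by move=> N0; rewrite divr_gt0 // exprn_gt0 // ltr0n. Qed.

Lemma prob01 N : (0 < N)%N -> 0 < pN N < 1.
Proof. by move=> /mesh_gt0/expRN_bounds. Qed.

Lemma prob_le N : pN N <= mesh T N.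
Proof. exact: one_minus_expR_le. Qed.

Lemma slots_mesh_le N : (0 < N)%N -> (slots N).+1%:R * mesh T N <= 3 * T.
Proof.
move=> N0; rewrite /mesh mulrA ler_pdivrMr ?exprn_gt0 ?ltr0n // mulrAC.
apply: ler_wpM2r; first exact: ltW.
by rewrite -natrX -natrM ler_nat /slots; nia.
Qed.

Lemma slots_prob_le N : (0 < N)%N -> (slots N).+1%:R * pN N <= 3 * T.
Proof.
move=> N0; apply: le_trans (slots_mesh_le N0); apply: ler_wpM2l => //; exact: prob_le.
Qed.

Lemma Pr_not_nice n : exists c, 0 <= c /\ forall N, (0 < N)%N ->
  Pr (weN N n) (fun v => ~ nice N v) <= c / N%:R.
Proof.
have He N : (0 < N)%N -> Pr (@wp R (pN N) 'I_(slots N).+1) (fun A => ~ edge_ok N A) <= 5 * T / N%:R.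
  move=> N0; apply: le_trans (Pr_edge_ok (slots N) (prob01 N0) N0) _.
  have NR : 0 < N%:R :> R by rewrite ltr0n.
  have h1 : (slots N).+1%:R * pN N / N%:R <= 3 * T / N%:R.
    by apply: ler_wpM2r; [rewrite invr_ge0|exact: slots_prob_le].
  have h2 : ((slots N).+1 - N ^ 2)%:R * pN N <= 2 * T / N%:R.
    apply: le_trans (ler_wpM2l (ler0n _ _) (prob_le N)) _.
    apply: le_trans (_ : (2 * N)%:R * mesh T N <= _).
      by apply: ler_wpM2r; [apply: ltW; exact: mesh_gt0|rewrite ler_nat /slots; lia].
    rewrite natrM /mesh; suff -> : 2 * N%:R * (T / N%:R ^+ 2) = 2 * T / N%:R by [].
    by field; rewrite gt_eqF.
  by move: h1 h2; rewrite -!mulrA; clear; lra.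
elim: n => [|n [c [c0 IH]]].
  exists (5 * T); split=> [|N N0]; first by apply: mulr_ge0 => //; exact: ltW.
  apply: le_trans (He N N0).
  by rewrite (@Pr_we_fst _ _ _ _ 0 (fun A => ~ edge_ok N A)).
exists (5 * T + (d%:R + d%:R ^+ 2) * (6 * T ^+ 2) + d%:R * c); split=> [|N N0].
  by rewrite !addr_ge0 ?mulr_ge0 ?exprn_ge0 ?addr_ge0 ?exprn_ge0 // ltW.
have NR : 0 < N%:R :> R by rewrite ltr0n.
apply: le_trans (nice_step d (slots N) (prob01 N0) N n) _.
rewrite [X in _ <= X]mulrDl [X in _ <= X + _]mulrDl; apply: lerD; last by rewrite -mulrA; apply: ler_wpM2l => //; apply: IH.
apply: lerD; first exact: He.
rewrite -[X in _ <= X]mulrA; apply: ler_wpM2l; first by rewrite addr_ge0.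
have p0 : 0 <= pN N by case/andP: (prob01 N0) => /ltW.
have -> : 6 * T ^+ 2 / N%:R = 3 * T * (2 * N%:R * (T / N%:R ^+ 2)).
  by field; rewrite gt_eqF.
have -> : (slots N).+1%:R * (2 * N)%:R * pN N ^+ 2 =
    ((slots N).+1%:R * pN N) * (2 * N%:R * pN N) by rewrite natrM; ring.
apply: ler_pM; [exact: mulr_ge0|by rewrite !mulr_ge0|exact: slots_prob_le|].
by apply: ler_wpM2l; [exact: mulr_ge0|exact: prob_le].
Qed.

Lemma nice_likely n (delta : R) : 0 < delta ->
  exists N0, forall N, (N0 <= N)%N -> (0 < N)%N ->
    Pr (weN N n) (fun v => ~ nice N v) <= delta.
Proof.
move=> d0; have [c [c0 H]] := Pr_not_nice n.
exists (Num.truncn (c / delta)).+1 => N hN N0; apply: le_trans (H N N0) _.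
rewrite ler_pdivrMr ?ltr0n // mulrC -ler_pdivrMr //; apply: ltW.
by apply: lt_le_trans (truncnS_gt _) _; rewrite ler_nat.
Qed.

Lemma power_small (a delta : R) : 0 <= a -> a < 1 -> 0 < delta ->
  exists k0, forall k, (k0 <= k)%N -> a ^+ k <= delta.
Proof.
move=> a0 a1 d0; pose b := 1 - a; have b0 : 0 < b by rewrite subr_gt0.
exists (Num.truncn (1 / (b * delta))).+1 => k hk.
have bd : 0 < b * delta by apply: mulr_gt0.
have : 1 / (b * delta) < k%:R.
  by apply: lt_le_trans (truncnS_gt _) _; rewrite ler_nat.
rewrite ltr_pdivrMr // => kbd.
have kb : 0 <= k%:R * b by apply: mulr_ge0 => //; exact: ltW.
apply: le_trans (_ : expR (- (k%:R * b)) <= _).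
  rewrite -mulrN expRM_natl; apply: lerXn2r; rewrite ?nnegrE ?expR_ge0 //.
  by have := expR_ge1Dx (- b); rewrite /b; lra.
rewrite expRN; apply: le_trans (_ : (1 + k%:R * b)^-1 <= _).
  rewrite lef_pV2 ?posrE ?expR_gt0 ?expR_ge1Dx //; lra.
rewrite -div1r ler_pdivrMr; last by lra.
by move: kbd; rewrite mulrA => kbd; nra.
Qed.

(** The order of choices matters: one trial succeeds with probability at least [exp (- 3 T) * c0]
    for every mesh, so [l] is fixed before [n], and only [N] depends on [n]. The finitely many
    vertices at depth [l] can then serve all [n]. *)
Lemma success_likely (c0 : R) N0 : (2 <= d)%N -> 0 < c0 -> c0 <= 1 ->
  (forall N, (N0 <= N)%N -> forall n t,
      Pr (@wc R (pN N) d (slots N) n) (fun c => exits c [set t]%SET (nx t) t) <= 1 - c0) ->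
  forall delta : R, 0 < delta -> exists l, forall n, exists2 N, (0 < N)%N &
    Pr (weN N (l + n)) (fun v => ~ (succeeds v /\ nice N v)) <= delta.
Proof.
move=> d2 c0_gt0 c0_le1 H delta delta0.
pose a := 1 - expR (- (3 * T)) * c0.
have e0 : 0 < expR (- (3 * T)) * c0 by rewrite mulr_gt0 ?expR_gt0.
have e1 : expR (- (3 * T)) * c0 <= 1.
  rewrite -[1]mulr1; apply: ler_pM; rewrite ?expR_ge0 ?(ltW c0_gt0) //.
  by rewrite expR_le1 oppr_le0 mulr_ge0 // ltW.
have [k0 Hk] := @power_small a (delta / 2) ltac:(rewrite /a; lra) ltac:(rewrite /a; lra) ltac:(lra).
exists k0 => n; have [N1 HN1] := nice_likely (k0 + n) (delta := delta / 2) ltac:(lra).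
pose N := maxn (maxn N0 N1) 1.
have NN0 : (N0 <= N)%N by rewrite /N !leq_max leqnn.
have NN1 : (N1 <= N)%N by rewrite /N !leq_max leqnn orbT.
have Np : (0 < N)%N by rewrite /N leq_max orbT.
exists N => //; have p01 := prob01 Np.
apply: le_trans (@Pr_U _ _ _ (we_ge0 p01 (n := k0 + n)) _ (fun v => ~ succeeds v)
  (fun v => ~ nice N v) _) _.
  by move=> v /not_andP.
rewrite [delta](splitr delta); apply: lerD; last exact: HN1.
apply: le_trans (Pr_succeeds (c0 := c0) p01 k0 (ltW c0_gt0) (H N NN0 n ord_max)) _.
have pw : expR (- (3 * T)) <= (1 - pN N) ^+ (slots N).+1.
  by rewrite probC ler_expR lerN2; apply: slots_mesh_le.
have pw1 : (1 - pN N) ^+ (slots N).+1 <= 1.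
  by apply: exprn_ile1; case/andP: p01 => *; lra.
apply: le_trans (_ : a ^+ (d ^ k0) <= _).
  apply: lerXn2r; rewrite ?nnegrE /a.
  - rewrite subr_ge0 -[X in _ <= X]mulr1; apply: ler_pM; rewrite ?(ltW c0_gt0) //.
    by apply: le_trans (expR_ge0 _) pw.
  - by rewrite subr_ge0.
  - by rewrite lerD2l lerN2; apply: ler_wpM2r => //; exact: ltW.
by apply: Hk; apply: ltnW; apply: ltn_expl.
Qed.

(** The first-moment bound is a term of the exponential series at [3 d T], whatever the mesh; [n] is
    chosen first to make it small, then [N]. *)
Lemma no_incr_likely (delta : R) : 0 < delta -> exists n, exists2 N, (0 < N)%N &
  Pr (weN N n) (fun v => ~ (nice N v /\ ~ incr v.2 0)) <= delta.
Proof.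
move=> delta0.
have := cvg_series_cvg_0 (@is_cvg_series_exp_coeff R (d%:R * (3 * T))).
move/cvgrPdist_lt => /(_ (delta / 2) ltac:(lra))[n _ /(_ n (leqnn n))].
rewrite sub0r normrN /exp_coeff /= => Hn.
have [N1 HN1] := nice_likely n (delta := delta / 2) ltac:(lra).
exists n; exists (maxn N1 1) => [|]; first by rewrite leq_max orbT.
set N := maxn N1 1; have Np : (0 < N)%N by rewrite /N leq_max orbT.
have p01 := prob01 Np; have p0 : 0 <= pN N by case/andP: p01 => /ltW.
apply: le_trans (@Pr_U _ _ _ (we_ge0 p01 (n := n)) _ (fun v => ~ nice N v)
  (fun v => incr v.2 0) _) _.
  by move=> v /not_andP[]; [left|move/contrapT; right].
rewrite [delta](splitr delta); apply: lerD.
  by apply: HN1 => //; rewrite /N leq_max leqnn.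
rewrite (@Pr_we_snd _ _ _ _ n (fun c => incr c 0)).
apply: le_trans (Pr_incr0 d (slots N) p01 n) _.
apply: le_trans (ltW Hn); apply: le_trans (ler_norm _).
apply: ler_wpM2r; first by rewrite invr_ge0.
have TT : 0 <= 3 * T by apply: mulr_ge0 => //; exact: ltW.
apply: lerXn2r; [by rewrite nnegrE !mulr_ge0|by rewrite nnegrE mulr_ge0|].
by rewrite -mulrA; apply: ler_wpM2l => //; rewrite mulrC; apply: slots_prob_le.
Qed.

End limits.

(** * Recording exponential clocks as Bernoulli slots *)

Section patterns.
Variables (R : realType) (eta : R).

(* The clock [x k, x k.+1, ...] realises the slots [b], given that [g] empty slots
   precede them. *)
Fixpoint follows (x : nat -> R) (k g : nat) (b : bitseq) : Prop :=
  match b with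
  | [::] => g%:R * eta < x k
  | false :: b' => follows x k g.+1 b'
  | true :: b' => g%:R * eta < x k <= g.+1%:R * eta /\ follows x k.+1 0 b'
  end.

Lemma follows_ex (x : nat -> R) M k g : (forall k, 0 < x k) -> g%:R * eta < x k ->
  exists2 b, size b = M & follows x k g b.
Proof.
move=> x0; elim: M k g => [|M IH] k g Hg; first by exists [::].
have [lt|le] := ltP (g.+1%:R * eta) (x k).
  by have [b bM Hb] := IH k g.+1 lt; exists (false :: b); rewrite /= ?bM.
have [|b bM Hb] := IH k.+1 0%N; first by rewrite mul0r.
by exists (true :: b); rewrite /= ?bM // Hg.
Qed.

End patterns.

Definition bits L (A : {set 'I_L.+1}) : bitseq := [seq m \in A | m <- enum 'I_L.+1].

Lemma size_bits L (A : {set 'I_L.+1}) : size (bits A) = L.+1.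
Proof. by rewrite size_map size_enum_ord. Qed.

Lemma nth_bits L (A : {set 'I_L.+1}) (m : 'I_L.+1) : nth false (bits A) m = (m \in A).
Proof. by rewrite (nth_map ord0) ?size_enum_ord // nth_ord_enum. Qed.

Lemma bits_ex L (b : bitseq) : size b = L.+1 -> exists A : {set 'I_L.+1}, bits A = b.
Proof.
move=> sb; exists [set m : 'I_L.+1 | nth false b m]%SET.
apply: (@eq_from_nth _ false); first by rewrite size_bits.
move=> i; rewrite size_bits => iL; rewrite (nth_bits _ (Ordinal iL)).
by rewrite finset.in_set.
Qed.

Lemma mem_In (S : eqType) (x : S) s : x \in s -> List.In x s.
Proof.
by elim: s => //= y s IH; rewrite inE => /orP[/eqP->|/IH]; [left|right].
Qed.

Section matching.
Variables (R : realType) (Omega : Type) (d : nat) (tau : tvertex d * nat -> Omega -> R).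
Variables (T : R) (N : nat).
Local Notation L := (slots N).
Local Notation slot := 'I_L.+1.
Local Notation pat := {set slot}.
Local Notation conf := (conf d L).
Local Notation eta := (mesh T N).

Fixpoint matches n : tvertex d -> pat * conf n -> Omega -> Prop :=
  match n return tvertex d -> pat * conf n -> Omega -> Prop with
  | 0 => fun v ec w => follows eta (fun k => tau (v, k) w) 0 0 (bits ec.1)
  | n'.+1 => fun v ec w => follows eta (fun k => tau (v, k) w) 0 0 (bits ec.1) /\
      forall i, matches (i :: v) (ec.2 i) w
  end.

Lemma matches_root n v (ec : pat * conf n) w :
  matches v ec w -> follows eta (fun k => tau (v, k) w) 0 0 (bits ec.1).
Proof. by case: n ec => [|n] ec // []. Qed.

Lemma matches_ex n v w : (forall i, 0 < tau i w) ->
  exists ec : pat * conf n, matches v ec w.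
Proof.
move=> pos; elim: n v => [|n IH] v.
  have [|b bM Hb] := @follows_ex R eta (fun k => tau (v, k) w) L.+1 0 0 (fun k => pos _).
    by rewrite mul0r.
  by have [S Sb] := bits_ex bM; exists (S, tt); rewrite /= Sb.
have [|b bM Hb] := @follows_ex R eta (fun k => tau (v, k) w) L.+1 0 0 (fun k => pos _).
  by rewrite mul0r.
have [S Sb] := bits_ex bM.
have [f fP] := choice (fun i : 'I_d => IH (i :: v)).
by exists (S, [ffun i => f i] : conf n.+1); rewrite /= Sb; split=> // i; rewrite ffunE.
Qed.

End matching.

Section clock_measure.
Local Open Scope classical_set_scope.
Local Open Scope ring_scope.
Context {R : realType} {dO : measure_display} {Omega : measurableType dO}.
Variables (P : probability Omega R) (d : nat) (tau : tvertex d * nat -> Omega -> R).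
Hypothesis clocks : poisson_clocks P tau.
Variables (T : R) (N : nat).
Hypotheses (T0 : 0 < T) (N0 : (0 < N)%N).
Local Notation L := (slots N).
Local Notation slot := 'I_L.+1.
Local Notation pat := {set slot}.
Local Notation conf := (conf d L).
Local Notation eta := (mesh T N).
Local Notation p := (prob T N).
Local Notation index := (tvertex d * nat)%type.

Local Notation matches := (@matches R Omega d tau T N _).

Fixpoint edge_events (e : tvertex d) (k g : nat) (b : bitseq) : seq (index * set R) :=
  match b with
  | [::] => [:: ((e, k), `]g%:R * eta, +oo[%classic)]
  | false :: b' => edge_events e k g.+1 b'
  | true :: b' => ((e, k), `]g%:R * eta, g.+1%:R * eta]%classic) :: edge_events e k.+1 0 b'
  end.

Fixpoint all_events n : tvertex d -> pat * conf n -> seq (index * set R) :=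
  match n return tvertex d -> pat * conf n -> seq (index * set R) with
  | 0 => fun v ec => edge_events v 0 0 (bits ec.1)
  | n'.+1 => fun v ec => edge_events v 0 0 (bits ec.1) ++
      flatten [seq all_events (i :: v) (ec.2 i) | i <- enum 'I_d]
  end.

Definition event_set (s : seq (index * set R)) : set Omega :=
  \big[setI/setT]_(u <- s) (tau u.1 @^-1` u.2).

Definition all_in (s : seq (index * set R)) (w : Omega) : Prop :=
  forall u, List.In u s -> u.2 (tau u.1 w).

Lemma event_setP s w : event_set s w <-> all_in s w.
Proof.
rewrite /event_set; elim: s => [|u s IH]; first by rewrite big_nil; split=> // _ v [].
rewrite big_cons; split=> [[uw /IH sw] v [<-//|/sw]//|H].
split; first by apply: H; left.
by apply/IH => v vs; apply: H; right.
Qed.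

Lemma all_in_cat s s' w : all_in (s ++ s') w <-> all_in s w /\ all_in s' w.
Proof.
split=> [H|[H H'] u us]; last by case: (List.in_app_or _ _ _ us) => [/H|/H'].
by split=> u us; apply: H; apply/List.in_or_app; [left|right].
Qed.

Lemma edge_eventsP e k g b w :
  all_in (edge_events e k g b) w <-> follows eta (fun k => tau (e, k) w) k g b.
Proof.
elim: b k g => [|[] b IH] k g /=.
- split=> [H|H u]; first by have /= := H _ (or_introl erefl); rewrite in_itv /= andbT.
  by case=> // <- /=; rewrite in_itv /= andbT.
- split=> [H|[H /IH H'] u]; last by case=> [<- /=|/H' //]; rewrite in_itv.
  split; last by apply/IH => u us; apply: H; right.
  by have /= := H _ (or_introl erefl); rewrite in_itv.
- exact: IH.
Qed.

Lemma all_eventsP n v (ec : pat * conf n) w :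
  all_in (all_events v ec) w <-> matches v ec w.
Proof.
elim: n v ec => [|n IH] v ec /=; first exact: edge_eventsP.
rewrite all_in_cat edge_eventsP; split=> -[H1 H2]; split=> //.
  move=> i; apply/IH => u ui; apply: H2; apply/List.in_concat.
  exists (all_events (i :: v) (ec.2 i)); split=> //.
  by apply/List.in_map_iff; exists i; split=> //; apply: mem_In; rewrite mem_enum.
move=> u /List.in_concat[s [/List.in_map_iff[i [<- _]] us]].
by have /IH := H2 i; apply.
Qed.

Lemma measurable_tau i (B : set R) : measurable B -> measurable (tau i @^-1` B).
Proof.
move=> mB; have [/(_ i)[mt _] _] := clocks.
by have := mt measurableT _ mB; rewrite setTI.
Qed.

Lemma edge_events_meas e k g b u : List.In u (edge_events e k g b) -> measurable u.2.
Proof.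
elim: b k g => [|[] b IH] k g /=.
- by case=> // <-; exact: measurable_itv.
- by case=> [<-|/IH //]; exact: measurable_itv.
- exact: IH.
Qed.

Lemma all_events_meas n v (ec : pat * conf n) u : List.In u (all_events v ec) -> measurable u.2.
Proof.
elim: n v ec => [|n IH] v ec /=; first exact: edge_events_meas.
move=> H; case: (List.in_app_or _ _ _ H); first exact: edge_events_meas.
by move=> /List.in_concat[s [/List.in_map_iff[i [<- _]] us]]; apply: IH us.
Qed.

Lemma measurable_event_set s : (forall u, List.In u s -> measurable u.2) ->
  measurable (event_set s).
Proof.
rewrite /event_set; elim: s => [|u s IH] Hs; first by rewrite big_nil.
rewrite big_cons; apply: measurableI; first by apply: measurable_tau; apply: Hs; left.
by apply: IH => v vs; apply: Hs; right.
Qed.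

(** Turns a list of events into a family indexed by all clocks, as the independence hypothesis
    requires, with the trivial event elsewhere. *)
Fixpoint lookup (s : seq (index * set R)) (i : index) : set R :=
  if s is u :: s' then if u.1 == i then u.2 else lookup s' i else setT.

Lemma measurable_lookup s i : (forall u, List.In u s -> measurable u.2) ->
  measurable (lookup s i).
Proof.
elim: s => [|u s IH] Hs //=; case: eqP => _; first by apply: Hs; left.
by apply: IH => v vs; apply: Hs; right.
Qed.

Lemma big_lookup (U : Type) (idx : U) (op : U -> U -> U) (F : index -> set R -> U) s :
  uniq (unzip1 s) ->
  \big[op/idx]_(i <- unzip1 s) F i (lookup s i) = \big[op/idx]_(u <- s) F u.1 u.2.
Proof.
elim: s => [|u s IH] /=; first by rewrite !big_nil.
case/andP=> us /IH H; rewrite !big_cons eqxx -H; congr (op _ _).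
apply: eq_big_seq => i si; case: eqP => // E.
by rewrite E si in us.
Qed.

Lemma P_event_set s : uniq (unzip1 s) -> (forall u, List.In u s -> measurable u.2) ->
  P (event_set s) = (\prod_(u <- s) P (tau u.1 @^-1` u.2))%E.
Proof.
move=> us ms; have [_ indep] := clocks.
have := indep (unzip1 s) (lookup s) us (fun i => measurable_lookup i ms).
rewrite (big_lookup _ _ (fun i B => tau i @^-1` B) us) => ->.
by rewrite (big_lookup _ _ (fun i B => P (tau i @^-1` B)) us).
Qed.

Lemma edge_events_index e k g b i : i \in unzip1 (edge_events e k g b) ->
  i.1 = e /\ (k <= i.2)%N.
Proof.
elim: b k g => [|[] b IH] k g /=.
- by rewrite inE => /eqP ->.
- by rewrite inE => /orP[/eqP -> //|/IH[-> /ltnW]].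
- exact: IH.
Qed.

Lemma uniq_edge_events e k g b : uniq (unzip1 (edge_events e k g b)).
Proof.
elim: b k g => [|[] b IH] k g //=; rewrite IH andbT.
by apply/negP => /edge_events_index[_] /=; rewrite ltnn.
Qed.

(** Words grow at the head, so descendants of [v] are the words with suffix [v]; this separates the
    clocks of different subtrees. *)
Lemma all_events_index n v (ec : pat * conf n) i : i \in unzip1 (all_events v ec) ->
  (size v <= size i.1)%N /\ drop (size i.1 - size v) i.1 = v.
Proof.
elim: n v ec => [|n IH] v ec /=.
  by move=> /edge_events_index[-> _]; rewrite subnn drop0.
rewrite /unzip1 map_cat mem_cat => /orP[/edge_events_index[-> _]|].
  by rewrite subnn drop0.
rewrite map_flatten => /flatten_mapP[s /mapP[j _ ->]] /IH /= [jv dv]; split; first exact: ltnW.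
by rewrite -(subnSK jv) -add1n -drop_drop dv /= drop0.
Qed.

Lemma uniq_all_events n v (ec : pat * conf n) : uniq (unzip1 (all_events v ec)).
Proof.
elim: n v ec => [|n IH] v ec /=; first exact: uniq_edge_events.
rewrite /unzip1 map_cat cat_uniq -!/unzip1 uniq_edge_events /=; apply/andP; split.
  apply/hasPn => i; rewrite /unzip1 map_flatten => /flatten_mapP[s /mapP[j _ ->]] /all_events_index /= [jv _].
  by apply/negP => /edge_events_index[ie _]; move: jv; rewrite ie ltnn.
rewrite /unzip1 map_flatten -map_comp.
have := enum_uniq 'I_d; elim: (enum 'I_d) => //= j s IHs /andP[js us].
rewrite cat_uniq IH IHs // andbT /=; apply/hasPn => i /flatten_mapP[k ks /=].
move=> /all_events_index[_ ik]; apply/negP => /all_events_index[_ ij].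
by move: js; rewrite ij in ik; case: ik => ->; rewrite ks.
Qed.

Lemma P_tail i a : 0 <= a -> P (tau i @^-1` `]a, +oo[) = (expR (- a))%:E.
Proof. by move=> a0; have [/(_ i)[_ H] _] := clocks; exact: H. Qed.

Lemma P_itv i a b : 0 <= a -> a <= b ->
  P (tau i @^-1` `]a, b]) = (expR (- a) - expR (- b))%:E.
Proof.
move=> a0 ab; have b0 := le_trans a0 ab.
have -> : tau i @^-1` `]a, b] = tau i @^-1` `]a, +oo[ `\` tau i @^-1` `]b, +oo[.
  apply/seteqP; split=> w /=; rewrite !in_itv /= !andbT.
    by move=> /andP[-> h]; split=> //; apply/negP; rewrite -leNgt.
  by move=> [-> /negP]; rewrite -leNgt.
have mA := measurable_tau i (measurable_itv `]a, +oo[).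
have mB := measurable_tau i (measurable_itv `]b, +oo[).
have fA : (P (tau i @^-1` `]a, +oo[) < +oo)%E by rewrite P_tail // ltry.
apply: etrans (measureD mA mB fA) _.
rewrite (_ : _ `&` _ = tau i @^-1` `]b, +oo[).
  by apply: etrans (congr2 (fun x y => (x - y)%E) (P_tail i a0) (P_tail i b0)) _.
apply/seteqP; split=> w /=; rewrite !in_itv /= !andbT; first by case.
by move=> h; split=> //; apply: le_lt_trans h.
Qed.

(** Memorylessness: after [g] empty slots the next slot again carries a ring with probability [p],
    so the recorded slots are exactly Bernoulli. *)
Lemma P_edge_events e k g b :
  (\prod_(u <- edge_events e k g b) P (tau u.1 @^-1` u.2))%E =
  (expR (- (g%:R * eta)) * \prod_(x <- b) (if x then p else 1 - p))%:E.
Proof.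
have eta0 : 0 <= eta by apply: ltW; exact: mesh_gt0.
have ge0 j : 0 <= j%:R * eta by exact: mulr_ge0.
elim: b k g => [|[] b IH] k g /=.
- by rewrite big_nil big_seq1 mulr1; apply: P_tail.
- rewrite big_cons IH big_cons P_itv //; last by apply: ler_wpM2r => //; rewrite ler_nat.
  rewrite -EFinM; congr EFin; rewrite mul0r oppr0 expR0 mul1r mulrA; congr (_ * _).
  rewrite -(natr1 g) mulrDl mul1r opprD expRD /prob; ring.
rewrite IH big_cons; congr EFin; rewrite mulrA; congr (_ * _).
by rewrite -(natr1 g) mulrDl mul1r opprD expRD /prob; ring.
Qed.

Lemma P_matches n v (ec : pat * conf n) :
  P (event_set (all_events v ec)) = (we p ec)%:E.
Proof.
rewrite P_event_set; [|exact: uniq_all_events|exact: all_events_meas].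
have bitsE (A : pat) : \prod_(x <- bits A) (if x then p else 1 - p) = wp p A.
  by rewrite big_map big_enum.
elim: n v ec => [|n IH] v ec /=.
  by rewrite P_edge_events mul0r oppr0 expR0 mul1r bitsE /we mulr1.
rewrite big_cat P_edge_events mul0r oppr0 expR0 mul1r bitsE big_flatten big_map /=.
under eq_bigr do rewrite IH.
by rewrite big_enum prodEFin -EFinM.
Qed.

(** [V] is the finite union of the cylinder events of the configurations violating [Q]. Finite
    estimates thus pass to the clocks without any measurability of events about trajectories. *)
Lemma approximation n v (Q : pat * conf n -> Prop) :
  exists V : set Omega, [/\ measurable V,
    (P V <= (Pr (@we R p d L n) (fun ec => ~ Q ec))%:E)%E &
    forall w, (forall i, 0 < tau i w) -> ~ V w -> exists2 ec, Q ec & matches v ec w].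
Proof.
have mE ec : measurable (event_set (all_events v ec)).
  by apply: measurable_event_set; exact: all_events_meas.
exists (\big[setU/set0]_(ec : pat * conf n | `[< ~ Q ec >]) event_set (all_events v ec)); split.
- by apply: bigsetU_measurable => ec _; exact: mE.
- rewrite /Pr -sumEFin.
  apply: (@proj2 (measurable (\big[setU/set0]_(ec : pat * conf n | `[< ~ Q ec >])
    event_set (all_events v ec)))).
  elim/big_rec2: _ => [|ec s A _ [mA PA]]; first by rewrite measure0.
  split; first by apply: measurableU.
  apply: le_trans (measureU2 _ _ _) _ => //.
  by apply: leeD PA; rewrite -(P_matches v ec); exact: lexx.
- move=> w pos nV; have [ec Hec] := @matches_ex _ _ _ tau T N n v w pos.
  exists ec => //; apply: contrapT => nQ; apply: nV.
  rewrite (bigD1 ec) /=; last exact/asboolP.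
  by left; apply/event_setP/all_eventsP.
Qed.

End clock_measure.

(** * The stirring trajectory follows the walk *)

Section partial_sums.
Variables (R : realType) (eta : R) (x : nat -> R).
Hypothesis x0 : forall k, 0 < x k.

Definition psum k c : R := \sum_(i < c.+1) x (k + i).

Lemma psum0 k : psum k 0 = x k.
Proof. by rewrite /psum big_ord1 addn0. Qed.

Lemma psumS k c : psum k c.+1 = x k + psum k.+1 c.
Proof.
rewrite /psum big_ord_recl addn0; congr (_ + _).
by apply: eq_bigr => i _; rewrite /= /bump /= addnA addn1.
Qed.

Lemma psum_lt k c c' : (c < c')%N -> psum k c < psum k c'.
Proof.
elim: c' => // c' IH; rewrite ltnS leq_eqVlt => /orP[/eqP->|/IH H].
  by rewrite /psum [X in _ < X]big_ord_recr /= ltrDl.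
by apply: lt_trans H _; rewrite /psum [X in _ < X]big_ord_recr /= ltrDl.
Qed.

Lemma psum_ge k c c' : (c <= c')%N -> psum k c <= psum k c'.
Proof. by rewrite leq_eqVlt => /orP[/eqP->//|/(psum_lt k)/ltW]. Qed.

(** Each ring is postponed to the end of its slot before the next gap is measured, so every ring
    adds less than one slot to the delay. *)
Lemma follows_psum k g b j : follows eta x k g b -> (j < size b)%N -> nth false b j ->
  let c := count id (take j b) in
  ((j.+1 + g)%:R - c.+1%:R) * eta < psum k c <= (j.+1 + g)%:R * eta.
Proof.
elim: b k g j => [//|[] b IH] k g j /=; last first.
  case: j => // j /= /IH H jb nj; have /= := H j jb nj.
  by rewrite add0n addnS -addSn.
case=> /andP[h1 h2] Hb; case: j => [_ _|j jb nj] /=.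
  by rewrite psum0; move: h1 h2; rewrite -(natr1 g) => h1 h2; apply/andP; split; lra.
have /= /andP[h3 h4] := IH _ _ j Hb jb nj.
move: h1 h2 h3 h4; rewrite add1n psumS addn0 natrD -(natr1 g) -(natr1 j.+1).
set c := count id _; rewrite -(natr1 c.+1).
by move=> h1 h2 h3 h4; apply/andP; split; lra.
Qed.

Lemma follows_last k g b : follows eta x k g b ->
  ((size b + g)%:R - (count id b)%:R) * eta < psum k (count id b).
Proof.
elim: b k g => [|[] b IH] k g /=.
- by rewrite psum0 subr0 add0n.
- case=> /andP[h1 h2] /IH; rewrite addn0 add1n psumS => h3.
  move: h1 h3; rewrite natrD -(natr1 (size b)) -(natr1 (count id b)).
  by set z := psum _ _; lra.
- by move=> /IH; rewrite add0n addnS -addSn.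
Qed.

Lemma count_take_lt b j j' : (j < j')%N -> (j < size b)%N -> nth false b j ->
  (count id (take j b) < count id (take j' b))%N.
Proof.
elim: b j j' => // a b IH [|j] [|j'] //=; first by move=> _ _ ->.
by rewrite !ltnS ltn_add2l => jj' jb nj; apply: IH.
Qed.

Lemma count_take_ex b n : (n < count id b)%N ->
  exists j, [/\ (j < size b)%N, nth false b j & count id (take j b) = n].
Proof.
elim: b n => // -[] b IH n /=.
  case: n => [|n]; first by exists 0%N.
  by rewrite add1n ltnS => /IH[j [jb nj <-]]; exists j.+1; rewrite /= add1n.
by rewrite add0n => /IH[j [jb nj <-]]; exists j.+1.
Qed.

End partial_sums.

Lemma count_bits L (A : {set 'I_L.+1}) : count id (bits A) = #|A|.
Proof.
rewrite /bits count_map cardE -size_filter; congr size.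
by rewrite enumT; apply: eq_filter => m.
Qed.

Section simulation.
Variables (R : realType) (Omega : Type) (d : nat) (tau : tvertex d * nat -> Omega -> R).
Variables (T : R) (w : Omega).
Hypotheses (T0 : 0 < T) (tau0 : forall i, 0 < tau i w).

Local Notation jump := (jump tau w).
Local Notation reach := (reach tau w).
Local Notation rings := (rings tau w).

Lemma jump_det p q q' : jump p q -> jump p q' -> q = q'.
Proof.
case: p q q' => v s [u t] [u' t'] [st [e [ie re -> min un]]] [st' [e' [ie' re' -> min' un']]].
have tt' : t = t'.
  by case: (ltgtP t t') => // lt; [case: (min' e t)|case: (min e' t')].
by subst t'; rewrite (un _ ie' re').
Qed.

Lemma jump_lt p q : jump p q -> p.2 < q.2.
Proof. by case: p q => v s [u t] []. Qed.

Lemma reach_le p q : reach p q -> p.2 <= q.2.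
Proof. by elim=> // a b c /jump_lt ab _; apply: le_trans; apply: ltW. Qed.

Lemma reach_trans p q r : reach p q -> reach q r -> reach p r.
Proof. by elim=> // a b c ab _ IH /IH; apply: reach_step. Qed.

Lemma reach_first p q : reach p q -> p = q \/ exists2 r, jump p r & reach r q.
Proof. by case=> [|a b c ab bc]; [left|right; exists b]. Qed.

Definition final (q : tvertex d * R) := forall u t, jump q (u, t) -> T < t.

Lemma reach_final p q q' : reach p q -> q.2 <= T -> final q ->
  reach p q' -> q'.2 <= T -> final q' -> q = q'.
Proof.
elim=> {p q} [p pT pf|p r q pr rq IH qT qf] pq' q'T q'f.
  case: (reach_first pq') => // -[[u t] /pf Tt] /reach_le /= tq.
  by move: (le_trans tq q'T); rewrite leNgt Tt.
case: (reach_first pq') => [E|[r' pr' r'q]].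
  have := reach_le rq; rewrite E in pr; case: r pr {rq IH} => u t /q'f Tt /= tq.
  by move: (le_trans tq qT); rewrite leNgt Tt.
by apply: IH => //; rewrite (jump_det pr pr').
Qed.

Lemma stir_permE y v s : reach (y, 0) (v, s) -> s <= T -> final (v, s) ->
  stir_perm tau T w y = v.
Proof.
move=> rs sT fs; apply: xget_unique; first by exists s.
by move=> v' [s' [rs' s'T fs']]; have [] := reach_final rs' s'T fs' rs sT fs.
Qed.

(** The walk in true time: the trajectories on [[0, T]] of [x] and its iterates, laid end to end. *)
Definition orb (x : tvertex d) (q : tvertex d * R) : Prop :=
  exists k, reach (iter k (stir_perm tau T w) x, 0) q /\ q.2 <= T.

Lemma orb_jump x p q : orb x p -> jump p q -> q.2 <= T -> orb x q.
Proof.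
move=> [k [rk _]] pq qT; exists k; split=> //; apply: reach_trans rk _.
by apply: reach_step pq _; apply: reach_refl.
Qed.

Lemma orb_wrap x v s : orb x (v, s) -> final (v, s) -> orb x (v, 0).
Proof.
move=> [k [rk sT]] fs; exists k.+1; rewrite iterS (stir_permE rk sT fs); split; last exact: ltW.
exact: reach_refl.
Qed.

Fixpoint real_incr n (v : tvertex d) (r : R) : Prop :=
  if n is n'.+1 then exists i t, [/\ rings (i :: v) t, r < t, t <= T & real_incr n' (i :: v) t]
  else True.

Lemma real_incr_lower n v r r' : r' <= r -> real_incr n v r -> real_incr n v r'.
Proof.
case: n => // n rr' [i [t [it rt tT H]]]; exists i, t; split=> //.
exact: le_lt_trans rt.
Qed.

Lemma real_incr_le n n' v r : (n' <= n)%N -> real_incr n v r -> real_incr n' v r.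
Proof.
elim: n n' v r => [|n IH] [|n'] v r //=; rewrite ltnS => nn' [i [t [it rt tT H]]].
by exists i, t; split=> //; apply: IH H.
Qed.

Section mesh.
Variable N : nat.
Hypothesis N0 : (0 < N)%N.
Local Notation L := (slots N).
Local Notation slot := 'I_L.+1.
Local Notation pat := {set slot}.
Local Notation conf := (conf d L).
Local Notation eta := (mesh T N).
Local Notation matches := (@matches R Omega d tau T N _).
Let eta0 : 0 < eta. Proof. exact: mesh_gt0. Qed.

Lemma mesh_sqr : (N ^ 2)%:R * eta = T.
Proof. by rewrite natrX /mesh mulrC divfK // gt_eqF // exprn_gt0 // ltr0n. Qed.

Definition pos (e : tvertex d) (A : pat) (m : slot) : R :=
  arrival tau e (count id (take m (bits A))) w.

Definition realizes (e : tvertex d) (A : pat) : Prop :=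
  [/\ forall t, t <= T -> rings e t -> exists2 m, m \in A & t = pos e A m,
      forall m, m \in A -> [/\ rings e (pos e A m), 0 < pos e A m <= T &
                 (m.+1%:R - N%:R) * eta < pos e A m <= m.+1%:R * eta],
      forall m m' : slot, m \in A -> (m < m')%N -> pos e A m < pos e A m'
    & forall m, m \in A -> (m < N ^ 2)%N].

Lemma follows_realizes e A : edge_ok N A ->
  follows eta (fun k => tau (e, k) w) 0 0 (bits A) -> realizes e A.
Proof.
move=> [AN AN2] fol; set x := fun k => tau (e, k) w.
have x0 k : 0 < x k by exact: tau0.
have arrE n : arrival tau e n w = psum x 0 n by apply: eq_bigr.
have sz (m : slot) : (m < size (bits A))%N by rewrite size_bits.
have posE m : m \in A ->
    (m.+1%:R - N%:R) * eta < pos e A m <= m.+1%:R * eta.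
  move=> mA; have /= := follows_psum fol (sz m) (etrans (nth_bits A m) mA).
  rewrite addn0 /pos arrE => /andP[h1 h2]; rewrite h2 andbT; apply: le_lt_trans h1.
  apply: ler_wpM2r; first exact: ltW.
  rewrite lerD2l lerN2 ler_nat; apply: leq_trans AN.
  have := count_take_lt (ltn_ord m) (sz m) (etrans (nth_bits A m) mA).
  by rewrite -{2}(size_bits A) take_size count_bits.
split=> [t tT [n]|m mA|m m' mA mm'|//].
- rewrite arrE => nt; have [nA|An] := ltnP n #|A|.
    rewrite -count_bits in nA; have [j [jb nj jn]] := count_take_ex nA.
    rewrite size_bits in jb; exists (Ordinal jb).
      by rewrite -(nth_bits A (Ordinal jb)).
    by rewrite /pos arrE /= jn.
  (* As [A] has at most [N] bars, the first ring after the recorded slots comes later than [N ^ 2]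
     slot lengths, that is [T]: no ring up to [T] is missed. *)
  have := follows_last fol; rewrite addn0 size_bits count_bits => h.
  suff : T < t by rewrite ltNge tT.
  rewrite -nt; apply: lt_le_trans (psum_ge x0 0 An); apply: le_lt_trans h.
  rewrite -[X in X <= _]mesh_sqr; apply: ler_wpM2r; first exact: ltW.
  by rewrite lerBrDr -natrD ler_nat /slots ltnW // ltnS leq_add2l.
- split; [by eexists|apply/andP; split|exact: posE].
    by rewrite /pos arrE; apply: lt_le_trans (psum_ge x0 0 (leq0n _)); rewrite psum0.
  case/andP: (posE m mA) => _ /le_trans; apply; rewrite -[X in _ <= X]mesh_sqr.
  by apply: ler_wpM2r; [exact: ltW|rewrite ler_nat; exact: AN2].
- rewrite /pos !arrE; apply: psum_lt => //.
  by apply: count_take_lt => //; rewrite nth_bits.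
Qed.

(** The guard [v <> [::]] reflects that the root has no edge above it, although the index [[::]] has
    clocks. *)
Definition inc_pat (v : tvertex d) (B : pat) (E : 'I_d -> pat) (e : tvertex d) (A : pat) :=
  (e = v /\ v <> [::] /\ A = B) \/ (exists i, e = i :: v /\ A = E i).

Definition local_good v B E : Prop :=
  (forall e A, inc_pat v B E e A -> realizes e A) /\
  (forall e A e' A' m m', inc_pat v B E e A -> inc_pat v B E e' A' -> m \in A -> m' \in A' ->
     ((m < m')%N -> pos e A m < pos e' A' m') /\ (m = m' -> e = e' /\ A = A')).

(** A ring precedes the end of its slot by less than [N] slot lengths, so slots at distance at least
    [N] are ordered like their rings. *)
Lemma sepd_pos e A e' A' m m' : realizes e A -> realizes e' A' -> sepd N A A' ->
  m \in A -> m' \in A' -> ((m < m')%N -> pos e A m < pos e' A' m') /\ m <> m'.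
Proof.
move=> [_ H _ _] [_ H' _ _] sep mA m'A; split=> [mm'|E]; last first.
  by case: (sep _ _ mA m'A); rewrite E; lia.
have le : (m.+1 + N <= m'.+1)%N by case: (sep _ _ mA m'A); lia.
have [_ _ /andP[_ h]] := H m mA; have [_ _ /andP[h' _]] := H' m' m'A.
apply: le_lt_trans h (le_lt_trans _ h'); apply: ler_wpM2r; first exact: ltW.
by rewrite lerBrDr -natrD ler_nat.
Qed.

Lemma sepdC (A B : pat) : sepd N A B -> sepd N B A.
Proof. by move=> H m m' mB mA; case: (H _ _ mA mB); [right|left]. Qed.

Lemma nice_realizes n v (ec : pat * conf n) : matches v ec w -> nice N ec ->
  realizes v ec.1.
Proof.
move=> ma ni; apply: follows_realizes (matches_root ma).
by case: n ec ni {ma} => [|n] ec // [].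
Qed.

Lemma nice_local_good n v (ec : pat * conf n.+1) : matches v ec w -> nice N ec ->
  local_good v ec.1 (fun i => (ec.2 i).1).
Proof.
move=> ma ni; have rv := nice_realizes ma ni.
case: ma ni => _ ma [_ s1 s2 ni].
have rc i : realizes (i :: v) (ec.2 i).1 by apply: nice_realizes (ma i) (ni i).
split=> [e A [[-> [_ ->]]|[i [-> ->]]] //|e A e' A' m m'].
case=> [[-> [_ ->]]|[i [-> ->]]] [[-> [_ ->]]|[j [-> ->]]] mA m'A.
- by split=> // mm'; case: rv => _ _ H _; apply: H.
- by have [? ?] := sepd_pos rv (rc j) (s1 j) mA m'A.
- by have [? ?] := sepd_pos (rc i) rv (sepdC (s1 i)) mA m'A.
- have [ij|ij] := eqVneq i j; last by have [? ?] := sepd_pos (rc i) (rc j) (s2 i j ij) mA m'A.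
  by subst j; split=> // mm'; case: (rc i) => _ _ H _; apply: H.
Qed.

Variable x : tvertex d.

(** The time [s] is tied to the slot [m] only by separating the same rings, since the recording
    delays differ from edge to edge. *)
Definition sim (v : tvertex d) (B : pat) (E : 'I_d -> pat) (m : slot) : Prop :=
  exists2 s, orb x (v, s) &
    forall e A m', inc_pat v B E e A -> m' \in A -> (pos e A m' <= s) = (m' < m)%N.

Lemma sim_jump v B E m e A : local_good v B E -> sim v B E m -> inc_pat v B E e A ->
  m \in A -> orb x (other_end v e, pos e A m).
Proof.
move=> [re ord] [s os Hs] ieA mA.
have [_ HA _ _] := re _ _ ieA; have [rm /andP[p0 pT] _] := HA m mA.
have sp : s < pos e A m by rewrite ltNge (Hs _ _ _ ieA mA) ltnn.
have inc e' : incident v e' -> exists A', inc_pat v B E e' A'.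
  case=> [[-> vn]|[i ->]]; first by exists B; left.
  by exists (E i); right; exists i.
apply: (orb_jump os) => //=; split=> //; exists e; split=> //.
- by case: ieA => [[-> [vn _]]|[i [-> _]]]; [left|right; exists i].
- move=> e' t' /inc[A' ie'] re' st' t'p.
  have [H' _ _ _] := re _ _ ie'; have [m' m'A t'E] := H' _ (ltW (lt_le_trans t'p pT)) re'.
  subst t'; have : (m' < m)%N = false by rewrite -(Hs _ _ _ ie' m'A) leNgt st'.
  move/negbT; rewrite -leqNgt leq_eqVlt => /orP[/eqP/val_inj mm'|lt].
    subst m'; have [_ /(_ erefl)[E1 E2]] := ord _ _ _ _ _ _ ieA ie' mA m'A.
    by move: t'p; rewrite E1 E2 ltxx.
  have [h _] := ord _ _ _ _ _ _ ieA ie' mA m'A.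
  by have := lt_trans t'p (h lt); rewrite ltxx.
- move=> e' /inc[A' ie'] re'.
  have [H' _ _ _] := re _ _ ie'; have [m' m'A t'E] := H' _ pT re'.
  have [k1 k2] := ord _ _ _ _ _ _ ieA ie' mA m'A.
  have [k3 _] := ord _ _ _ _ _ _ ie' ieA m'A mA.
  case: (ltngtP m m') => [/k1|/k3|/val_inj /k2[] //]; first by rewrite t'E ltxx.
  by rewrite t'E ltxx.
Qed.

Lemma lt_slots (m : slot) : (m < N ^ 2)%N -> nx m = m.+1 :> nat.
Proof. by move=> h; rewrite val_nx; case: eqP => // E; move: h; rewrite E /slots; lia. Qed.

Lemma sim_next v B E m : local_good v B E -> sim v B E m ->
  (v <> [::] -> m \notin B) -> (forall i, m \notin E i) -> sim v B E (nx m).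
Proof.
move=> [re ord] [s os Hs] mB mE.
have mA e A : inc_pat v B E e A -> m \notin A.
  by case=> [[_ [vn ->]]|[i [_ ->]]]; [exact: mB|exact: mE].
have neq e A m' : inc_pat v B E e A -> m' \in A -> m' != m :> nat.
  by move=> ie m'A; apply: contraNneq (mA _ _ ie) => /val_inj <-.
have [mL|mL] := eqVneq (m : nat) L; last first.
  exists s => // e A m' ie m'A; rewrite (Hs _ _ _ ie m'A) val_nx (negPf mL) ltnS [RHS]leq_eqVlt.
  by rewrite (negPf (neq _ _ _ ie m'A)).
(* From the last slot the walk goes to slot 0: no ring is left up to [T], so the trajectory is
   complete and the next iterate starts at time 0. *)
exists 0.
  apply: orb_wrap os _ => u t [st [e [ie rt _ _ _]]]; rewrite ltNge; apply/negP => tT.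
  have [A ieA] : exists A, inc_pat v B E e A.
    case: ie => [[-> vn]|[i ->]]; first by exists B; left.
    by exists (E i); right; exists i.
  have [H _ _ HN] := re _ _ ieA; have [m' m'A tE] := H _ tT rt.
  have := Hs _ _ _ ieA m'A; rewrite -tE leNgt st mL => /esym/negbT.
  by have := HN _ m'A; rewrite /slots; lia.
move=> e A m' ie m'A; have [_ H _ _] := re _ _ ie; have [_ /andP[h _] _] := H _ m'A.
by rewrite val_nx mL eqxx ltn0 leNgt h.
Qed.

(* At depth [0] no edge below the vertex has been discretised, so only the arrival of
   the trajectory is recorded. *)
Definition simn n (v : tvertex d) : pat * conf n -> slot -> Prop :=
  match n return pat * conf n -> slot -> Prop with
  | 0 => fun _ _ => exists s, orb x (v, s)
  | n'.+1 => fun ec m => sim v ec.1 (fun i => (ec.2 i).1) m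
  end.

Lemma pos_le v B E e A m : local_good v B E -> inc_pat v B E e A -> m \in A ->
  forall e' A' m', inc_pat v B E e' A' -> m' \in A' -> (pos e' A' m' <= pos e A m) = (m' < nx m)%N.
Proof.
move=> [re ord] ie mA e' A' m' ie' m'A.
have [_ _ _ HN] := re _ _ ie; rewrite (lt_slots (HN _ mA)) ltnS leNgt leqNgt; congr (~~ _).
have [k1 k2] := ord _ _ _ _ _ _ ie ie' mA m'A.
have [k3 _] := ord _ _ _ _ _ _ ie' ie m'A mA.
case: (ltngtP m m') => [/k1 -> //|/k3 h|/val_inj mm'].
  by apply/negbTE; rewrite -leNgt ltW.
by have [<- <-] := k2 mm'; rewrite mm' ltxx.
Qed.

Lemma sim_enter n v (ec : pat * conf n.+1) m i : matches v ec w -> nice N ec ->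
  sim v ec.1 (fun i => (ec.2 i).1) m -> m \in (ec.2 i).1 -> simn (i :: v) (ec.2 i) (nx m).
Proof.
move=> ma ni si mi; have lg := nice_local_good ma ni.
have ie : inc_pat v ec.1 (fun i => (ec.2 i).1) (i :: v) (ec.2 i).1 by right; exists i.
have := sim_jump lg si ie mi; rewrite /other_end.
have -> : (i :: v == v) = false by apply/eqP => /(congr1 size) /=; lia.
case: ma ni => _ ma [_ _ _ ni].
case: n ec si mi ma ni lg ie => [|n] ec si mi ma ni lg ie o; first by eexists; exact: o.
exists (pos (i :: v) (ec.2 i).1 m) => //.
by apply: pos_le (nice_local_good (ma i) (ni i)) _ mi; left.
Qed.

Lemma sim_leave n u (B : pat) (E : 'I_d -> pat) i (ec : pat * conf n.+1) k :
  local_good u B E -> E i = ec.1 -> matches (i :: u) ec w -> nice N ec ->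
  sim (i :: u) ec.1 (fun j => (ec.2 j).1) k -> k \in ec.1 -> sim u B E (nx k).
Proof.
move=> lg Ei ma ni si kB.
have ie : inc_pat (i :: u) ec.1 (fun j => (ec.2 j).1) (i :: u) ec.1 by left.
have := sim_jump (nice_local_good ma ni) si ie kB; rewrite /other_end eqxx /= => o.
exists (pos (i :: u) ec.1 k) => //.
by apply: pos_le lg _ kB; right; exists i.
Qed.

(** The stopping bars [B'] may exceed the real bars [ec.1], which accommodates the fictitious bar of
    a walk started at time 0. *)
Lemma sim_star n v (ec : pat * conf n.+1) (B' : pat) m m' :
  matches v ec w -> nice N ec -> (v <> [::] -> ec.1 \subset B') ->
  (forall i m k, simn (i :: v) (ec.2 i) m -> exits (ec.2 i).2 (ec.2 i).1 m k ->
     sim v ec.1 (fun i => (ec.2 i).1) (nx k)) ->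
  star (cstep (fun i => (ec.2 i).1) (fun i => exits (ec.2 i).2 (ec.2 i).1) B') m m' ->
  sim v ec.1 (fun i => (ec.2 i).1) m -> sim v ec.1 (fun i => (ec.2 i).1) m'.
Proof.
move=> ma ni BB' IH; elim=> // a b c [aB' st] _ IHs sa; apply: IHs.
case: st => [[aE ->]|[i [k [[ai _] ex ->]]]].
  apply: sim_next sa _ aE; first exact: nice_local_good ma ni.
  by move=> /BB' /fintype.subsetP BB; apply: contra aB'; apply: BB.
by apply: IH ex; apply: sim_enter ma ni sa ai.
Qed.

Lemma sim_exits n i u (ec : pat * conf n) (B : pat) (E : 'I_d -> pat) m k :
  matches (i :: u) ec w -> nice N ec -> local_good u B E -> E i = ec.1 ->
  simn (i :: u) ec m -> exits ec.2 ec.1 m k -> sim u B E (nx k).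
Proof.
elim: n i u ec B E m k => [//|n IH] i u ec B E m k ma ni lg Ei si /= [kB st].
apply: sim_leave (lg) (Ei) (ma) (ni) _ (kB); apply: sim_star (ma) (ni) _ _ st si => // j a b sj ex.
have [_ maj] := ma; have [_ _ _ nij] := ni.
exact: IH (maj j) (nij j) (nice_local_good ma ni) erefl sj ex.
Qed.

Lemma sim_escapes n v (ec : pat * conf n) (B' : pat) m :
  matches v ec w -> nice N ec -> (v <> [::] -> ec.1 \subset B') ->
  simn v ec m -> escapes ec.2 B' m ->
  exists u s, orb x (u, s) /\ (size v + n <= size u)%N.
Proof.
elim: n v ec B' m => [|n IH] v ec B' m ma ni BB' /=.
  by move=> [s os] _; exists v, s; rewrite addn0.
move=> si [m' [i [st m'B [mi _] esc]]].
have [_ maj] := ma; have [_ _ _ nij] := ni.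
have sm' : sim v ec.1 (fun i => (ec.2 i).1) m'.
  apply: sim_star (ma) (ni) BB' _ st si => j a b sj ex.
  exact: sim_exits (maj j) (nij j) (nice_local_good ma ni) erefl sj ex.
have := IH (i :: v) (ec.2 i) (ec.2 i).1 _ (maj i) (nij i) (fun _ => fintype.subxx _)
  (sim_enter ma ni sm' mi) esc.
by rewrite /= addSnnS.
Qed.

Definition after (r : R) (a : nat) n (v : tvertex d) : pat * conf n -> Prop :=
  match n return pat * conf n -> Prop with
  | 0 => fun _ => True
  | n'.+1 => fun ec => forall i m, m \in (ec.2 i).1 -> r < pos (i :: v) (ec.2 i).1 m -> (a <= m)%N
  end.

(** Rings and slots being ordered alike at each vertex, increasing times become increasing slots;
    [after] carries the lower bound from one level to the next. *)
Lemma real_incr_incr n v (ec : pat * conf n) r a : matches v ec w -> nice N ec ->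
  after r a v ec -> real_incr n v r -> incr ec.2 a.
Proof.
elim: n v ec r a => [//|n IH] v ec r a ma ni aft /= [i [t [it rt tT H]]].
have [_ maj] := ma; have [_ _ _ nij] := ni.
have [k1 _ _ _] := nice_realizes (maj i) (nij i).
have [m mi tE] := k1 t tT it; rewrite tE in rt H.
exists i, m; split=> //; first exact: aft mi rt.
apply: (IH (i :: v) (ec.2 i)) (maj i) (nij i) _ H.
case: n ec ma ni aft maj nij {IH k1 rt tE} mi => [//|n] ec ma ni aft maj nij mi j m' m'j lt.
have [_ ord] := nice_local_good (maj i) (nij i).
rewrite ltnNge; apply/negP => m'm.
have ie : inc_pat (i :: v) (ec.2 i).1 (fun j => ((ec.2 i).2 j).1) (i :: v) (ec.2 i).1 by left.
have je : inc_pat (i :: v) (ec.2 i).1 (fun j => ((ec.2 i).2 j).1) (j :: i :: v) ((ec.2 i).2 j).1.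
  by right; exists j.
have [k1 k2] := ord _ _ _ _ _ _ je ie m'j mi.
move: m'm; rewrite leq_eqVlt => /orP[/eqP/val_inj/k2[/(congr1 size) /=]|/k1].
  by clear; lia.
by move/(lt_trans lt); rewrite ltxx.
Qed.

Lemma sepd_disjoint (A B : pat) : sepd N A B -> [disjoint A & B].
Proof.
move=> H; apply/pred0P => m /=; apply/negP => /andP[mA mB].
by case: (H _ _ mA mB); lia.
Qed.

(** The first alternative admits the fictitious bar at [ord_max], which lies among the final slots
    that [edge_ok] keeps empty. *)
Lemma nice_cfree n (ec : pat * conf n) (B : pat) : nice N ec ->
  (forall m, m \in B -> (N ^ 2 <= m)%N \/ m \in ec.1) -> cfree ec.2 B.
Proof.
elim: n ec B => [//|n IH] ec B [_ s1 s2 ni] HB i; split.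
- apply/pred0P => m /=; apply/negP => /andP[/HB[mN|mA] mi].
    have : edge_ok N (ec.2 i).1 by case: (n) (ec.2 i) (ni i) => [|n'] ec' // [].
    by case=> _ /(_ _ mi); rewrite ltnNge mN.
  exact: disjointN (sepd_disjoint (s1 i)) mA mi.
- by move=> j ji; apply: sepd_disjoint; apply: s2.
- by apply: IH (ni i) _ => m mi; right.
Qed.

Lemma success_reaches n (ec : pat * conf n) : matches x ec w -> nice N ec ->
  ec.1 = finset.set0 -> ~ exits ec.2 [set ord_max]%SET (nx ord_max) ord_max ->
  exists u s, orb x (u, s) /\ (size x + n <= size u)%N.
Proof.
move=> ma ni B0 nex.
have o0 : orb x (x, 0) by exists 0%N; split; [exact: reach_refl|exact: ltW].
have esc : escapes ec.2 [set ord_max]%SET (nx ord_max).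
  have [||[k ek]//|//] := @exits_or_escapes _ _ _ ec.2 [set ord_max]%SET ord_max.
  - apply: nice_cfree ni _ => m; rewrite finset.in_set1 => /eqP ->; left.
    by rewrite /= /slots leq_addr.
  - by rewrite finset.in_set1.
  - by case: nex; have := exits_in ek; rewrite finset.in_set1 => /eqP kE; rewrite kE in ek.
apply: sim_escapes (ma) (ni) _ _ (esc); first by move=> _; rewrite B0 finset.sub0set.
case: n ec ma ni {B0 nex esc} => [|n] ec ma ni; first by exists 0.
exists 0 => // e A m' ie m'A; have [re _] := nice_local_good ma ni.
have [_ H _ _] := re _ _ ie; have [_ /andP[h _] _] := H _ m'A.
by rewrite off_last ltn0 leNgt h.
Qed.

End mesh.

(* A trajectory at [u] at time [t] crossed the last [j] edges above [u], for the last
   time, at increasing times. *)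
Fixpoint ascent j (u : tvertex d) (t : R) : Prop :=
  if j is j'.+1 then exists r r', [/\ rings u r, r <= t, r' < r & ascent j' (behead u) r']
  else 0 <= t.

Lemma ascent_le j u t t' : t <= t' -> ascent j u t -> ascent j u t'.
Proof.
case: j => [|j] tt' /=; first by move/le_trans; apply.
by move=> [r [r' [ur rt rr' H]]]; exists r, r'; split=> //; apply: le_trans tt'.
Qed.

Lemma ascent_real_incr j u t n : ascent j u t -> t <= T -> (j <= size u)%N ->
  real_incr n u t -> real_incr (j + n) (drop j u) 0.
Proof.
elim: j u t n => [|j IH] u t n.
  by move=> t0 _ _; rewrite drop0; apply: real_incr_lower.
case: u => // i u [r [r' [ur rt rr' H]]] tT ju Hn; rewrite addSnnS -[drop _ _]/(drop j u).
apply: IH H _ _ _ => //; first by rewrite (le_trans (ltW rr')) // (le_trans rt).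
exists i, r; split=> //; first exact: le_trans tT.
exact: real_incr_lower rt Hn.
Qed.

(** A jump down adds a last crossing at its own time; a jump up forgets the latest one. Truncated
    subtraction reduces the claim to [0 <= t] at or above the level of [y]. *)
Lemma reach_ascent (y : tvertex d) p q : reach p q ->
  0 <= p.2 -> ascent (size p.1 - size y) p.1 p.2 -> ascent (size q.1 - size y) q.1 q.2.
Proof.
elim=> // {p q} [[u t]] [u' t'] q ut _ IH /= t0 H; apply: IH => /=.
  by apply: le_trans t0 (ltW (jump_lt ut)).
case: ut => tt' [e [ie re -> _ _]]; rewrite /other_end.
case: ie re => [[-> un]|[i ->]] re.
  rewrite eqxx; case: u H un {re} => // i u H _ /=.
  have [uy|yu] := leqP (size (i :: u)) (size y).
    have -> : (size u - size y = 0)%N by move: uy => /=; lia.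
    by apply: le_trans t0 (ltW tt').
  have E : (size (i :: u) - size y = (size u - size y).+1)%N by move: yu => /=; lia.
  move: H; rewrite E => -[r [r' [_ rt rr' H]]].
  by apply: ascent_le H; rewrite (le_trans (ltW rr')) // (le_trans rt) // ltW.
have -> : (i :: u == u) = false by apply/eqP => /(congr1 size) /=; lia.
have [yu|uy] := leqP (size y) (size u).
  by rewrite /= subSn //; exists t', t.
have -> : (size (i :: u) - size y = 0)%N by move: uy => /=; lia.
by apply: le_trans t0 (ltW tt').
Qed.

Hypothesis no_incr : forall v, exists n, ~ real_incr n v 0.

(** A deep vertex [u] is reached by an increasing path from its ancestor [drop j u] at the level of
    [y]; that level is finite, so the maximum of its bounds serves. *)
Lemma depth_bound (y : tvertex d) :
  exists D, forall u s, reach (y, 0) (u, s) -> s <= T -> (size u <= D)%N.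
Proof.
have [f fP] := choice no_incr.
exists (size y + \max_(v : (size y).-tuple 'I_d) f v)%N => u s yu sT.
rewrite leqNgt; apply/negP => lt.
have := reach_ascent (y := y) yu (lexx 0); rewrite /= subnn => /(_ (lexx 0)) H.
set j := (size u - size y)%N in H; have ju : (j <= size u)%N by apply: leq_subr.
have sv : size (drop j u) == size y by rewrite size_drop subKn // ltnW // (leq_trans _ lt) // ltnS leq_addr.
have := ascent_real_incr (n := 0) H sT ju I; rewrite addn0.
have := leq_bigmax (F := fun v : (size y).-tuple 'I_d => f v) (Tuple sv).
move=> /= fj; apply: contra_not (fP (drop j u)) => Hj.
apply: real_incr_le Hj; apply: leq_trans fj _; rewrite /j -(leq_add2l (size y)) subnKC.
  exact: ltnW.
exact: leq_trans (leq_addr _ _) (ltnW lt).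
Qed.

Lemma infinite_orbit x :
  (forall n, exists u s, orb x (u, s) /\ (size x + n <= size u)%N) ->
  has_infinite_cycle (stir_perm tau T w).
Proof.
move=> far; exists x => /finite_seqP[s cs].
have [D HD] := choice depth_bound.
have [u [t [[k [xu tT]] un]]] := far (\max_(y <- s) D y).+1.
have ks : iter k (stir_perm tau T w) x \in s.
  have : cycle_of (stir_perm tau T w) x (iter k (stir_perm tau T w) x) by exists k; left.
  by rewrite cs.
have := HD _ _ _ xu tT; have := leq_bigmax_seq (P := xpredT) (F := D) _ ks isT.
by move: un; set a := \max_(y <- s) D y; set b := D _; lia.
Qed.

End simulation.

(** * Tools for almost sure statements *)

Section almost_everywhere.
Local Open Scope classical_set_scope.
Local Open Scope ring_scope.
Context {R : realType} {dO : measure_display} {Omega : measurableType dO}.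
Variable P : probability Omega R.

Lemma ae_small (Q : Omega -> Prop) :
  (forall eps : R, 0 < eps -> exists V : set Omega,
     [/\ measurable V, (P V <= eps%:E)%E & forall w, ~ V w -> Q w]) ->
  {ae P, forall w, Q w}.
Proof.
move=> H; have H' k : exists V : set Omega,
    [/\ measurable V, (P V <= (k.+1%:R^-1 : R)%:E)%E & forall w, ~ V w -> Q w].
  by apply: H; rewrite invr_gt0 ltr0n.
have [V HV] := choice H'.
have mV : measurable (\bigcap_k V k) by apply: bigcap_measurable => // k _; case: (HV k).
exists (\bigcap_k V k); split=> //.
  apply/eqP; rewrite eq_le measure_ge0 andbT; apply/lee_addgt0Pr => e e0; rewrite add0e.
  have h : 1 / e < (Num.truncn (1 / e)).+1%:R by apply: truncnS_gt.
  have [mk Pk _] := HV (Num.truncn (1 / e)).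
  apply: le_trans (_ : P (V (Num.truncn (1 / e))) <= _)%E.
    by apply: le_measure; rewrite ?inE // => w; apply.
  apply: le_trans Pk _; rewrite lee_fin -div1r ler_pdivrMr ?ltr0n // mulrC.
  by rewrite -ler_pdivrMr // ltW.
by move=> w /= nQ k _; apply: contrapT => nV; apply: nQ; case: (HV k) => _ _; apply.
Qed.

Lemma ae_countable (I : countType) (Q : I -> Omega -> Prop) :
  (forall i, {ae P, forall w, Q i w}) -> {ae P, forall w, forall i, Q i w}.
Proof.
move=> H.
have : {ae P, forall w, forall n : nat, if unpickle n is Some i then Q i w else True}.
  apply: ae_foralln => n; case: (unpickle n) => [i|]; first exact: H.
  by apply: nearW.
by apply: filterS => w Hw i; have := Hw (pickle i); rewrite pickleK.
Qed.

End almost_everywhere.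

(** * From finite estimates to almost sure infinite cycles *)

Section main.
Local Open Scope classical_set_scope.
Local Open Scope ring_scope.
Context {R : realType} {dO : measure_display} {Omega : measurableType dO}.
Variables (P : probability Omega R) (d : nat) (tau : tvertex d * nat -> Omega -> R).
Hypothesis clocks : poisson_clocks P tau.
Variable T : R.
Hypothesis T0 : 0 < T.

Definition positive (w : Omega) := forall i, 0 < tau i w.

Lemma ae_positive : {ae P, forall w, positive w}.
Proof.
apply: (@ae_countable _ _ _ P (seq 'I_d * nat)%type (fun i w => 0 < tau i w)) => i.
have mA := measurable_tau clocks i (measurable_itv `]0, +oo[).
exists (~` (tau i @^-1` `]0, +oo[)); split.
- exact: measurableC.
- by rewrite probability_setC // (P_tail clocks) // oppr0 expR0 subee.
- by move=> w /= nw; rewrite in_itv /= andbT.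
Qed.

Lemma ae_no_incr : {ae P, forall w, forall v, exists n, positive w -> ~ real_incr tau T w n v 0}.
Proof.
apply: (@ae_countable _ _ _ P (seq 'I_d)
  (fun v w => exists n, positive w -> ~ real_incr tau T w n v 0)) => v.
apply: ae_small => eps eps0.
have [n [N N0 HN]] := no_incr_likely d T0 eps0.
have [V [mV PV HV]] := approximation clocks T0 N0 v
  (fun ec : _ * conf d (slots N) n => nice N ec /\ ~ incr ec.2 0).
exists V; split=> // [|w nV]; first by apply: le_trans PV _; rewrite lee_fin.
exists n => pw; have [ec [ni nincr] ma] := HV w pw nV.
apply: contra_not nincr => /(real_incr_incr T0 pw N0 ma ni); apply.
by case: (n) (ec).
Qed.

Definition reaches (w : Omega) (x : tvertex d) n :=
  exists u s, orb tau T w x (u, s) /\ (size x + n <= size u)%N.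

Lemma succeeds_reaches w N l n v (ec : _ * conf d (slots N) (l + n)) :
  positive w -> (0 < N)%N -> matches tau T v ec w -> nice N ec -> succeeds ec ->
  exists2 x, size x = (size v + l)%N & reaches w x n.
Proof.
move=> pw N0; elim: l v ec => [|l IH] v ec ma ni.
  case=> e0 nex; exists v; first by rewrite addn0.
  exact: (@success_reaches _ _ _ _ _ _ T0 pw N N0 v n ec ma ni e0 nex).
case: ma ni => _ ma [_ _ _ ni] [i si].
have [x sx rx] := IH (i :: v) _ (ma i) (ni i) si.
by exists x => //; rewrite sx /= addSnnS.
Qed.

Lemma reaches_le w x n n' : (n' <= n)%N -> reaches w x n -> reaches w x n'.
Proof.
move=> nn' [u [s [xu un]]]; exists u, s; split=> //.
by apply: leq_trans un; rewrite leq_add2l.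
Qed.

(** If [w] is outside [V n] for infinitely many [n], the pigeonhole principle gives one vertex at
    depth [l] that reaches every level. The other [w] form the increasing union of the sets [W m],
    each contained in [V m], of probability at most [eps]. *)
Lemma ae_reaches (c0 : R) N0 : (2 <= d)%N -> 0 < c0 -> c0 <= 1 ->
  (forall N, (N0 <= N)%N -> forall n t,
      Pr (@wc R (prob T N) d (slots N) n) (fun c => exits c [set t]%SET (nx t) t) <= 1 - c0) ->
  {ae P, forall w, positive w -> exists x, forall n, reaches w x n}.
Proof.
move=> d2 c00 c01 H; apply: ae_small => eps eps0.
have [l Hl] := success_likely T0 d2 c00 c01 H eps0.
have HV n : exists V : set Omega, [/\ measurable V, (P V <= eps%:E)%E &
    forall w, positive w -> ~ V w -> exists2 x, size x = l & reaches w x n].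
  have [N Np HN] := Hl n.
  have [V [mV PV HV]] := approximation clocks T0 Np [::]
    (fun ec : _ * conf d (slots N) (l + n) => succeeds ec /\ nice N ec).
  exists V; split=> // [|w pw nV]; first by apply: le_trans PV _; rewrite lee_fin.
  have [ec [se ni] ma] := HV w pw nV.
  by have [x sx rx] := succeeds_reaches pw Np ma ni se; exists x.
have {HV}[V HV] := choice HV.
pose W m := \bigcap_(n in [set n | (m <= n)%N]) V n.
have mW m : measurable (W m) by apply: bigcap_measurable => [|n _]; [exists m => /=|case: (HV n)].
have mU : measurable (\bigcup_m W m) by apply: bigcup_measurable => m _; exact: mW.
exists (\bigcup_m W m); split=> // [|w nW pw].
  have ndW : {homo W : n m / (n <= m)%N >-> (n <= m)%O}.
    move=> a b ab; apply/subsetPset => w Wa n /= bn; apply: Wa => /=.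
    exact: leq_trans ab bn.
  apply: cvge_le (nondecreasing_cvg_mu mW mU ndW); apply: nearW => m /=.
  have [mV PV _] := HV m; apply: le_trans PV.
  by apply: le_measure; rewrite ?inE // => w; apply => /=.
apply: contrapT => nx.
have nr x : exists n, ~ reaches w x n.
  by apply: contrapT => nn; apply: nx; exists x => n; apply: contrapT => h; apply: nn; exists n.
have [f fP] := choice nr.
pose m := \max_(x : l.-tuple 'I_d) f x.
have [n mn nV] : exists2 n, (m <= n)%N & ~ V n w.
  apply: contrapT => nn; apply: nW; exists m => // n /= mn.
  by apply: contrapT => nV; apply: nn; exists n.
have [_ _ /(_ w pw nV)[x /eqP sx rx]] := HV n.
apply: fP (x) _; apply: reaches_le (rx); apply: leq_trans mn.
exact: (leq_bigmax (F := fun v : l.-tuple 'I_d => f v) (Tuple sx)).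
Qed.

End main.

Theorem theorem3 (R : realType) (eps : R) :
  0 < eps ->
  exists d0 : nat, forall d : nat, (d0 <= d)%N ->
    forall T : R, d%:R^-1 + (7 / 6 + eps) * (d%:R ^+ 2)^-1 <= T -> in_TG d T.
Proof.
move=> eps0; have [d0 [d02 H]] := escape_bound eps0.
exists d0 => d dd0 T hT; have [T0 [c0 c00 [N0 HN0]]] := H d dd0 T hT.
split=> // dO Omega P tau clocks.
have d2 := leq_trans d02 dd0.
(* At depth 0 no walk exits, so the bound reads [0 <= 1 - c0]. *)
have c01 : c0 <= 1.
  have := HN0 (maxn N0 1) (leq_maxl _ _) 0%N ord0; rewrite Pr_false; first by lra.
  by move=> c [].
have Hre := ae_reaches clocks T0 d2 c00 c01 HN0.
move: (ae_positive clocks) (ae_no_incr clocks T0) Hre; apply: filterS3 => w pw ni re.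
have [x rx] := re pw.
by apply: (@infinite_orbit _ _ _ _ _ _ T0 _ x) => // v; have [n Hn] := ni v; exists n; apply: Hn.
Qed.
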